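(* Let $I\subset\mathbb{R}$ be an open interval, $s\in\mathbb{R}$, $m\geq 1$ an integer, and let $a(D)=\sum_{k=0}^{m}(2\pi i)^{-k}a_k\frac{d^k}{dx^k}$, with $a_k\in\mathbb{C}$ and $a_m\neq 0$, be a linear differential operator with constant coefficients of order $m$, considered as $$a(D): H^{s+m}_{0}(I)\subset H^{s}_{loc}(I)\longrightarrow H^{s}_{loc}(I),$$ such that its formal transpose $a(D)'=\sum_{k=0}^{m}(-2\pi i)^{-k}a_k\frac{d^k}{dx^k}$ is hypoelliptic. Let $a(D)^{*}: D(a(D)^{*})\subset H^{-s}_{c}(I)\to H^{-s}_{c}(I)$ be its adjoint. Then: (i) $\sigma_{p}(a(D))\cup\sigma_{r}(a(D))\subset\sigma_{p}(a(D)^{*})\cup\sigma_{r}(a(D)^{*})$; (ii) $\sigma_{p}(a(D)^{*})\subset\sigma_{p}(a(D))\cup\sigma_{r}(a(D))$; (iii) $\sigma_{r}(a(D)^{*})\subset\sigma_{p}(a(D))\cup\sigma_{c}(a(D))$.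
   Context: All function spaces are complex. For $s\in\mathbb{R}$, $H^s(\mathbb{R})=\{u\in\mathcal{S}'(\mathbb{R}): (1+|\xi|^2)^{s/2}\hat u\in L^2(\mathbb{R})\}$ with norm $\|(1+|\xi|^2)^{s/2}\hat u\|_{L^2}$. $H^s_{loc}(I)$ is the set of $u\in\mathcal{D}'(I)$ such that $\phi u\in H^s(\mathbb{R})$ for all $\phi\in C_c^\infty(I)$. It is a Fréchet space with the seminorms $p^{(s)}_j(u)=\|\varphi_j u\|_{H^s(\mathbb{R})}$, where $I_j=(a_j,b_j)$, $[a_j,b_j]\subset(a_{j+1},b_{j+1})$, $I=\bigcup_j[a_j,b_j]$, $\varphi_j\in C_c^\infty(I_{j+1})$ and $\varphi_j=1$ on $[a_j,b_j]$. $H^{r}_0(I)$ denotes the closure of $C_c^\infty(I)$ in $H^{r}(I)$, where $H^r(I)$ is the usual Sobolev space on $I$. As the domain of $a(D)$, $H^{s+m}_0(I)$ carries the topology induced from $H^s_{loc}(I)$. $H^{-s}_c(I)$ is the space of distributions in $H^{-s}(\mathbb{R})$ with compact support contained in $I$. It is identified with the dual $[H^s_{loc}(I)]'$ via the bilinear pairing $\langle g,u\rangle=\langle g,\varphi u\rangle$ ($\varphi\in C_c^\infty(I)$, $\varphi=1$ near $\mathrm{supp}\,g$) extending $\int g u\,dx$, and is equipped with the weak* topology. The adjoint: $D(a(D)^* )$ is the set of $g\in H^{-s}_c(I)$ such that $u\mapsto\langle g,a(D)u\rangle$, $u\in H^{s+m}_0(I)$, is continuous for the topology induced by $H^s_{loc}(I)$.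 For such $g$, $a(D)^*g\in H^{-s}_c(I)=[H^s_{loc}(I)]'$ is the unique continuous extension of this functional to $H^s_{loc}(I)$. Hypoellipticity: a constant coefficient differential operator $P$ on $I$ is hypoelliptic if $\mathrm{sing\,supp}(Pu)=\mathrm{sing\,supp}\,u$ for every $u\in\mathcal{D}'(I)$. Spectrum: for a linear operator $A:D(A)\subset X\to X$, where $X$ is either $H^s_{loc}(I)$ with its Fréchet topology or $H^{-s}_c(I)$ with the weak* topology, $\sigma_p(A)$ is the set of $\lambda\in\mathbb{C}$ with $\lambda-A$ not injective. $\sigma_r(A)$ is the set of $\lambda$ with $\lambda-A$ injective and $\overline{R(\lambda-A)}\neq X$. $\sigma_c(A)$ is the set of $\lambda$ with $\lambda-A$ injective, $\overline{R(\lambda-A)}=X$, and $(\lambda-A)^{-1}:R(\lambda-A)\to X$ not continuous. Here $R(\cdot)$ denotes the range. *)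

(* Defs.v *)
From HB Require Import structures.
From mathcomp Require Import all_boot all_order all_algebra.
From mathcomp Require Import complex.
From mathcomp Require Import all_classical all_reals all_analysis.

Set Implicit Arguments.
Unset Strict Implicit.
Unset Printing Implicit Defensive.
Import Order.TTheory GRing.Theory Num.Theory.
Import numFieldNormedType.Exports.
Import Normc.

Local Open Scope classical_set_scope.
Local Open Scope complex_scope.
Local Open Scope ring_scope.

Section real_smooth.
Context {R : realType}.
Implicit Types (g h : R -> R) (a b x : R) (n : nat).

Definition rsmooth_on (V : set R) g :=
  forall n x, V x -> derivable (derive1n n g) x 1.

Definition Cn n g := forall k, (k < n)%N -> forall x, derivable (derive1n k g) x 1.

Lemma CnW m n g : (m <= n)%N -> Cn n g -> Cn m g.
Proof. by move=> mn cg k km; apply: cg; exact: leq_trans km mn. Qed.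

Lemma Cn_smooth g : (forall n, Cn n g) <-> rsmooth_on setT g.
Proof.
by split=> [cg n x _|sg n k _ x]; [exact: (cg n.+1 n)|exact: sg].
Qed.

Let linE g h a b : (fun y => a * g y + b * h y) = (a *: g + b *: h).
Proof. by []. Qed.

Lemma derive1n_lin a b g h n : Cn n g -> Cn n h ->
  derive1n n (fun x => a * g x + b * h x) =
  (fun x => a * derive1n n g x + b * derive1n n h x).
Proof.
elim: n => [//|n IH] cg ch.
rewrite derive1nS IH; [|exact: CnW cg|exact: CnW ch].
apply/funext => x; rewrite !derive1nS /= !derive1E.
have dg := cg n (ltnSn n) x; have dh := ch n (ltnSn n) x.
rewrite linE (deriveD (derivableZ (k:=a) dg) (derivableZ (k:=b) dh)).
by rewrite (deriveZ _ dg) (deriveZ _ dh).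
Qed.

Lemma Cn_lin a b g h n : Cn n g -> Cn n h -> Cn n (fun x => a * g x + b * h x).
Proof.
move=> cg ch k kn x.
rewrite derive1n_lin; [|exact: CnW (ltnW kn) cg|exact: CnW (ltnW kn) ch].
by rewrite linE; apply: derivableD; apply: derivableZ; [exact: cg|exact: ch].
Qed.

Lemma Cn_derive1 n g : Cn n.+1 g -> Cn n (derive1 g).
Proof. by move=> cg k kn x; rewrite -derive1Sn; exact: cg. Qed.

Lemma CnM n g h : Cn n g -> Cn n h -> Cn n (fun x => g x * h x).
Proof.
elim: n g h => [|n IH] g h cg ch; first by move=> k; rewrite ltn0.
move=> [_ x|k kn x].
  by apply: derivableM; [exact: (cg 0%N)|exact: (ch 0%N)].
have -> : derive1n k.+1 (fun x => g x * h x)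
    = derive1n k (fun x => 1 * (g x * derive1 h x) + 1 * (h x * derive1 g x)).
  rewrite derive1Sn; congr (derive1n k _).
  apply/funext => y; rewrite derive1E !mul1r !derive1E.
  by rewrite (@deriveM _ _ g h)//; [exact: (cg 0%N)|exact: (ch 0%N)].
have cg' := CnW (leqnSn n) cg; have ch' := CnW (leqnSn n) ch.
have dg := Cn_derive1 cg; have dh := Cn_derive1 ch.
exact: (@Cn_lin 1 1 _ _ n (IH _ _ cg' dh) (IH _ _ ch' dg) k kn).
Qed.

Lemma rsmooth_lin a b g h : rsmooth_on setT g -> rsmooth_on setT h ->
  rsmooth_on setT (fun x => a * g x + b * h x).
Proof.
by move=> /Cn_smooth sg /Cn_smooth sh; apply/Cn_smooth => n; exact: (@Cn_lin a b g h n (sg n) (sh n)).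
Qed.

Lemma rsmoothM g h : rsmooth_on setT g -> rsmooth_on setT h ->
  rsmooth_on setT (fun x => g x * h x).
Proof.
by move=> /Cn_smooth sg /Cn_smooth sh; apply/Cn_smooth => n; exact: (CnM (sg n) (sh n)).
Qed.

Lemma rsmooth_derive1n g n : rsmooth_on setT g -> rsmooth_on setT (derive1n n g).
Proof. by move=> sg k x _; rewrite /derive1n -iterD; exact: sg. Qed.

Lemma derive1n_cst0 n : derive1n n (fun _ : R => 0 : R) = fun=> 0.
Proof.
elim: n => [//|n IH]; rewrite derive1nS IH.
by apply/funext => x; rewrite derive1E derive_cst.
Qed.

Lemma rsmooth0 : rsmooth_on setT (fun _ : R => 0 : R).
Proof. by move=> n x _; rewrite derive1n_cst0; exact: derivable_cst. Qed.

Lemma derive1n_open0 (U : set R) g n : open U -> (forall x, U x -> g x = 0) ->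
  forall x, U x -> derive1n n g x = 0.
Proof.
move=> oU g0; elim: n => [//|n IH] x Ux.
rewrite derive1nS derive1E (_ : 0 = 'D_1 (cst 0 : R -> R) x); last by rewrite derive_cst.
apply: near_eq_derive.
by near=> y; apply: IH; near: y; exact: open_nbhs_nbhs.
Unshelve. all: by end_near. Qed.

Lemma rsmooth_bounded (K : set R) g : compact K -> (forall x, ~ K x -> g x = 0) ->
  rsmooth_on setT g -> exists M : R, forall x, `|g x| <= M.
Proof.
move=> cK g0 sg.
have cg : continuous g.
  by move=> x; apply/differentiable_continuous/derivable1_diffP; exact: (sg 0%N).
have cgK : compact (g @` K).
  by apply: continuous_compact => //; exact: continuous_subspaceT.
have [M [_ HM]] := compact_bounded cgK.
exists (`|M| + 1) => x; have [Kx|nKx] := pselect (K x).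
  by apply: (HM (`|M| + 1)); [rewrite (le_lt_trans (ler_norm _))// ltrDl|exists x].
by rewrite g0// normr0 addr_ge0.
Qed.

End real_smooth.
Arguments derive1n_lin {R} a b {g h n}.
Arguments Cn_lin {R} a b {g h n}.
Arguments rsmooth_lin {R} a b {g h}.

Section complex_functions.
Context {R : realType}.
Local Notation C := (R[i]^o).
Implicit Types (f g : R -> C).

Definition ReF f (x : R) : R := complex.Re (f x).
Definition ImF f (x : R) : R := complex.Im (f x).

(* complex-valued functions of a real variable are differentiated, measured
   and integrated componentwise *)
Definition smooth_on (V : set R) f := rsmooth_on V (ReF f) /\ rsmooth_on V (ImF f).

Definition cderiv (n : nat) f : R -> C :=
  fun x => derive1n n (ReF f) x +i* derive1n n (ImF f) x.

Definition cmeasurable f :=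
  measurable_fun setT (ReF f) /\ measurable_fun setT (ImF f).

Definition cint f : C :=
  Rintegral (@lebesgue_measure R) setT (ReF f) +i*
  Rintegral (@lebesgue_measure R) setT (ImF f).

Definition tsupport f : set R := closure [set x | f x != 0].

Lemma ReF_lin f g (a b : R) : ReF ((a +i* b) *: f + g) =
  (fun x => 1 * (a * ReF f x + (- b) * ImF f x) + 1 * ReF g x).
Proof.
apply/funext => x; rewrite /ReF /ImF !mul1r mulNr.
rewrite -[LHS]/(complex.Re ((a +i* b) * (f x : R[i]) + g x)).
by case: (f x) => u v; case: (g x).
Qed.

Lemma ImF_lin f g (a b : R) : ImF ((a +i* b) *: f + g) =
  (fun x => 1 * (a * ImF f x + b * ReF f x) + 1 * ImF g x).
Proof.
apply/funext => x; rewrite /ReF /ImF !mul1r.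
rewrite -[LHS]/(complex.Im ((a +i* b) * (f x : R[i]) + g x)).
by case: (f x) => u v; case: (g x).
Qed.

Lemma cderivE f g (c : R[i]) n : smooth_on setT f -> smooth_on setT g ->
  cderiv n (c *: f + g) = c *: cderiv n f + cderiv n g.
Proof.
case: c => a b [/Cn_smooth f1 /Cn_smooth f2] [/Cn_smooth g1 /Cn_smooth g2].
apply/funext => x; rewrite /cderiv ReF_lin ImF_lin.
rewrite (derive1n_lin 1 1 (Cn_lin a (- b) (f1 n) (f2 n)) (g1 n)).
rewrite (derive1n_lin 1 1 (Cn_lin a b (f2 n) (f1 n)) (g2 n)).
rewrite (derive1n_lin a (- b) (f1 n) (f2 n)) (derive1n_lin a b (f2 n) (f1 n)).
rewrite -[RHS]/((a +i* b) * (derive1n n (ReF f) x +i* derive1n n (ImF f) x) +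
   (derive1n n (ReF g) x +i* derive1n n (ImF g) x)).
by rewrite !mul1r mulNr.
Qed.

Lemma smooth_lin f g (c : R[i]) : smooth_on setT f -> smooth_on setT g ->
  smooth_on setT (c *: f + g).
Proof.
case: c => a b [f1 f2] [g1 g2]; rewrite /smooth_on ReF_lin ImF_lin.
split.
  exact: (rsmooth_lin 1 1 (rsmooth_lin a (- b) f1 f2) g1).
exact: (rsmooth_lin 1 1 (rsmooth_lin a b f2 f1) g2).
Qed.

Lemma smooth0 : smooth_on setT (0 : R -> C).
Proof. by split; exact: rsmooth0. Qed.

Lemma cderiv0 n : cderiv n 0 = 0.
Proof.
have := @cderivE 0 0 (-1) n smooth0 smooth0.
by rewrite scaleN1r addNr scaleN1r addNr.
Qed.

Lemma smooth_cderiv f n : smooth_on setT f -> smooth_on setT (cderiv n f).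
Proof. by move=> [f1 f2]; split; exact: rsmooth_derive1n. Qed.

Lemma smoothM f g : smooth_on setT f -> smooth_on setT g ->
  smooth_on setT (fun x => f x * g x).
Proof.
move=> [f1 f2] [g1 g2]; split.
  rewrite (_ : ReF _ = fun x => 1 * (ReF f x * ReF g x) + (-1) * (ImF f x * ImF g x)).
    exact: (rsmooth_lin 1 (-1) (rsmoothM f1 g1) (rsmoothM f2 g2)).
  apply/funext => x; rewrite /ReF /ImF mul1r mulN1r.
  by case: (f x) => u v; case: (g x).
rewrite (_ : ImF _ = fun x => 1 * (ReF f x * ImF g x) + 1 * (ImF f x * ReF g x)).
  exact: (rsmooth_lin 1 1 (rsmoothM f1 g2) (rsmoothM f2 g1)).
apply/funext => x; rewrite /ReF /ImF !mul1r.
by case: (f x) => u v; case: (g x).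
Qed.

Lemma cderiv_out f n x : ~ tsupport f x -> cderiv n f x = 0.
Proof.
move=> nx; have oV : open (~` tsupport f) by exact/closed_openC/closed_closure.
have f0 y : (~` tsupport f) y -> f y = 0.
  by move=> ny; apply: contrapT => fy; apply: ny; apply: subset_closure; exact/eqP.
rewrite /cderiv !(derive1n_open0 (U := ~` tsupport f))//.
- by move=> y /f0 fy; rewrite /ImF fy.
- by move=> y /f0 fy; rewrite /ReF fy.
Qed.

Lemma tsupport_sub f (K : set R) : closed K -> (forall x, ~ K x -> f x = 0) ->
  tsupport f `<=` K.
Proof.
move=> cK f0; rewrite (closure_id K).1//; apply: closure_subset => x /= fx.
by apply: contrapT => /f0 /eqP; rewrite (negbTE fx).
Qed.

End complex_functions.

Section test_functions.
Context {R : realType}.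
Local Notation C := (R[i]^o).

Definition test_pred (I : set R) : {pred (R -> C)} := fun f =>
  `[< [/\ smooth_on setT f, compact (tsupport f) & tsupport f `<=` I] >].

Lemma test_predP I f :
  reflect (exists K : set R, [/\ smooth_on setT f, compact K, K `<=` I &
             forall x, ~ K x -> f x = 0]) (f \in test_pred I).
Proof.
apply: (iffP (asboolP _)) => [[sf cf fI]|[K [sf cK KI f0]]].
  exists (tsupport f); split => // x nx.
  by apply: contrapT => fx; apply: nx; apply: subset_closure; exact/eqP.
have fK : tsupport f `<=` K.
  by apply: tsupport_sub => //; apply: compact_closed => //; exact: Rhausdorff.
split => //; last exact: subset_trans KI.
by apply: subclosed_compact cK fK; exact: closed_closure.
Qed.

Lemma test_submod (I : set R) : GRing.submod_closed (test_pred I).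
Proof.
split.
  apply/test_predP; exists set0; split => //; [exact: smooth0|exact: compact0].
move=> c f g /test_predP[K [sf cK KI f0]] /test_predP[L [sg cL LI g0]].
apply/test_predP; exists (K `|` L); split.
- exact: smooth_lin.
- exact: compactU.
- by move=> x [/KI|/LI].
- move=> x nKL; rewrite !fctE f0 ?g0 ?scaler0 ?addr0//.
    by move=> Lx; apply: nKL; right.
  by move=> Kx; apply: nKL; left.
Qed.

HB.instance Definition _ (I : set R) :=
  GRing.isSubmodClosed.Build R[i] (R -> C) (test_pred I) (test_submod I).

Record test (I : set R) := Test {
  test_val :> R -> C ;
  testP : test_val \in test_pred I }.
HB.instance Definition _ I := [isSub for @test_val I].
HB.instance Definition _ I := [Choice of test I by <:].
HB.instance Definition _ I := [SubChoice_isSubLmodule of test I by <:].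

Definition schwartz_pred : {pred (R -> C)} := fun f =>
  `[< smooth_on setT f /\
      forall k n : nat, exists M : R, forall x, `|x| ^+ k * normc (cderiv n f x) <= M >].

Lemma schwartz_submod : GRing.submod_closed schwartz_pred.
Proof.
split.
  apply/asboolP; split=> [|k n]; first exact: smooth0.
  by exists 0 => x; rewrite cderiv0 normc0 mulr0.
move=> c f g /asboolP[sf bf] /asboolP[sg bg]; apply/asboolP.
split=> [|k n]; first exact: smooth_lin.
have [M HM] := bf k n; have [N HN] := bg k n.
exists (normc c * M + N) => x; rewrite cderivE//.
rewrite (@le_trans _ _ (`|x| ^+ k * (normc (c * cderiv n f x) + normc (cderiv n g x))))//.
  by rewrite ler_wpM2l ?exprn_ge0//; exact: le_normcD.
rewrite mulrDr lerD// normcM mulrCA ler_wpM2l//.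
by case: c => ? ?; exact: sqrtr_ge0.
Qed.

HB.instance Definition _ :=
  GRing.isSubmodClosed.Build R[i] (R -> C) schwartz_pred schwartz_submod.

Record schwartz := Schwartz {
  schwartz_val :> R -> C ;
  schwartzP : schwartz_val \in schwartz_pred }.
HB.instance Definition _ := [isSub for schwartz_val].
HB.instance Definition _ := [Choice of schwartz by <:].
HB.instance Definition _ := [SubChoice_isSubLmodule of schwartz by <:].

Lemma test_deriv_subproof I n (phi : test I) : cderiv n phi \in test_pred I.
Proof.
have /asboolP[sf cf fI] := testP phi.
apply/test_predP; exists (tsupport phi); split.
- exact: smooth_cderiv.
- exact: cf.
- exact: fI.
- by move=> x; exact: cderiv_out.
Qed.
Definition test_deriv I n (phi : test I) : test I := Test (test_deriv_subproof n phi).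

Lemma test_mul_subproof I (phi : test I) (psi : schwartz) :
  (fun x => phi x * psi x) \in test_pred I.
Proof.
have /test_predP[K [sf cK KI f0]] := testP phi.
have /asboolP[sg _] := schwartzP psi.
apply/test_predP; exists K; split.
- exact: smoothM.
- exact: cK.
- exact: KI.
- by move=> x /f0 ->; rewrite mul0r.
Qed.
Definition test_mul I (phi : test I) (psi : schwartz) : test I :=
  Test (test_mul_subproof phi psi).

Lemma test_schwartz_subproof I (phi : test I) : (phi : R -> C) \in schwartz_pred.
Proof.
have /asboolP[sf cf _] := testP phi.
apply/asboolP; split=> // k n.
have [s1 s2] := smooth_cderiv n sf.
have o x : ~ tsupport phi x -> cderiv n phi x = 0 by exact: cderiv_out.
have [M1 H1] : exists M : R, forall x, `|ReF (cderiv n phi) x| <= M.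
  by apply: rsmooth_bounded cf _ s1 => x /o; rewrite /ReF => ->.
have [M2 H2] : exists M : R, forall x, `|ImF (cderiv n phi) x| <= M.
  by apply: rsmooth_bounded cf _ s2 => x /o; rewrite /ImF => ->.
have [B [_ HB]] := compact_bounded cf.
exists ((`|B| + 1) ^+ k * (M1 + M2)) => x.
have MM : normc (cderiv n phi x) <= M1 + M2.
  move: (H1 x) (H2 x); rewrite /ReF /ImF; case: (cderiv n phi x) => u v /= Hu Hv.
  apply: le_trans (lerD Hu Hv).
  rewrite -[leRHS]ger0_norm ?addr_ge0// -sqrtr_sqr ler_wsqrtr//.
  rewrite sqrrD !real_normK ?num_real// -addrA lerD2l addrC lerDl.
  by rewrite mulrn_wge0// mulr_ge0.
have [Sx|nSx] := pselect (tsupport phi x).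
  rewrite ler_pM ?exprn_ge0//; last first.
    rewrite lerXn2r ?nnegrE// ?addr_ge0//; apply: (HB (`|B| + 1)) => //.
    by rewrite (le_lt_trans (ler_norm _))// ltrDl.
  by case: (cderiv n phi x) => ? ?; exact: sqrtr_ge0.
rewrite o// normc0 mulr0 mulr_ge0 ?exprn_ge0 ?addr_ge0//.
  exact: le_trans (H1 x).
exact: le_trans (H2 x).
Qed.
Definition test_schwartz I (phi : test I) : schwartz :=
  Schwartz (test_schwartz_subproof phi).

End test_functions.
Arguments schwartz : clear implicits.

Section distributions.
Context {R : realType}.
Local Notation C := (R[i]^o).
Implicit Types (I V K : set R) (s : R).

Definition distr_on I : set (test I -> C) := [set u | linear u /\
  forall K, compact K -> K `<=` I -> exists (N : nat) (c : R),
    forall (phi : test I) (M : R), tsupport phi `<=` K ->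
      (forall n x, (n <= N)%N -> normc (cderiv n phi x) <= M) ->
      normc (u phi) <= c * M].

Definition tempered : set (schwartz R -> C) := [set T | linear T /\
  exists (N : nat) (c : R), forall (psi : schwartz R) (M : R),
    (forall k n x, (k <= N)%N -> (n <= N)%N ->
       `|x| ^+ k * normc (cderiv n psi x) <= M) ->
    normc (T psi) <= c * M].

Definition dist_of_fun I (f : R -> C) : test I -> C :=
  fun phi => cint (fun x => f x * phi x).

Definition tempered_of_fun (f : R -> C) : schwartz R -> C :=
  fun psi => cint (fun x => f x * psi x).

Definition dist_restrict I (T : schwartz R -> C) : test I -> C :=
  fun phi => T (test_schwartz phi).

(* the product [phi u], extended by zero outside [I] *)
Definition cutoff I (phi : test I) (u : test I -> C) : schwartz R -> C :=
  fun psi => u (test_mul phi psi).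

Definition dsupport (T : schwartz R -> C) : set R :=
  ~` [set x | exists V, [/\ open V, V x & forall phi : test V, dist_restrict T phi = 0]].

Definition sing_support I (u : test I -> C) : set R :=
  I `&` ~` [set x | exists V, [/\ open V, V x, V `<=` I &
    exists2 f : R -> C, smooth_on V f &
      forall phi : test I, tsupport phi `<=` V -> u phi = dist_of_fun f phi]].

(* [\sum_k c_k u^(k)], where [u^(k) phi = (-1)^k u (phi^(k))] *)
Definition diff_op I m (c : 'I_m.+1 -> R[i]) (u : test I -> C) : test I -> C :=
  fun phi => \sum_(k < m.+1) c k * ((-1) ^+ k * (u (test_deriv k phi) : R[i])).

Definition hypoelliptic I (P : (test I -> C) -> (test I -> C)) :=
  forall u, distr_on u -> sing_support (P u) = sing_support u.

Definition opD I m (a : 'I_m.+1 -> R[i]) : (test I -> C) -> (test I -> C) :=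
  diff_op (fun k => (0 +i* (2 * pi)) ^- k * a k).

Definition opD_transpose I m (a : 'I_m.+1 -> R[i]) : (test I -> C) -> (test I -> C) :=
  diff_op (fun k => (- (0 +i* (2 * pi))) ^- k * a k).

Definition fourier (f : R -> C) : R -> C := fun xi =>
  cint (fun x => f x * (cos (2 * pi * x * xi) -i* sin (2 * pi * x * xi))).

(* [||(1 + xi^2)^(s/2) w||_(L^2)] *)
Definition weighted_norm s (w : R -> C) : \bar R :=
  Lnorm (@lebesgue_measure R) 2%:E
    (fun xi => (((1 + xi ^+ 2) `^ (s / 2)) * normc (w xi))%:E).

(* The Fourier transform of [T] is the function [w]. By definition that
   transform maps [psi] to [T (fourier psi)]; [chi] below is [fourier psi]
   seen as an element of the Schwartz space. *)
Definition fourier_repr s (T : schwartz R -> C) (w : R -> C) :=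
  [/\ cmeasurable w, (weighted_norm s w < +oo)%E &
    forall psi chi : schwartz R, schwartz_val chi = fourier psi ->
      T chi = tempered_of_fun w psi].

Definition Hs s : set (schwartz R -> C) :=
  [set T | tempered T /\ exists w, fourier_repr s T w].

Definition fourier_fun s (T : schwartz R -> C) : R -> C :=
  xget (cst 0) [set w | fourier_repr s T w].

Definition Hs_norm s (T : schwartz R -> C) : R :=
  fine (weighted_norm s (fourier_fun s T)).

(* the bilinear duality between H^(-s)(R) and H^s(R) which extends
   [\int g v dx], by Parseval's formula *)
Definition Hs_pairing s (g v : schwartz R -> C) : C :=
  cint (fun xi => fourier_fun (- s) g xi * fourier_fun s v (- xi)).

Definition Hloc s I : set (test I -> C) :=
  [set u | distr_on u /\ forall phi : test I, Hs s (cutoff phi u)].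

(* H^s(I): restrictions to [I] of elements of H^s(R), with the quotient norm *)
Definition HI s I : set (test I -> C) := @dist_restrict I @` Hs s.

Definition HI_norm s I (u : test I -> C) : R :=
  inf (Hs_norm s @` [set T | Hs s T /\ dist_restrict T = u]).

Definition Hc s I : set (schwartz R -> C) :=
  [set g | [/\ Hs s g, compact (dsupport g) & dsupport g `<=` I]].

(* The value does not depend on the choice of [phi]. *)
Definition pairing s I (g : schwartz R -> C) (u : test I -> C) : C :=
  xget 0 [set z | exists2 phi : test I,
    set_nbhs (dsupport g) [set x | phi x = 1] &
    z = Hs_pairing s g (cutoff phi u)].

Record exhaustion I := Exhaustion {
  exh_left : nat -> R ;
  exh_right : nat -> R ;
  exh_fun : nat -> test I ;
  exh_lt : forall j, exh_left j < exh_right j ;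
  exh_nested : forall j,
    `[exh_left j, exh_right j]%classic `<=` `]exh_left j.+1, exh_right j.+1[%classic ;
  exh_cover : I = \bigcup_j `[exh_left j, exh_right j]%classic ;
  exh_support : forall j, 
    tsupport (exh_fun j) `<=` `]exh_left j.+1, exh_right j.+1[%classic ;
  exh_eq1 : forall j x, x \in `[exh_left j, exh_right j] -> exh_fun j x = 1 }.

End distributions.

Arguments distr_on {R} I _.
Arguments Hloc {R} s I _.
Arguments HI {R} s I _.
Arguments Hc {R} s I _.

(* A subset of a vector space with a family of seminorms; the subspace and
   seminorm laws are not needed to define the topology. *)
Record lcs (R : realType) := Lcs {
  lcs_ambient : lmodType R[i] ;
  lcs_set : set lcs_ambient ;
  lcs_index : Type ;
  lcs_seminorm : lcs_index -> lcs_ambient -> R }.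

Definition lcs_sort (R : realType) (X : lcs R) : Type := set_type (@lcs_set R X).
Coercion lcs_sort : lcs >-> Sortclass.

Section lcs_topology.
Context {R : realType} (X : lcs R).

HB.instance Definition _ := Choice.on (lcs_sort X).

Definition lcs_val (x : X) : lcs_ambient X := set_val x.

Definition lcs_ball (j : lcs_index X) (x : X) (r : R) : set X :=
  [set y | lcs_seminorm j (lcs_val y - lcs_val x) < r].

Definition lcs_subbase : set (set X) :=
  [set B | exists j x r, 0 < r /\ B = lcs_ball j x r].

HB.instance Definition _ := isSubBaseTopological.Build (lcs_sort X) lcs_subbase id.

End lcs_topology.

(* A partially defined operator; the values of [op_fun] outside [op_dom] are
   irrelevant. *)
Record operator (R : realType) (X : lcs R) := Operator {
  op_dom : set (lcs_ambient X) ;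
  op_fun : lcs_ambient X -> lcs_ambient X }.

Section spectrum.
Context {R : realType} {X : lcs R} (A : operator X).
Implicit Types l : R[i].

Definition shifted l (u : lcs_ambient X) : lcs_ambient X := l *: u - op_fun A u.

Definition shifted_injective l := set_inj (op_dom A) (shifted l).

Definition shifted_range l : set X :=
  [set y | (shifted l @` op_dom A) (lcs_val y)].

(* continuity of the inverse of [l - A], defined on the range of [l - A] *)
Definition shifted_inverse_continuous l := exists S : X -> X,
  (forall u y : X, op_dom A (lcs_val u) -> lcs_val y = shifted l (lcs_val u) -> S y = u) /\
  {within shifted_range l, continuous S}.

Definition sigma_p : set R[i] := [set l | ~ shifted_injective l].

Definition sigma_r : set R[i] :=
  [set l | shifted_injective l /\ closure (shifted_range l) <> setT].

Definition sigma_c : set R[i] :=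
  [set l | [/\ shifted_injective l, closure (shifted_range l) = setT &
               ~ shifted_inverse_continuous l]].

End spectrum.

Section spaces.
Context {R : realType}.
Local Notation C := (R[i]^o).
Implicit Types (I : set R) (s : R).

Definition Hloc_space s I (e : exhaustion I) : lcs R :=
  @Lcs R (test I -> C : lmodType R[i]) (Hloc s I) nat
    (fun j u => Hs_norm s (cutoff (exh_fun e j) u)).

(* H^(-s)_c(I) with the weak* topology *)
Definition Hc_space s I : lcs R :=
  @Lcs R (schwartz R -> C : lmodType R[i]) (Hc (- s) I) (set_type (Hloc s I))
    (fun u g => normc (pairing s g (set_val u))).

Definition HI_space s I : lcs R :=
  @Lcs R (test I -> C : lmodType R[i]) (HI s I) unit (fun _ u => HI_norm s u).

Definition H0 s I : set (test I -> C) :=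
  [set lcs_val u | u in closure [set u : HI_space s I |
      exists phi : test I, lcs_val u = (dist_of_fun phi : test I -> C)]].

Definition aD s I (e : exhaustion I) m (a : 'I_m.+1 -> R[i]) :
    operator (Hloc_space s e) :=
  @Operator R (Hloc_space s e) (@H0 (s + m%:R) I) (@opD R I m a).

(* [H^s_loc(I)]' is identified with [H^(-s)_c(I)] through [pairing]: the
   continuous extension of the functional is the element [h] below. *)
Definition adjoint s I (e : exhaustion I) (A : operator (Hloc_space s e)) :
    operator (Hc_space s I) :=
  @Operator R (Hc_space s I)
    [set g | Hc (- s) I g /\
      {within [set u : Hloc_space s e | op_dom A (lcs_val u)],
        continuous (fun u : Hloc_space s e => pairing s g (op_fun A (lcs_val u)) : C)}]
    (fun g => xget 0 [set h | Hc (- s) I h /\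
      forall u, op_dom A u -> pairing s h u = pairing s g (op_fun A u)]).

End spaces.

(* Main.v *)
(* The ordinary differential equation (lambda - a(D)) y = f has a smooth
   solution on every bounded interval.  Cutting such solutions off far away
   shows that lambda - a(D) has dense range; since p_j only sees a compact part
   of I, cutting off an exponential solution of the homogeneous equation gives
   functions that are not small while their images vanish for the first
   seminorms, so the inverse of lambda - a(D) is never continuous.  Hence
   sigma_r(a(D)) is empty and sigma_p(a(D)), sigma_c(a(D)) cover the plane.
   Solving the equation on a neighbourhood of a compact set also shows that
   lambda - a(D)^* is injective.  Finally an eigenvector of a(D) annihilates the
   range of lambda - a(D)^*, which is therefore not weak* dense.

   That a(D)^* g exists as an element of H^(-s)_c(I) rests on this: the Fourier
   transform W of a compactly supported element of some H^t is smooth, and if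
   |int W psi| <= C ||psi||_s for Schwartz psi, testing on truncations of
   <xi>^(-2s) conj(W) gives W in the weighted L^2 space of order -s. *)
Require Import Defs.
From mathcomp Require Import all_boot all_order all_algebra.
From mathcomp Require Import complex.
From mathcomp Require Import all_classical all_reals all_analysis.
From mathcomp Require Import measurable_realfun.
From mathcomp Require Import ring lra.

Set Implicit Arguments.
Unset Strict Implicit.
Unset Printing Implicit Defensive.
Import Order.TTheory GRing.Theory Num.Theory.
Import numFieldNormedType.Exports.
Import Normc.
Local Open Scope classical_set_scope.
Local Open Scope complex_scope.
Local Open Scope ring_scope.

(** * Complex-valued functions of a real variable *)

Section complex_derivative.
Context {R : realType}.
Local Notation C := (R[i]^o).
Local Notation Re := complex.Re.
Local Notation Im := complex.Im.
Implicit Types (f g : R -> C) (x a b : R) (z w : R[i]).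

(** [Hs_norm] and [Hs_pairing] are computed from a Fourier representative picked by choice, so
    nothing can be said about them before representatives are known to be unique almost everywhere;
    this is why Fourier inversion and Lebesgue differentiation are developed. After that an element
    of [H^s] is a function in a weighted L^2 space, multiplication by a test function is convolution
    with a Schwartz kernel, and a(D) is multiplication by a polynomial.

    The exhaustion supplies the cut-off functions: one of them, made nonnegative and rescaled, is
    the [bump] behind every truncation and partition.

    The domain of a(D) is a closure in a quotient norm. Density of the range and discontinuity of
    the inverse are seen on the test functions inside it; a general element is reached by
    restriction from the line and by approximation. The value of the adjoint at g is also a choice:
    on test functions it must be the transposed operator applied to g, and the work lies in lowering
    the loss of m derivatives to none. Algebraic closedness enters twice: splitting the polynomial
    solves the equation, and its degree m >= 1 yields an exponential solution. *)

Lemma cReD z w : Re (z + w) = Re z + Re w. Proof. by case: z; case: w. Qed.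
Lemma cImD z w : Im (z + w) = Im z + Im w. Proof. by case: z; case: w. Qed.
Lemma cReN z : Re (- z) = - Re z. Proof. by case: z. Qed.
Lemma cImN z : Im (- z) = - Im z. Proof. by case: z. Qed.
Lemma cReM z w : Re (z * w) = Re z * Re w - Im z * Im w.
Proof. by case: z => ? ?; case: w. Qed.
Lemma cImM z w : Im (z * w) = Re z * Im w + Im z * Re w.
Proof. by case: z => ? ?; case: w. Qed.
Lemma complex_ext z w : Re z = Re w -> Im z = Im w -> z = w.
Proof. by case: z => ? ?; case: w => ? ? /= -> ->. Qed.
Definition RIE := (cReD, cImD, cReN, cImN, cReM, cImM).

Lemma normc_ge0 z : 0 <= normc z. Proof. by case: z => ? ?; exact: sqrtr_ge0. Qed.
Lemma normcE z : normc z = Num.sqrt (Re z ^+ 2 + Im z ^+ 2). Proof. by case: z. Qed.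
Lemma sqr_normcE z : normc z ^+ 2 = Re z ^+ 2 + Im z ^+ 2.
Proof. by rewrite normcE sqr_sqrtr// addr_ge0// sqr_ge0. Qed.
Lemma normc_Re z : `|Re z| <= normc z.
Proof.
by rewrite normcE -sqrtr_sqr ler_wsqrtr// lerDl sqr_ge0.
Qed.
Lemma normc_Im z : `|Im z| <= normc z.
Proof. by rewrite normcE -sqrtr_sqr ler_wsqrtr// lerDr sqr_ge0. Qed.
Lemma normc_le z : normc z <= `|Re z| + `|Im z|.
Proof.
rewrite normcE -[leRHS]ger0_norm ?addr_ge0// -sqrtr_sqr ler_wsqrtr//.
rewrite sqrrD !real_normK ?num_real// -addrA lerD2l addrC lerDl.
by rewrite mulrn_wge0// mulr_ge0.
Qed.
Lemma normc_real (r : R) : normc r%:C = `|r|.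
Proof. by rewrite /= expr0n addr0 sqrtr_sqr. Qed.
Lemma normc_gt0 z : (0 < normc z) = (z != 0).
Proof.
rewrite lt_neqAle normc_ge0 andbT eq_sym; congr (~~ _).
by apply/eqP/eqP => [/eq0_normc//|->]; rewrite normc0.
Qed.
Lemma normcB z w : normc (z - w) = normc (w - z).
Proof. by rewrite -normcN opprB. Qed.
Lemma normcX z n : normc (z ^+ n) = normc z ^+ n.
Proof. by elim: n => [|n IH]; rewrite ?expr0 ?normc1// !exprS normcM IH. Qed.
Lemma normc_conj z : normc (conjc z) = normc z.
Proof. by case: z => a b /=; rewrite sqrrN. Qed.

(** Differentiability and the value of the derivative in one predicate, so that the rules of
    calculus compose without separate side conditions. *)
Definition cdiff f x (d : R[i]) :=
  is_derive x 1 (ReF f) (Re d) /\ is_derive x 1 (ImF f) (Im d).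

Lemma is_derive_eqd (h : R -> R) x (d d' : R) :
  is_derive x 1 h d -> d = d' -> is_derive x 1 h d'.
Proof. by move=> + <-. Qed.

Lemma cdiff_eq f x d d' : cdiff f x d -> d = d' -> cdiff f x d'.
Proof. by move=> + <-. Qed.

Lemma cdiff_ext f g x d : (forall y, f y = g y) -> cdiff f x d -> cdiff g x d.
Proof. by move=> /funext ->. Qed.

Lemma cdiff_cst (c : C) x : cdiff (fun=> c) x 0.
Proof. by split; exact: is_derive_cst. Qed.

Lemma cdiffD f g x d e : cdiff f x d -> cdiff g x e ->
  cdiff (fun y => f y + g y) x (d + e).
Proof.
move=> [f1 f2] [g1 g2]; rewrite /cdiff !RIE; split.
  rewrite (_ : ReF _ = ReF f \+ ReF g); last by apply/funext => y; rewrite /ReF RIE.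
  exact: is_deriveD.
rewrite (_ : ImF _ = ImF f \+ ImF g); last by apply/funext => y; rewrite /ImF RIE.
exact: is_deriveD.
Qed.

Lemma cdiffM f g x d e : cdiff f x d -> cdiff g x e ->
  cdiff (fun y => f y * g y) x (f x * e + d * g x).
Proof.
move=> [f1 f2] [g1 g2]; rewrite /cdiff !RIE.
have E (a b c k : R -> R) (a' b' c' k' : R) : is_derive x 1 a a' ->
   is_derive x 1 b b' -> is_derive x 1 c c' -> is_derive x 1 k k' ->
   is_derive x 1 (fun y => a y * b y + c y * k y)
     (a x * b' + a' * b x + (c x * k' + c' * k x)).
  move=> ha hb hc hd.
  have := @is_deriveD _ _ _ (a * b) (c * k) x 1 _ _ (@is_deriveM _ _ a b x 1 _ _ ha hb)
    (@is_deriveM _ _ c k x 1 _ _ hc hd).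
  by move=> /is_derive_eqd; apply; rewrite /GRing.scale/=; ring.
have N (a : R -> R) (a' : R) : is_derive x 1 a a' -> is_derive x 1 (- a) (- a').
  by move=> ha; exact: is_deriveN.
split.
  rewrite (_ : ReF _ = fun y => ReF f y * ReF g y + (- ImF f) y * ImF g y); last first.
    by apply/funext => y; rewrite /ReF RIE -mulNr.
  by apply: is_derive_eqd (E _ _ _ _ _ _ _ _ f1 g1 (N _ _ f2) g2) _; rewrite /ReF /ImF !fctE /=; ring.
rewrite (_ : ImF _ = fun y => ReF f y * ImF g y + ImF f y * ReF g y); last first.
  by apply/funext => y; rewrite /ImF RIE.
by apply: is_derive_eqd (E _ _ _ _ _ _ _ _ f1 g2 f2 g1) _; rewrite /ReF /ImF; ring.
Qed.

Lemma cdiffZ (c : R[i]) f x d : cdiff f x d -> cdiff (fun y => c * f y) x (c * d).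
Proof.
by move=> hf; apply: cdiff_eq (cdiffM (cdiff_cst c x) hf) _; rewrite mul0r addr0.
Qed.

Lemma cdiffN f x d : cdiff f x d -> cdiff (fun y => - f y) x (- d).
Proof.
move=> /(cdiffZ (-1)) h; apply: cdiff_eq (cdiff_ext _ h) _; last by rewrite mulN1r.
by move=> y; rewrite mulN1r.
Qed.

Lemma cdiffB f g x d e : cdiff f x d -> cdiff g x e ->
  cdiff (fun y => f y - g y) x (d - e).
Proof. by move=> hf /cdiffN; exact: cdiffD. Qed.

Lemma cdiff_real (h : R -> R) x d : is_derive x 1 h d ->
  cdiff (fun y => (h y)%:C) x d%:C.
Proof.
move=> hh; split=> //=; rewrite (_ : ImF _ = cst 0)//.
exact: is_derive_cst.
Qed.

Lemma cdiff_id x : cdiff (fun y => y%:C) x 1.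
Proof. by apply: cdiff_eq (cdiff_real (is_derive_id x 1)) _. Qed.

Lemma cdiff_comp f (h : R -> R) x d (e : R) : cdiff f (h x) d ->
  is_derive x 1 h e -> cdiff (fun y => f (h y)) x (d * e%:C).
Proof.
move=> [f1 f2] hh; rewrite /cdiff !RIE /= !mulr0 subr0 add0r.
by split; [apply: is_derive_eqd (@is_derive1_comp _ (ReF f) h x _ _ f1 hh) _|
  apply: is_derive_eqd (@is_derive1_comp _ (ImF f) h x _ _ f2 hh) _];
  rewrite mulrC.
Qed.

Lemma cdiff_affine f a b x d : cdiff f (a * x + b) d ->
  cdiff (fun y => f (a * y + b)) x (a%:C * d).
Proof.
move=> hf; rewrite mulrC; apply: (@cdiff_comp f (fun y => a * y + b)) => //.
have := @is_deriveD _ _ _ (a \*: @id R) (cst b) x 1 _ _ (is_deriveZ a (is_derive_id x 1)) (is_derive_cst b x 1).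
by move=> /is_derive_eqd; apply; rewrite addr0 /GRing.scale/= mulr1.
Qed.

Lemma cdiff_conj f x d : cdiff f x d -> cdiff (fun y => conjc (f y)) x (conjc d).
Proof.
move=> [f1 f2]; split.
  rewrite (_ : ReF _ = ReF f); last by apply/funext => y; rewrite /ReF; case: (f y).
  by case: (d) f1 f2.
rewrite (_ : ImF _ = - ImF f); last by apply/funext => y; rewrite /ImF !fctE; case: (f y).
rewrite (_ : Im _ = - Im d); last by case: (d).
exact: is_deriveN.
Qed.

Lemma cderivS f n : cderiv n.+1 f = cderiv 1%N (cderiv n f).
Proof. by []. Qed.

Lemma cderiv_add f n k : cderiv n (cderiv k f) = cderiv (n + k) f.
Proof. by elim: n => [|n IH]; [|rewrite cderivS IH addSn [RHS]cderivS]; apply/funext => x; rewrite /cderiv/=; case: (f x). Qed.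

Lemma cderiv_0 f : cderiv 0 f = f.
Proof. by apply/funext => x; rewrite /cderiv/= /ReF /ImF; case: (f x). Qed.

Lemma cdiff_cderiv1 f x d : cdiff f x d -> cderiv 1%N f x = d.
Proof. by move=> [[_ h1] [_ h2]]; rewrite /cderiv -[derive1n 1 (ReF f) x]/(derive1 (ReF f) x) -[derive1n 1 (ImF f) x]/(derive1 (ImF f) x) !derive1E h1 h2; case: (d). Qed.

Lemma smooth_cdiff f n x : smooth_on setT f -> cdiff (cderiv n f) x (cderiv n.+1 f x).
Proof.
move=> [f1 f2]; rewrite cderivS.
by split; apply: DeriveDef; rewrite -?derive1E//; [exact: f1|exact: f2].
Qed.

Lemma smooth_cdiff0 f x : smooth_on setT f -> cdiff f x (cderiv 1%N f x).
Proof. by move/(@smooth_cdiff f 0 x); rewrite cderiv_0. Qed.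

(** By induction on the order, every derivative stays in the class and is therefore differentiable
    again. Smoothness of Gaussians, exponentials, weights and convolutions is obtained this way,
    from an explicit first derivative. *)
Lemma derivative_closed_class (P : (R -> C) -> Prop) :
  (forall f, P f -> exists2 f', P f' & forall x, cdiff f x (f' x)) ->
  forall f, P f -> smooth_on setT f /\ forall n, P (cderiv n f).
Proof.
move=> HP f Pf.
have Pn n : P (cderiv n f).
  elim: n => [|n IH]; first by rewrite cderiv_0.
  have [g Pg dg] := HP _ IH; rewrite cderivS (_ : cderiv 1%N _ = g)//.
  by apply/funext => x; exact: cdiff_cderiv1.
split=> //; split=> n x _; have [g _ dg] := HP _ (Pn n).
- by have [[]] := dg x.
- by have [_ []] := dg x.
Qed.

Lemma cdiff_continuous f x d : cdiff f x d ->
  {for x, continuous (ReF f)} /\ {for x, continuous (ImF f)}.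
Proof.
move=> [f1 f2]; split; apply/differentiable_continuous/derivable1_diffP.
  exact: ex_derive.
exact: ex_derive.
Qed.

End complex_derivative.

(** * Integrable real functions and affine changes of variable *)

Section real_integral.
Context {R : realType}.
Local Notation mu := (@lebesgue_measure R).
Implicit Types (f g : R -> R).

Definition rint f := mu.-integrable setT (EFin \o f).

Lemma rint_measurable f : rint f -> measurable_fun setT f.
Proof. by move=> /measurable_int /measurable_EFinP. Qed.

Lemma rint_le f g : measurable_fun setT f -> (forall x, `|f x| <= g x) ->
  rint g -> rint f.
Proof.
move=> mf fg ig; apply: le_integrable ig => //; first exact/measurable_EFinP.
by move=> x _; rewrite !abse_EFin lee_fin (le_trans (fg x)) ?ler_norm.
Qed.

Lemma rint_abs f : rint f -> rint (fun x => `|f x|).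
Proof.
move=> hf; have mf := rint_measurable hf; apply: le_integrable hf => //.
  by apply/measurable_EFinP; exact: measurableT_comp.
by move=> x _; rewrite !abse_EFin normr_id.
Qed.

Lemma rintD f g : rint f -> rint g -> rint (fun x => f x + g x).
Proof. by move=> hf hg; have := integrableD measurableT hf hg. Qed.

Lemma rintZ (k : R) f : rint f -> rint (fun x => k * f x).
Proof. by move=> hf; have := integrableZl measurableT k hf. Qed.

Lemma rintN f : rint f -> rint (fun x => - f x).
Proof. by move=> /(rintZ (-1)); under eq_fun do rewrite mulN1r. Qed.

Lemma rintB f g : rint f -> rint g -> rint (fun x => f x - g x).
Proof. by move=> hf /rintN; exact: rintD. Qed.

Lemma rint0 : rint (fun=> 0).
Proof. exact: integrable0. Qed.

Lemma rint_ge0P f : measurable_fun setT f -> (forall x, 0 <= f x) ->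
  (\int[mu]_x (f x)%:E < +oo)%E -> rint f.
Proof.
move=> mf f0 h; apply/integrableP; split; first exact/measurable_EFinP.
by under eq_integral do rewrite /= ger0_norm//.
Qed.

Lemma rint_EFin f : rint f -> (\int[mu]_x (f x)%:E)%E = (\int[mu]_x f x)%:E.
Proof. by move=> hf; rewrite /Rintegral fineK//; exact: integrable_fin_num. Qed.

Section affine.
Variables (a b : R).
Hypothesis a0 : a != 0.
Let T (x : measurableTypeR R) : measurableTypeR R := a * x + b.

Lemma measurable_affine : measurable_fun setT (fun x : R => a * x + b).
Proof.
by apply: measurable_funD => //; apply: measurable_funM.
Qed.

Let mT : measurable_fun setT T. Proof. exact: measurable_affine. Qed.

(** The image of Lebesgue measure under the affine map, rescaled by [|a|]; the claim is that it is
    Lebesgue measure again. *)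
Let m : {measure set (measurableTypeR R) -> \bar R} :=
  mscale (`|a|%:nng)
    (measure_function_pushforward__canonical__measure_function_Measure mu mT).

(** Lebesgue measure is determined by its values on the intervals []c, d]]. The sign of [a] matters
    because the preimage is half-open on the other side when [a < 0]. *)
Lemma lebesgue_measure_affine (A : set (measurableTypeR R)) :
  measurable A -> mu A = m A.
Proof.
apply: (@lebesgue_measure_unique R m) => X.
move=> [[c d] _ <-] /=.
rewrite (_ : m _ = (`|a|%:E * mu (T @^-1` `]c, d]%classic))%E)//.
have a1 : (a < 0) || (0 < a) by rewrite -neq_lt.
have [a_lt0|a_gt0] := orP a1.
  rewrite (_ : T @^-1` _ = `[(d - b) / a, (c - b) / a[%classic); last first.
    apply/seteqP; split=> x /=; rewrite !in_itv/= /T lter_ndivrMr// ?ltr_ndivlMr//.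
      by rewrite lerBrDr ltrBlDr ![_ * a]mulrC andbC.
    by rewrite lerBrDr ltrBlDr ![_ * a]mulrC andbC.
  rewrite !lebesgue_measure_itv/= !lte_fin ltr_nM2r ?invr_lt0// ltrD2r.
  case: ifP => cd; last by rewrite mule0.
  rewrite -!EFinB -EFinM; congr EFin; rewrite ltr0_norm//.
  by field.
rewrite (_ : T @^-1` _ = `](c - b) / a, (d - b) / a]%classic); last first.
  apply/seteqP; split=> x /=; rewrite !in_itv/= /T ltr_pdivrMr// ler_pdivlMr//.
    by rewrite lerBrDr ltrBlDr ![_ * a]mulrC.
  by rewrite lerBrDr ltrBlDr ![_ * a]mulrC.
rewrite !lebesgue_measure_itv/= !lte_fin ltr_pM2r ?invr_gt0// ltrD2r.
case: ifP => cd; last by rewrite mule0.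
rewrite -!EFinB -EFinM; congr EFin; rewrite gtr0_norm//.
by field.
Qed.

Lemma ge0_integral_affine (f : R -> \bar R) : measurable_fun setT f ->
  (forall x, 0 <= f x)%E ->
  (\int[mu]_x f x = `|a|%:E * \int[mu]_x f (a * x + b)%R)%E.
Proof.
move=> mf f0.
rewrite (@eq_measure_integral _ _ _ _ m) => [|A mA _]; last first.
  exact: lebesgue_measure_affine.
rewrite ge0_integral_mscale//=; congr (_ * _)%E.
by rewrite ge0_integral_pushforward.
Qed.

Lemma rint_affine (f : R -> R) : rint f -> rint (fun x => f (a * x + b)).
Proof.
move=> hf; have mf := rint_measurable hf.
apply/integrableP; split.
  apply/measurable_EFinP; apply: (measurableT_comp mf); exact: measurable_affine.
have := hf => /integrableP[_].
rewrite (@ge0_integral_affine (fun x => `|(f x)%:E|%E))//; last first.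
  by apply: measurableT_comp => //; exact/measurable_EFinP.
(* If the integral of the composed function were [+oo], its product with [|a| > 0] would be [+oo]
   too, against the integrability of [f]. *)
rewrite muleC; set J := integral _ _ _; rewrite -/J; case: J => [r| |]; rewrite ?ltry ?ltNyr//.
by rewrite mulyr gtr0_sg ?normr_gt0// mul1e.
Qed.

Lemma Rintegral_affine (f : R -> R) : rint f ->
  (\int[mu]_x f x = `|a| * \int[mu]_x f (a * x + b)).
Proof.
move=> hf; have mf := rint_measurable hf.
apply: EFin_inj; rewrite EFinM -!rint_EFin//; last exact: rint_affine.
rewrite [in LHS]integralE [in RHS]integralE.
rewrite (@ge0_integral_affine (EFin \o f)^\+%E)//; last by apply: measurable_funepos; exact/measurable_EFinP.
rewrite (@ge0_integral_affine (EFin \o f)^\-%E)//; last by apply: measurable_funeneg; exact/measurable_EFinP.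
have ihf := rint_affine hf.
rewrite [RHS]muleBr//.
  by congr (_ - _)%E; congr (_ * _)%E; apply: eq_integral => x _;
    rewrite ?funeposE ?funenegE.
apply: fin_num_adde_defl.
have := integrable_funeneg measurableT ihf.
by move=> /(integrable_fin_num measurableT); rewrite fin_numN.
Qed.

End affine.

End real_integral.

(** * Complex integrals *)

Section cauchy_weight.
Context {R : realType}.
Local Notation mu := (@lebesgue_measure R).

(** The Cauchy kernel, of total mass [pi]: the common majorant for Schwartz functions, boundary
    terms and convolution kernels. *)
Definition K0 (x : R) : R := (1 + x ^+ 2)^-1.

Lemma onesq_gt0 (x : R) : 0 < 1 + x ^+ 2.
Proof. by rewrite ltr_pwDl// sqr_ge0. Qed.

Lemma K0_gt0 x : 0 < K0 x. Proof. by rewrite invr_gt0 onesq_gt0. Qed.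

Lemma K0_ge0 x : 0 <= K0 x. Proof. exact/ltW/K0_gt0. Qed.

Lemma K0N x : K0 (- x) = K0 x. Proof. by rewrite /K0 sqrrN. Qed.

Lemma K0_continuous : continuous K0.
Proof. exact: continuous_oneDsqrV. Qed.

Lemma measurable_K0 : measurable_fun setT K0.
Proof. by apply: continuous_measurable_fun; exact: K0_continuous. Qed.

Lemma integral_K0 : (\int[mu]_x (K0 x)%:E = pi%:E)%E.
Proof.
rewrite ge0_symfun_integralT//; last 3 first.
- exact: K0_ge0.
- exact: K0_continuous.
- by move=> x /=; rewrite K0N.
rewrite (_ : [set x : R | 0 <= x] = `[0%R, +oo[%classic); last first.
  by apply/seteqP; split=> x /=; rewrite in_itv/= andbT.
rewrite (_ : (\int[mu]_(x in `[0%R, +oo[) (K0 x)%:E = (pi / 2)%:E)%E).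
  by rewrite -EFinM mulrC divfK.
exact: integral0y_oneDsqr.
Qed.

Lemma rint_K0 : rint K0.
Proof.
apply: rint_ge0P; [exact: measurable_K0|exact: K0_ge0|].
by rewrite integral_K0 ltry.
Qed.

End cauchy_weight.

Section complex_integral.
Context {R : realType}.
Local Notation C := (R[i]^o).
Local Notation mu := (@lebesgue_measure R).
Local Notation Re := complex.Re.
Local Notation Im := complex.Im.
Implicit Types (f g : R -> C).

Definition cintegrable f := rint (ReF f) /\ rint (ImF f).

Lemma cintegrable_measurable f : cintegrable f -> cmeasurable f.
Proof. by move=> [h1 h2]; split; exact: rint_measurable. Qed.

Lemma cmeasurable_normc f : cmeasurable f -> measurable_fun setT (fun x => normc (f x)).
Proof.
move=> [m1 m2]; under eq_fun do rewrite normcE.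
have ms : measurable_fun setT (@Num.sqrt R).
  by apply: continuous_measurable_fun; exact: sqrt_continuous.
apply: (measurableT_comp ms); apply: measurable_funD.
  exact: (measurable_funX 2%N m1).
exact: (measurable_funX 2%N m2).
Qed.

Lemma cmeasurableD f g : cmeasurable f -> cmeasurable g ->
  cmeasurable (fun x => f x + g x).
Proof.
move=> [f1 f2] [g1 g2]; split.
  rewrite (_ : ReF _ = ReF f \+ ReF g); first exact: measurable_funD.
  by apply/funext => x; rewrite /ReF !RIE.
rewrite (_ : ImF _ = ImF f \+ ImF g); first exact: measurable_funD.
by apply/funext => x; rewrite /ImF !RIE.
Qed.

Lemma cmeasurableM f g : cmeasurable f -> cmeasurable g ->
  cmeasurable (fun x => f x * g x).
Proof.
move=> [f1 f2] [g1 g2]; split.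
  rewrite (_ : ReF _ = fun x => ReF f x * ReF g x - ImF f x * ImF g x).
    by apply: measurable_funB; apply: measurable_funM.
  by apply/funext => x; rewrite /ReF !RIE.
rewrite (_ : ImF _ = fun x => ReF f x * ImF g x + ImF f x * ReF g x).
  by apply: measurable_funD; apply: measurable_funM.
by apply/funext => x; rewrite /ImF !RIE.
Qed.

Lemma cmeasurable_real (h : R -> R) : measurable_fun setT h ->
  cmeasurable (fun x => (h x)%:C).
Proof. by move=> mh; split => //; exact: measurable_cst. Qed.

Lemma cmeasurable_cst (c : R[i]) : cmeasurable (fun=> c).
Proof. by split; exact: measurable_cst. Qed.

Lemma cmeasurable_comp f (h : R -> R) : cmeasurable f -> measurable_fun setT h ->
  cmeasurable (fun x => f (h x)).
Proof. by move=> [f1 f2] mh; split; [exact: (measurableT_comp f1 mh)|exact: (measurableT_comp f2 mh)]. Qed.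

Lemma cdiff_cmeasurable f (f' : R -> C) : (forall x, cdiff f x (f' x)) -> cmeasurable f.
Proof.
by move=> df; split; apply: continuous_measurable_fun => x;
  have [] := cdiff_continuous (df x).
Qed.

Lemma smooth_cmeasurable f : smooth_on setT f -> cmeasurable f.
Proof. by move=> sf; apply: (@cdiff_cmeasurable _ (cderiv 1%N f)) => x; exact: smooth_cdiff0. Qed.

Lemma cintegrable_le f (g : R -> R) : cmeasurable f -> (forall x, normc (f x) <= g x) ->
  rint g -> cintegrable f.
Proof.
move=> [m1 m2] fg ig; split; apply: rint_le ig => // x.
  exact: le_trans (normc_Re _) (fg x).
exact: le_trans (normc_Im _) (fg x).
Qed.

Lemma cintegrable_normc f : cintegrable f -> rint (fun x => normc (f x)).
Proof.
move=> hf; apply: rint_le (rintD (rint_abs hf.1) (rint_abs hf.2)).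
  by apply: cmeasurable_normc; exact: cintegrable_measurable.
by move=> x; rewrite ger0_norm ?normc_ge0//; exact: normc_le.
Qed.

Lemma cintegrableD f g : cintegrable f -> cintegrable g ->
  cintegrable (fun x => f x + g x).
Proof.
move=> [f1 f2] [g1 g2]; split.
  rewrite (_ : ReF _ = fun x => ReF f x + ReF g x); first exact: rintD.
  by apply/funext => x; rewrite /ReF !RIE.
rewrite (_ : ImF _ = fun x => ImF f x + ImF g x); first exact: rintD.
by apply/funext => x; rewrite /ImF !RIE.
Qed.

Lemma cintegrableZ (c : R[i]) f : cintegrable f -> cintegrable (fun x => c * f x).
Proof.
move=> [f1 f2]; split.
  rewrite (_ : ReF _ = fun x => Re c * ReF f x - Im c * ImF f x).
    by apply: rintB; exact: rintZ.
  by apply/funext => x; rewrite /ReF !RIE.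
rewrite (_ : ImF _ = fun x => Re c * ImF f x + Im c * ReF f x).
  by apply: rintD; exact: rintZ.
by apply/funext => x; rewrite /ImF !RIE.
Qed.

Lemma cintegrableN f : cintegrable f -> cintegrable (fun x => - f x).
Proof. by move=> /(cintegrableZ (-1)); under eq_fun do rewrite mulN1r. Qed.

Lemma cintegrableB f g : cintegrable f -> cintegrable g ->
  cintegrable (fun x => f x - g x).
Proof. by move=> hf /cintegrableN; exact: cintegrableD. Qed.

Lemma cintD f g : cintegrable f -> cintegrable g ->
  cint (fun x => f x + g x) = cint f + cint g.
Proof.
move=> [f1 f2] [g1 g2]; apply: complex_ext; rewrite RIE /=.
  rewrite -RintegralD//; congr Rintegral; apply/funext => x; by rewrite /ReF !RIE.
by rewrite -RintegralD//; congr Rintegral; apply/funext => x; rewrite /ImF !RIE.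
Qed.

Lemma cintZ (c : R[i]) f : cintegrable f -> cint (fun x => c * f x) = c * cint f.
Proof.
move=> [f1 f2]; apply: complex_ext; rewrite RIE /=.
  rewrite -!RintegralZl//; rewrite -RintegralB//; [|exact: rintZ..].
  by congr Rintegral; apply/funext => x; rewrite /ReF !RIE.
rewrite -!RintegralZl//; rewrite -RintegralD//; [|exact: rintZ..].
by congr Rintegral; apply/funext => x; rewrite /ImF !RIE.
Qed.

Lemma cintN f : cintegrable f -> cint (fun x => - f x) = - cint f.
Proof. by move=> hf; rewrite -mulN1r -cintZ//; congr cint; apply/funext => x; rewrite mulN1r. Qed.

Lemma cintB f g : cintegrable f -> cintegrable g ->
  cint (fun x => f x - g x) = cint f - cint g.
Proof. by move=> hf hg; rewrite cintD ?cintN//; exact: cintegrableN. Qed.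

Lemma eq_cint f g : (forall x, f x = g x) -> cint f = cint g.
Proof. by move=> /funext ->. Qed.

Lemma cint0 : cint (fun=> 0 : C) = 0 :> C.
Proof.
apply: complex_ext => /=; rewrite (_ : _ (fun=> 0) = cst 0)//;
  by rewrite Rintegral_cst// mul0r.
Qed.

(** A unimodular factor [u] rotates the integral onto the positive half-line, where it equals its
    real part and the real estimate applies. Estimating the two components separately would lose a
    constant. *)
Lemma normc_cint_le f (g : R -> R) : cmeasurable f -> (forall x, normc (f x) <= g x) ->
  rint g -> normc (cint f) <= \int[mu]_x g x.
Proof.
move=> mf fg ig; have hf := cintegrable_le mf fg ig.
have [->|c0] := eqVneq (cint f) 0.
  by rewrite normc0; apply: Rintegral_ge0 => x _; exact: le_trans (normc_ge0 _) (fg x).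
pose u := conjc (cint f) / (normc (cint f))%:C.
have n0 : normc (cint f) != 0 by rewrite gt_eqF// normc_gt0.
have nu : normc u = 1.
  by rewrite normcM normcV normc_conj normc_real ger0_norm ?normc_ge0// divff.
have -> : normc (cint f) = Re (u * cint f).
  rewrite /u mulrAC (_ : conjc (cint f) * cint f = (normc (cint f) ^+ 2)%:C); last first.
    by rewrite sqr_normcE; case: (cint f) => a b; apply: complex_ext; rewrite RIE /=; ring.
  by rewrite -fmorphV -rmorphM/= expr2 mulfK.
rewrite -cintZ//=; apply: le_Rintegral => //.
  by have [] := cintegrableZ u hf.
move=> x _; apply: le_trans (ler_norm _) _; apply: le_trans (normc_Re _) _.
by rewrite normcM nu mul1r.
Qed.

Lemma cintegrable_affine (a b : R) f : a != 0 -> cintegrable f ->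
  cintegrable (fun x => f (a * x + b)).
Proof. by move=> a0 [f1 f2]; split; [exact: (rint_affine b a0 f1)|exact: (rint_affine b a0 f2)]. Qed.

Lemma cint_affine (a b : R) f : a != 0 -> cintegrable f ->
  cint f = `|a|%:C * cint (fun x => f (a * x + b)).
Proof.
move=> a0 [f1 f2]; apply: complex_ext; rewrite RIE /= mul0r ?subr0 ?addr0.
  exact: Rintegral_affine.
exact: Rintegral_affine.
Qed.

Lemma cint_shift (b : R) f : cintegrable f -> cint f = cint (fun x => f (x + b)).
Proof.
move=> hf; rewrite (cint_affine b (@oner_neq0 R) hf) normr1 mul1r.
by apply: eq_cint => x; rewrite mul1r.
Qed.

Lemma cint_opp f : cintegrable f -> cint f = cint (fun x => f (- x)).
Proof.
move=> hf; rewrite (@cint_affine (-1) 0)// ?oppr_eq0 ?oner_neq0// normrN1 mul1r.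
by apply: eq_cint => x; rewrite mulN1r addr0.
Qed.

(** The fundamental theorem of calculus on growing symmetric intervals; the boundary values vanish
    in the limit by the decay of [h], and dominated convergence passes to the whole line. *)
Lemma Rintegral_derive0 (h h' : R -> R) (M : R) : (forall x : R, is_derive x 1 h (h' x)) ->
  continuous h' -> rint h' -> (forall x, `|h x| <= M * K0 x) ->
  \int[mu]_x h' x = 0.
Proof.
move=> dh ch ih hM.
have M0 : 0 <= M.
  by have := le_trans (normr_ge0 _) (hM 0); rewrite /K0 expr0n addr0 invr1 mulr1.
(* The successor keeps the interval nondegenerate at [n = 0], as the fundamental theorem of calculus
   demands. *)
pose I (n : nat) : set R := `[- (n.+1%:R), n.+1%:R]%classic.
have E n : (\int[mu]_(x in I n) (h' x)%:E = (h n.+1%:R - h (- n.+1%:R))%:E)%E.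
  rewrite (@continuous_FTC2 R h' h)//.
  - by rewrite -subr_gt0 opprK addr_gt0.
  - exact: continuous_subspaceT.
  - split.
    + by move=> x _; have [] := dh x.
    + apply: cvg_at_right_filter; apply/differentiable_continuous/derivable1_diffP.
      by have [] := dh (- n.+1%:R).
    + apply: cvg_at_left_filter; apply/differentiable_continuous/derivable1_diffP.
      by have [] := dh n.+1%:R.
  - by move=> x _; rewrite derive1E; have [_ ->] := dh x.
have := @dominated_convergence _ _ R mu setT measurableT
  (fun n => EFin \o (h' \_ (I n))) (EFin \o h') (fun x => `|h' x|%:E).
have mh : measurable_fun setT h' by exact: rint_measurable.
case=> //.
- move=> n; apply/measurable_EFinP; apply/(measurable_restrictT _ _).1 => //.
    exact: measurable_itv.
  exact: measurable_funTS.
- exact/measurable_EFinP.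
- apply/aeW => x _; apply: cvg_EFin; first exact: nearW.
  apply/cvgrPdist_lt => e e0; near=> n; rewrite /= patchE ifT ?subrr ?normr0//.
  rewrite inE /I/= in_itv/=; rewrite -ler_norml.
  apply: (@le_trans _ _ n%:R); last by rewrite ler_nat.
  by near: n; exact: nbhs_infty_ger.
- exact: (rint_abs ih).
- apply/aeW => x n _ /=; rewrite lee_fin patchE; case: ifPn => //=.
  by rewrite normr0.
move=> _ _ cv.
have cv0 : (h n.+1%:R - h (- n.+1%:R)) @[n --> \oo] --> (0 : R).
  apply/cvgrPdist_lt => e e0; near=> n; rewrite sub0r normrN.
  apply: le_lt_trans (ler_normB _ _) _.
  apply: le_lt_trans (lerD (hM _) (hM _)) _; rewrite K0N -mulr2n.
  have n0 : (0 : R) < n.+1%:R by [].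
  have : K0 (n.+1%:R : R) <= n.+1%:R^-1.
    rewrite lef_pV2 ?posrE ?onesq_gt0//.
    by rewrite ler_wpDl// expr2 ler_peMr ?ler1n// ltW.
  move=> hK; apply: (@le_lt_trans _ _ (M * n.+1%:R^-1 *+ 2)).
    by rewrite lerMn2r/= ler_wpM2l.
  rewrite -mulrnAl ltr_pdivrMr//.
  rewrite mulrC -ltr_pdivrMr//.
  apply: (@le_lt_trans _ _ n%:R); last by rewrite ltr_nat.
  by near: n; exact: nbhs_infty_ger.
have : (\int[mu]_x (h' x)%:E = 0%:E)%E.
  apply: (cvg_unique _ cv) => //.
  rewrite (_ : [sequence _]_n = fun n => (h n.+1%:R - h (- n.+1%:R))%:E).
    by apply: cvg_EFin; [exact: nearW|exact: cv0].
  by apply/funext => n /=; rewrite -E [RHS]integral_mkcond restrict_EFin.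
by rewrite rint_EFin// => -[].
Unshelve. all: by end_near. Qed.

(** The derivative [f''] provides the continuity of [f'] required by the fundamental theorem of
    calculus. *)
Lemma cint_derive0 f (f' f'' : R -> C) (M : R) : (forall x, cdiff f x (f' x)) ->
  (forall x, cdiff f' x (f'' x)) ->
  cintegrable f' -> (forall x, normc (f x) <= M * K0 x) -> cint f' = 0.
Proof.
move=> df df' [i1 i2] fM; apply: complex_ext => /=.
  apply: (@Rintegral_derive0 (ReF f) (ReF f') M) => // x.
  - by have [] := df x.
  - by have [] := cdiff_continuous (df' x).
  - exact: le_trans (normc_Re _) (fM x).
apply: (@Rintegral_derive0 (ImF f) (ImF f') M) => // x.
- by have [] := df x.
- by have [] := cdiff_continuous (df' x).
- exact: le_trans (normc_Im _) (fM x).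
Qed.

(** The hypotheses are confined to the window of radius 1 around [x0], because the majorants found
    for convolutions are local in the parameter. *)
Lemma Rintegral_diff (h h' : R -> R -> R) (x0 : R) (G : R -> R) :
  (forall x, `|x - x0| < 1 -> rint (h x)) ->
  (forall x y, `|x - x0| < 1 -> is_derive x 1 (h^~ y) (h' x y)) ->
  rint G -> (forall x y, `|x - x0| < 1 -> `|h' x y| <= G y) ->
  is_derive x0 1 (fun x => \int[mu]_y h x y) (\int[mu]_y h' x0 y).
Proof.
move=> ih dh iG hG.
have I x : (`](x0 - 1), (x0 + 1)[%classic : set R) x -> `|x - x0| < 1.
  by rewrite /= in_itv/= ltr_distl.
have x0I : (`](x0 - 1), (x0 + 1)[%classic : set R) x0.
  by rewrite /= in_itv/= ltrBlDr ltrDl ltr01.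
have ih' x : (`](x0 - 1), (x0 + 1)[%classic : set R) x -> mu.-integrable setT (EFin \o h x).
  by move=> /I; exact: ih.
have dh' x y : (`](x0 - 1), (x0 + 1)[%classic : set R) x -> setT y -> derivable (h^~ y) x 1.
  by move=> /I hx _; have [] := dh x y hx.
have G0 y : 0 <= G y.
  by apply: le_trans (normr_ge0 _) (hG x0 y _); rewrite subrr normr0.
have E x y : `|x - x0| < 1 -> partial1of2 h x y = h' x y.
  by move=> hx; rewrite partial1of2E; have [_ ->] := dh x y hx.
have hG' x y : (`](x0 - 1), (x0 + 1)[%classic : set R) x -> setT y -> `|partial1of2 h x y| <= G y.
  by move=> /I hx _; rewrite E// hG.
have x00 : `|x0 - x0| < 1 by rewrite subrr normr0.
apply: DeriveDef.
  exact: (@derivable_under_integral _ _ _ mu h setT measurableT x0 _ _ x0I ih' dh' G G0 iG hG').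
rewrite -derive1E.
rewrite (@differentiation_under_integral _ _ _ mu h setT measurableT x0 _ _ x0I ih' dh' G G0 iG hG').
by congr Rintegral; apply/funext => y; rewrite E.
Qed.

Lemma cint_diff (h h' : R -> R -> C) (x0 : R) (G : R -> R) :
  (forall x, `|x - x0| < 1 -> cintegrable (h x)) ->
  (forall x y, `|x - x0| < 1 -> cdiff (h^~ y) x (h' x y)) ->
  rint G -> (forall x y, `|x - x0| < 1 -> normc (h' x y) <= G y) ->
  cdiff (fun x => cint (h x)) x0 (cint (h' x0)).
Proof.
move=> ih dh iG hG; split; rewrite /cint /=.
  apply: (@Rintegral_diff (fun x y => Re (h x y)) (fun x y => Re (h' x y)) x0 G) => //.
  - by move=> x /ih[].
  - by move=> x y /(dh x y)[].
  - by move=> x y /(hG x y); apply: le_trans; exact: normc_Re.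
apply: (@Rintegral_diff (fun x y => Im (h x y)) (fun x y => Im (h' x y)) x0 G) => //.
- by move=> x /ih[].
- by move=> x y /(dh x y)[].
- by move=> x y /(hG x y); apply: le_trans; exact: normc_Im.
Qed.

End complex_integral.

(** * Fubini's theorem and Schwartz functions *)

Section complex_fubini.
Context {R : realType}.
Local Notation C := (R[i]^o).
Local Notation mu := (@lebesgue_measure R).
Local Notation Re := complex.Re.
Local Notation Im := complex.Im.

Definition prodint (f : R -> R -> R) :=
  (mu \x mu)%E.-integrable setT (fun z : measurableTypeR R * measurableTypeR R => (f z.1 z.2)%:E).

Lemma prodint_integralr (f : R -> R -> R) : prodint f ->
  mu.-integrable setT (fun y => \int[mu]_x (f x y)%:E)%E.
Proof.
move=> hf; have mf := measurable_int _ hf.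
apply/integrableP; split; first exact: (measurable_fubini_G hf).
have h := (integrable21ltyP mu mu mf).1 hf.
apply: (le_lt_trans _ h); apply: ge0_le_integral => //.
- by apply: measurableT_comp => //; exact: (measurable_fubini_G hf).
- apply: (@measurable_fun_fubini_tonelli_G _ _ _ _ _ mu
    (fun z : measurableTypeR R * measurableTypeR R => `|(f z.1 z.2)%:E|%E)) => //.
  exact: measurableT_comp.
- move=> y _; apply: le_abse_integral => //.
  exact: (measurableT_comp mf (pair2_measurable y)).
Qed.

(** The inner integrals are finite only almost everywhere, and [Rintegral] replaces infinite values
    by 0; both sides are therefore compared almost everywhere with the extended-real iterated
    integrals. *)
Lemma Rintegral_fubini (f : R -> R -> R) : prodint f ->
  \int[mu]_x (\int[mu]_y f x y) = \int[mu]_y (\int[mu]_x f x y).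
Proof.
move=> hf; rewrite /Rintegral; congr fine.
have mf := measurable_int _ hf.
have i1 := integrable_fubini_F hf.
have i2 := prodint_integralr hf.
transitivity (\int[mu]_x \int[mu]_y (f x y)%:E)%E.
  apply: ae_eq_integral => //.
  - apply: measurableT_comp => //.
    exact: (measurableT_comp (fine_measurable measurableT) (measurable_int _ i1)).
  - exact: (measurable_int _ i1).
  - move: (integrable_ae measurableT i1); apply: filterS => x /(_ I) h _.
    by rewrite fineK.
rewrite (Fubini hf); apply: ae_eq_integral => //.
- exact: (measurable_int _ i2).
- apply: measurableT_comp => //.
  exact: (measurableT_comp (fine_measurable measurableT) (measurable_int _ i2)).
- move: (integrable_ae measurableT i2); apply: filterS => x /(_ I) h _.
  by rewrite fineK.
Qed.

Definition cmeasurable2 (h : R -> R -> C) :=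
  measurable_fun setT (fun z : measurableTypeR R * measurableTypeR R => Re (h z.1 z.2)) /\
  measurable_fun setT (fun z : measurableTypeR R * measurableTypeR R => Im (h z.1 z.2)).

Lemma cmeasurable2M (h k : R -> R -> C) : cmeasurable2 h -> cmeasurable2 k ->
  cmeasurable2 (fun x y => h x y * k x y).
Proof.
move=> [h1 h2] [k1 k2]; split.
  under eq_fun do rewrite cReM.
  by apply: measurable_funB; apply: measurable_funM.
under eq_fun do rewrite cImM.
by apply: measurable_funD; apply: measurable_funM.
Qed.

Lemma cmeasurable2_comp (f : R -> C)
    (g : measurableTypeR R * measurableTypeR R -> R) : cmeasurable f ->
  measurable_fun setT g -> cmeasurable2 (fun x y => f (g (x, y))).
Proof.
move=> [f1 f2] mg; split.
  rewrite (_ : (fun z => _) = (ReF f) \o g); last by apply/funext => -[].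
  exact: measurableT_comp.
rewrite (_ : (fun z => _) = (ImF f) \o g); last by apply/funext => -[].
exact: measurableT_comp.
Qed.

Lemma cmeasurable2_1 (f : R -> C) : cmeasurable f -> cmeasurable2 (fun x y => f x).
Proof. by move=> mf; exact: (cmeasurable2_comp mf measurable_fst). Qed.

Lemma cmeasurable2_2 (f : R -> C) : cmeasurable f -> cmeasurable2 (fun x y => f y).
Proof. by move=> mf; exact: (cmeasurable2_comp mf measurable_snd). Qed.

Lemma cmeasurable2_sub (f : R -> C) : cmeasurable f -> cmeasurable2 (fun x y => f (y - x)).
Proof.
move=> mf; apply: (cmeasurable2_comp mf (g := fun z => z.2 - z.1)).
by apply: measurable_funB; [exact: measurable_snd|exact: measurable_fst].
Qed.

Lemma prodint_le (f g : R -> R -> R) :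
  measurable_fun setT (fun z : measurableTypeR R * measurableTypeR R => f z.1 z.2) ->
  (forall x y, `|f x y| <= g x y) -> prodint g -> prodint f.
Proof.
move=> mf fg; apply: le_integrable => //; first by apply/measurable_EFinP.
by move=> [x y] _ /=; rewrite lee_fin (le_trans (fg x y)) ?ler_norm.
Qed.

Lemma prodint_ge0 (g : R -> R -> R) :
  measurable_fun setT (fun z : measurableTypeR R * measurableTypeR R => g z.1 z.2) ->
  (forall x y, 0 <= g x y) ->
  (\int[mu]_x \int[mu]_y (g x y)%:E < +oo)%E -> prodint g.
Proof.
move=> mg g0 h; apply/integrable12ltyP; first by apply/measurable_EFinP.
apply: le_lt_trans h; rewrite le_eqVlt; apply/orP; left; apply/eqP.
by apply: eq_integral => x _; apply: eq_integral => y _ /=; rewrite ger0_norm.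
Qed.

Lemma prodint_ge0' (g : R -> R -> R) :
  measurable_fun setT (fun z : measurableTypeR R * measurableTypeR R => g z.1 z.2) ->
  (forall x y, 0 <= g x y) ->
  (\int[mu]_y \int[mu]_x (g x y)%:E < +oo)%E -> prodint g.
Proof.
move=> mg g0 h; apply/integrable21ltyP; first by apply/measurable_EFinP.
apply: le_lt_trans h; rewrite le_eqVlt; apply/orP; left; apply/eqP.
by apply: eq_integral => x _; apply: eq_integral => y _ /=; rewrite ger0_norm.
Qed.

Lemma prodintD (f g : R -> R -> R) : prodint f -> prodint g ->
  prodint (fun x y => f x y + g x y).
Proof. by move=> hf hg; exact: (integrableD measurableT hf hg). Qed.

Lemma prodintZ (k : R) (f : R -> R -> R) : prodint f -> prodint (fun x y => k * f x y).
Proof. by move=> hf; exact: (integrableZl measurableT k hf). Qed.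

Lemma prodint_tensor (f g : R -> R) : rint f -> rint g ->
  (forall x, 0 <= f x) -> (forall x, 0 <= g x) -> prodint (fun x y => f x * g y).
Proof.
move=> hf hg f0 g0; apply: prodint_ge0 => [||].
- apply: measurable_funM.
    exact: (measurableT_comp (rint_measurable hf) measurable_fst).
  exact: (measurableT_comp (rint_measurable hg) measurable_snd).
- by move=> x y; rewrite mulr_ge0.
have E x : (\int[mu]_y (f x * g y)%:E = ((\int[mu]_y g y) * f x)%:E)%E.
  under eq_integral do rewrite EFinM.
  rewrite ge0_integralZl ?lee_fin//=; last 2 first.
  - by apply/measurable_EFinP; exact: rint_measurable.
  - by move=> y _; rewrite lee_fin.
  by rewrite rint_EFin// -EFinM mulrC.
under eq_integral do rewrite E.
by rewrite rint_EFin ?ltry//; exact: rintZ.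
Qed.

Lemma cint_fubini (h : R -> R -> C) (g : R -> R -> R) : cmeasurable2 h ->
  (forall x y, normc (h x y) <= g x y) -> prodint g ->
  cint (fun x => cint (fun y => h x y)) = cint (fun y => cint (fun x => h x y)).
Proof.
move=> [h1 h2] hg ig; apply: complex_ext => /=.
  apply: (@Rintegral_fubini (fun x y => Re (h x y))).
  by apply: prodint_le ig => // x y; exact: le_trans (normc_Re _) (hg x y).
apply: (@Rintegral_fubini (fun x y => Im (h x y))).
by apply: prodint_le ig => // x y; exact: le_trans (normc_Im _) (hg x y).
Qed.

End complex_fubini.

(** * Schwartz functions and their closure properties *)

Section schwartz_functions.
Context {R : realType}.
Local Notation C := (R[i]^o).
Implicit Types (f g : R -> C).

Definition sch f := f \in @schwartz_pred R.
(** Decay is measured by powers of [1 + x^2] because they are bounded below by 1 and are the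
    building blocks of the Sobolev weights. *)
Definition rapid f := forall k : nat, exists M : R, forall x, (1 + x ^+ 2) ^+ k * normc (f x) <= M.

Lemma onesq_ge1 (x : R) : 1 <= 1 + x ^+ 2.
Proof. by rewrite lerDl sqr_ge0. Qed.

Lemma norm_le_onesq (x : R) : `|x| <= 1 + x ^+ 2.
Proof.
rewrite -subr_ge0; have -> : 1 + x ^+ 2 - `|x| = (`|x| - 1/2) ^+ 2 + 3/4.
  by rewrite -[x ^+ 2]real_normK ?num_real//; field.
by rewrite addr_ge0// sqr_ge0.
Qed.

(** Peetre's inequality: the difference of the two sides is a sum of nonnegative terms. It is what
    lets weights pass through convolutions. *)
Lemma peetre (x y : R) : 1 + x ^+ 2 <= 2 * (1 + (x - y) ^+ 2) * (1 + y ^+ 2).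
Proof.
rewrite -subr_ge0.
have -> : 2 * (1 + (x - y) ^+ 2) * (1 + y ^+ 2) - (1 + x ^+ 2) =
  (x - y - y) ^+ 2 + 1 + 2 * ((x - y) ^+ 2 * y ^+ 2) by ring.
by rewrite !addr_ge0 ?sqr_ge0// mulr_ge0// mulr_ge0 ?sqr_ge0.
Qed.

Lemma schP f : reflect (smooth_on setT f /\ forall k n, exists M : R, forall x,
  `|x| ^+ k * normc (cderiv n f x) <= M) (sch f).
Proof. exact: asboolP. Qed.

Lemma sch_smooth f : sch f -> smooth_on setT f.
Proof. by move=> /schP[]. Qed.

Lemma sch_rapid f : sch f -> forall n, rapid (cderiv n f).
Proof.
move=> /schP[_ hf] n k.
(* The additional power [j] makes the induction go through: one more factor [1 + x^2] is paid for by
   the bounds for [j] and [j + 2]. *)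
suff: forall j, exists M : R, forall x,
    (1 + x ^+ 2) ^+ k * (`|x| ^+ j * normc (cderiv n f x)) <= M.
  by move=> /(_ 0%N)[M HM]; exists M => x; have := HM x; rewrite expr0 mul1r.
elim: k => [|k IH] j; first by have [M HM] := hf j n; exists M => x; rewrite expr0 mul1r.
have [M HM] := IH j; have [N HN] := IH j.+2; exists (M + N) => x.
apply: le_trans (lerD (HM x) (HN x)); rewrite [_ ^+ k.+1]exprSr [_ ^+ j.+2]exprS [_ ^+ j.+1]exprS -(real_normK (num_real x)).
by rewrite le_eqVlt; apply/orP; left; apply/eqP; ring.
Qed.

Lemma sch_rapid0 f : sch f -> rapid f.
Proof. by move=> /sch_rapid/(_ 0%N); rewrite cderiv_0. Qed.

(** The analogue of [derivative_closed_class] with decay: the derivatives remain in the class, hence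
    decay rapidly as well. *)
Lemma sch_class (P : (R -> C) -> Prop) :
  (forall f, P f -> exists2 f', P f' & forall x, cdiff f x (f' x)) ->
  (forall f, P f -> rapid f) -> forall f, P f -> sch f.
Proof.
move=> HP Hr f Pf; have [sf Pn] := derivative_closed_class HP Pf.
apply/schP; split=> // k n; have [M HM] := Hr _ (Pn n) k.
exists M => x; apply: le_trans (HM x).
rewrite ler_wpM2r ?normc_ge0// lerXn2r ?nnegrE//; last exact: norm_le_onesq.
by rewrite ltW// onesq_gt0.
Qed.

Lemma sch_cderiv f n : sch f -> sch (cderiv n f).
Proof.
move=> hf; apply: (@sch_class (fun g => exists n, g = cderiv n f)); last by exists n.
  move=> _ [k ->]; exists (cderiv k.+1 f); first by exists k.+1.
  by move=> x; apply: smooth_cdiff; exact: sch_smooth.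
by move=> _ [k ->]; exact: sch_rapid.
Qed.

Lemma sch_cdiff f x : sch f -> cdiff f x (cderiv 1%N f x).
Proof. by move=> /sch_smooth; exact: smooth_cdiff0. Qed.

Lemma schD f g : sch f -> sch g -> sch (fun x => f x + g x).
Proof. exact: rpredD. Qed.

Lemma schZ (c : R[i]) f : sch f -> sch (fun x => c * f x).
Proof. exact: rpredZ. Qed.

Lemma schN f : sch f -> sch (fun x => - f x).
Proof.
move=> /(schZ (-1)); rewrite (_ : (fun x => _) = fun x => - f x)//.
by apply/funext => x; rewrite mulN1r.
Qed.

Lemma schB f g : sch f -> sch g -> sch (fun x => f x - g x).
Proof. by move=> hf /schN; exact: schD. Qed.

Lemma rapidD f g : rapid f -> rapid g -> rapid (fun x => f x + g x).
Proof.
move=> hf hg k; have [M HM] := hf k; have [N HN] := hg k; exists (M + N) => x.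
apply: le_trans (lerD (HM x) (HN x)); rewrite -mulrDr ler_wpM2l ?le_normcD//.
by rewrite ltW// exprn_gt0// onesq_gt0.
Qed.

Lemma rapid_mulx f : rapid f -> rapid (fun x => x%:C * f x).
Proof.
move=> hf k; have [M HM] := hf k.+1; exists M => x; apply: le_trans (HM x).
rewrite [_ ^+ k.+1]exprSr -mulrA ler_wpM2l ?exprn_ge0 ?(ltW (onesq_gt0 _))//.
by rewrite normcM normc_real ler_wpM2r ?normc_ge0// norm_le_onesq.
Qed.

Lemma rapidZ (c : R[i]) f : rapid f -> rapid (fun x => c * f x).
Proof.
move=> hf k; have [M HM] := hf k; exists (normc c * M) => x.
by rewrite normcM mulrCA ler_wpM2l ?normc_ge0.
Qed.

Lemma sch_mulx f : sch f -> sch (fun x => x%:C * f x).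
Proof.
(* The derivative of [x g] is [x g' + g], so a free Schwartz summand [k] is what closes the class
   under differentiation. *)
move=> hf; pose P h := exists2 g, sch g & exists2 k, sch k &
  h = fun x => x%:C * g x + k x.
apply: (@sch_class P).
- move=> _ [g hg [k hk ->]]; exists (fun x => x%:C * cderiv 1%N g x + (g x + cderiv 1%N k x)).
    exists (cderiv 1%N g); first exact: sch_cderiv.
    by exists (fun x => g x + cderiv 1%N k x) => //; apply: schD => //; exact: sch_cderiv.
  move=> x; have := cdiffD (cdiffM (cdiff_id x) (sch_cdiff x hg)) (sch_cdiff x hk).
  by move=> /cdiff_eq; apply; rewrite mul1r addrA.
- move=> _ [g hg [k hk ->]]; apply: rapidD; last exact: sch_rapid0.
  by apply: rapid_mulx; exact: sch_rapid0.
exists f => //; exists (fun=> 0); first exact: rpred0.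
by apply/funext => x; rewrite addr0.
Qed.

Lemma sch_affine f (a b : R) : a != 0 -> sch f -> sch (fun x => f (a * x + b)).
Proof.
move=> a0 hf; pose P h := exists2 g, sch g & h = fun x => g (a * x + b).
apply: (@sch_class P); last by exists f.
- move=> _ [g hg ->]; exists (fun x => a%:C * cderiv 1%N g (a * x + b)).
    by exists (fun x => a%:C * cderiv 1%N g x) => //; apply/schZ/sch_cderiv.
  by move=> x; apply: cdiff_affine; exact: sch_cdiff.
move=> _ [g hg ->] k; have [M HM] := sch_rapid0 hg k.
(* Chosen so that [1 + x^2 <= c (1 + (a x + b)^2)]; the difference is written below as a sum of
   nonnegative terms. *)
pose c := 1 + 2 * (1 + b ^+ 2) / a ^+ 2.
exists (c ^+ k * M) => x; apply: le_trans (ler_wpM2l _ (HM (a * x + b))); last first.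
  by rewrite exprn_ge0// addr_ge0// divr_ge0 ?sqr_ge0// mulr_ge0// ltW// onesq_gt0.
rewrite mulrA -exprMn ler_wpM2r ?normc_ge0// lerXn2r ?nnegrE ?(ltW (onesq_gt0 _))//.
  rewrite mulr_ge0 ?(ltW (onesq_gt0 _))//.
  by rewrite addr_ge0// divr_ge0 ?sqr_ge0// mulr_ge0// ltW// onesq_gt0.
rewrite -subr_ge0.
have -> : c * (1 + (a * x + b) ^+ 2) - (1 + x ^+ 2) =
  (a * x + b) ^+ 2 + 2 * ((a * x + b) ^+ 2 * b ^+ 2 + 1) / a ^+ 2 + (x + 2 * b / a) ^+ 2.
  by rewrite /c; field.
by rewrite !addr_ge0 ?sqr_ge0// divr_ge0 ?sqr_ge0// mulr_ge0// addr_ge0// mulr_ge0// sqr_ge0.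
Qed.

Lemma sch_dilate f (a : R) : a != 0 -> sch f -> sch (fun x => f (a * x)).
Proof. by move=> a0 /(sch_affine 0 a0); under eq_fun do rewrite addr0. Qed.

Lemma sch_opp f : sch f -> sch (fun x => f (- x)).
Proof.
move=> /(@sch_affine f (-1) 0); rewrite oppr_eq0 oner_neq0 => /(_ erefl).
by under eq_fun do rewrite mulN1r addr0.
Qed.

Lemma sch_shift f b : sch f -> sch (fun x => f (x + b)).
Proof.
move=> /(@sch_affine f 1 b); rewrite oner_neq0 => /(_ erefl).
by under eq_fun do rewrite mul1r.
Qed.

Lemma sch_conj f : sch f -> sch (fun x => conjc (f x)).
Proof.
move=> hf; apply: (@sch_class (fun h => exists2 g, sch g & h = fun x => conjc (g x))).
- move=> _ [g hg ->]; exists (fun x => conjc (cderiv 1%N g x)).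
    by exists (cderiv 1%N g) => //; exact: sch_cderiv.
  by move=> x; apply: cdiff_conj; exact: sch_cdiff.
- move=> _ [g hg ->] k; have [M HM] := sch_rapid0 hg k.
  by exists M => x; rewrite normc_conj.
by exists f.
Qed.

Lemma rapid_K0 f : rapid f -> exists2 M : R, 0 <= M & forall x, normc (f x) <= M * K0 x.
Proof.
move=> /(_ 1%N)[M HM]; exists M.
  by apply: le_trans (HM 0); rewrite mulr_ge0 ?normc_ge0// exprn_ge0 ?(ltW (onesq_gt0 _)).
by move=> x; rewrite ler_pdivlMr ?onesq_gt0// mulrC -[1 + _]expr1.
Qed.

Lemma sch_cmeasurable f : sch f -> cmeasurable f.
Proof. by move=> /sch_smooth; exact: smooth_cmeasurable. Qed.

Lemma sch_cintegrable f : sch f -> cintegrable f.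
Proof.
move=> hf; have [M M0 HM] := rapid_K0 (sch_rapid0 hf).
by apply: cintegrable_le HM _; [exact: sch_cmeasurable|apply: rintZ; exact: rint_K0].
Qed.

Lemma cint_cderiv0 f : sch f -> cint (cderiv 1%N f) = 0.
Proof.
move=> hf; have [M M0 HM] := rapid_K0 (sch_rapid0 hf).
have sf := sch_smooth hf.
apply: (@cint_derive0 R f (cderiv 1%N f) (cderiv 2%N f) M).
- by move=> x; exact: sch_cdiff.
- by move=> x; exact: smooth_cdiff.
- by apply: sch_cintegrable; exact: sch_cderiv.
- exact: HM.
Qed.

Lemma test_sch (I : set R) (phi : test I) : sch phi.
Proof. exact: test_schwartz_subproof. Qed.

Lemma test_pred_mul (I : set R) (phi : test I) f : smooth_on setT f ->
  (fun x => phi x * f x) \in test_pred I.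
Proof.
move=> sf; have /test_predP[K [sp cK KI p0]] := testP phi.
apply/test_predP; exists K; split; [exact: smoothM|exact: cK|exact: KI|].
by move=> x /p0 ->; rewrite mul0r.
Qed.

Lemma sch_test_mul (I : set R) (phi : test I) f : smooth_on setT f ->
  sch (fun x => phi x * f x).
Proof. by move=> sf; exact: test_sch (Test (test_pred_mul phi sf)). Qed.

End schwartz_functions.

(** * The Fourier transform *)

Section fourier_transform.
Context {R : realType}.
Local Notation C := (R[i]^o).
Local Notation mu := (@lebesgue_measure R).
Local Notation Re := complex.Re.
Local Notation Im := complex.Im.
Implicit Types (f g : R -> C) (x y xi : R).

(** The character [exp (-2 pi i x xi)]. *)
Definition ph x xi : R[i] := cos (2 * pi * x * xi) -i* sin (2 * pi * x * xi).

Lemma phC x xi : ph x xi = ph xi x.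
Proof. by rewrite /ph; congr (cos _ -i* sin _); ring. Qed.

Lemma normc_ph x xi : normc (ph x xi) = 1.
Proof. by rewrite normcE /= sqrrN cos2Dsin2 sqrtr1. Qed.

Lemma ph0 xi : ph 0 xi = 1.
Proof. by rewrite /ph mulr0 mul0r cos0 sin0 oppr0. Qed.

Lemma phD x y xi : ph (x + y) xi = ph x xi * ph y xi.
Proof.
by apply: complex_ext; rewrite ?cReM ?cImM /= mulrDr mulrDl ?cosD ?sinD; ring.
Qed.

Lemma phZ (a x xi : R) : ph (a * x) xi = ph x (a * xi).
Proof. by rewrite /ph; congr (cos _ -i* sin _); ring. Qed.

Lemma phN x xi : ph (- x) xi = ph x (- xi).
Proof. by rewrite /ph mulrN mulrN mulNr. Qed.

Lemma ph_cdiff x xi : cdiff (ph x) xi ((0 -i* (2 * pi * x)) * ph x xi).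
Proof.
have D : is_derive xi 1 (fun xi => 2 * pi * x * xi) (2 * pi * x).
  apply: is_derive_eqd (is_deriveZ (2 * pi * x) (is_derive_id xi 1)) _.
  by rewrite /GRing.scale/= mulr1.
split; rewrite ?cReM ?cImM /=.
  apply: is_derive_eqd (is_derive1_comp (is_derive_cos _) D) _.
  by rewrite /GRing.scale/=; ring.
have := is_deriveN (is_derive1_comp (is_derive_sin _) D).
by move=> /is_derive_eqd; apply; rewrite /GRing.scale/=; ring.
Qed.

Lemma cmeasurable_ph x : cmeasurable (ph x).
Proof. by apply: cdiff_cmeasurable => xi; exact: ph_cdiff. Qed.

Lemma fourierE f xi : fourier f xi = cint (fun x => f x * ph x xi).
Proof. by []. Qed.

Lemma cintegrable_ph f xi : cintegrable f -> cintegrable (fun x => f x * ph x xi).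
Proof.
move=> hf; apply: cintegrable_le (cintegrable_normc hf).
  apply: cmeasurableM; first exact: cintegrable_measurable.
  by rewrite (_ : ph^~ xi = ph xi); [exact: cmeasurable_ph|apply/funext => y; exact: phC].
by move=> x; rewrite normcM normc_ph mulr1.
Qed.

Lemma fourier_bound f xi : cintegrable f ->
  normc (fourier f xi) <= \int[mu]_x normc (f x).
Proof.
move=> hf; rewrite fourierE; apply: normc_cint_le (cintegrable_normc hf).
  exact: cintegrable_measurable (cintegrable_ph xi hf).
by move=> x; rewrite normcM normc_ph mulr1.
Qed.

Lemma fourier_cdiff f xi : sch f ->
  cdiff (fourier f) xi (fourier (fun x => (0 -i* (2 * pi)) * (x%:C * f x)) xi).
Proof.
move=> hf; pose g x : C := (0 -i* (2 * pi)) * (x%:C * f x).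
have hg : sch g by apply/schZ/sch_mulx.
have := @cint_diff R (fun xi x => f x * ph x xi) (fun xi x => g x * ph x xi) xi
  (fun x => normc (g x)); apply.
- by move=> y _; apply: cintegrable_ph; exact: sch_cintegrable.
- move=> y x _; apply: cdiff_eq (cdiffZ (f x) (ph_cdiff x y)) _.
  have -> : (0 -i* (2 * pi * x)) = (0 -i* (2 * pi)) * x%:C :> R[i].
    by apply: complex_ext; rewrite ?cReM ?cImM/=; ring.
  by rewrite /g; ring.
- exact/cintegrable_normc/sch_cintegrable.
- by move=> y x _; rewrite normcM normc_ph mulr1.
Qed.

Lemma fourierZ (c : R[i]) f xi : cintegrable f ->
  fourier (fun x => c * f x) xi = c * fourier f xi.
Proof.
move=> hf; rewrite !fourierE -cintZ; last exact: cintegrable_ph.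
by apply: eq_cint => x; rewrite mulrA.
Qed.

Lemma fourier_cderiv f xi : sch f ->
  fourier (cderiv 1%N f) xi = (0 +i* (2 * pi * xi)) * fourier f xi.
Proof.
move=> hf; set c : R[i] := (0 +i* (2 * pi * xi)).
have hf1 : sch (cderiv 1%N f) by exact: sch_cderiv.
have hf2 : sch (cderiv 1%N (cderiv 1%N f)) by exact: sch_cderiv.
have dph x : cdiff (ph^~ xi) x (- c * ph x xi).
  rewrite (_ : ph^~ xi = ph xi); last by apply/funext => y; exact: phC.
  apply: cdiff_eq (ph_cdiff xi x) _; rewrite phC; congr (_ * _).
  by rewrite /c; apply: complex_ext; rewrite ?cReN ?cImN/= ?oppr0.
have [M M0 HM] := rapid_K0 (sch_rapid0 hf).
have i1 := cintegrable_ph xi (sch_cintegrable hf1).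
have i2 := cintegrable_ph xi (sch_cintegrable hf).
suff : cint (fun x => cderiv 1%N f x * ph x xi - c * (f x * ph x xi)) = 0.
  rewrite cintB//; last exact: cintegrableZ.
  by rewrite cintZ// => /eqP; rewrite subr_eq0 => /eqP.
apply: (@cint_derive0 R (fun x => f x * ph x xi) _
  (fun x => (cderiv 1%N f x * (- c * ph x xi) + cderiv 1%N (cderiv 1%N f) x * ph x xi)
    - c * (f x * (- c * ph x xi) + cderiv 1%N f x * ph x xi)) M).
- move=> x; apply: cdiff_eq (cdiffM (sch_cdiff x hf) (dph x)) _.
  by ring.
- move=> x; apply: cdiffB; first exact: cdiffM (sch_cdiff x hf1) (dph x).
  by apply: cdiffZ; exact: cdiffM (sch_cdiff x hf) (dph x).
- by apply: cintegrableB => //; exact: cintegrableZ.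
- by move=> x; rewrite normcM normc_ph mulr1.
Qed.

(** The Schwartz seminorms up to order [N], bounded in the same form as in the definition of
    [tempered]. *)
Definition schnorm_le (N : nat) f (M : R) := forall k n x, (k <= N)%N -> (n <= N)%N ->
  `|x| ^+ k * normc (cderiv n f x) <= M.

Lemma schnorm_leW (N N' : nat) f M : (N <= N')%N -> schnorm_le N' f M -> schnorm_le N f M.
Proof. by move=> NN h k n x kN nN; apply: h; exact: leq_trans NN. Qed.

(** Bounding both [|f|] and [x^2 |f|] by [M] gives [|f| <= 2 M K0], and [K0] has integral [pi]. *)
Lemma fourier_schnorm0 f M : sch f -> schnorm_le 2 f M ->
  forall xi, normc (fourier f xi) <= 2 * pi * M.
Proof.
move=> hf hM xi; have M0 : 0 <= M.
  by apply: le_trans (hM 0%N 0%N 0 _ _) => //; rewrite mulr_ge0 ?normc_ge0.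
have hK x : normc (f x) <= (2 * M) * K0 x.
  rewrite /K0 ler_pdivlMr ?onesq_gt0// mulrDr mulr1 mulr2n mulrDl mul1r.
  have := lerD (hM 0%N 0%N x isT isT) (hM 2%N 0%N x isT isT).
  by rewrite cderiv_0 expr0 mul1r real_normK ?num_real// [_ ^+ 2 * _]mulrC.
apply: le_trans (fourier_bound xi (sch_cintegrable hf)) _.
apply: (@le_trans _ _ (\int[mu]_x ((2 * M) * K0 x))).
  apply: le_Rintegral => //; first exact/cintegrable_normc/sch_cintegrable.
  exact/rintZ/rint_K0.
rewrite RintegralZl//; last exact: rint_K0.
by rewrite /Rintegral integral_K0/= mulrAC.
Qed.

Lemma fourier_cderiv2 f xi : sch f ->
  fourier (cderiv 2%N f) xi = - ((2 * pi * xi) ^+ 2)%:C * fourier f xi.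
Proof.
move=> hf; rewrite cderivS !fourier_cderiv//; last exact: sch_cderiv.
by rewrite mulrA; congr (_ * _); apply: complex_ext; rewrite ?cReM ?cImM ?cReN ?cImN /=; ring.
Qed.

(** A factor [1 + xi^2] is traded for two derivatives of [f], since the transform of [f''] is
    [- (2 pi xi)^2] times that of [f]; this explains the [N.+2] and the constant [c / (2 * pi) ^+ 2]
    in the induction. *)
Lemma fourier_schnorm k : exists (N : nat) (c : R), forall f M, sch f -> schnorm_le N f M ->
  forall xi, (1 + xi ^+ 2) ^+ k * normc (fourier f xi) <= c * M.
Proof.
elim: k => [|k [N [c IH]]].
  by exists 2%N, (2 * pi) => f M hf hM xi; rewrite expr0 mul1r; exact: fourier_schnorm0.
exists N.+2, (c + c / (2 * pi) ^+ 2) => f M hf hM xi.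
have p0 : (2 * pi : R) != 0 by rewrite mulf_neq0// gt_eqF// pi_gt0.
have p1 : 0 < (2 * pi : R) ^+ 2 by rewrite exprn_even_gt0.
have h1 := IH f M hf (schnorm_leW (leq_trans (leqnSn _) (leqnSn _)) hM) xi.
have h2 : (1 + xi ^+ 2) ^+ k * normc (fourier (cderiv 2%N f) xi) <= c * M.
  apply: IH; first exact: sch_cderiv.
  move=> j n x jN nN; rewrite cderiv_add addn2; apply: hM; last by [].
  exact: leq_trans jN (leq_trans (leqnSn _) (leqnSn _)).
rewrite fourier_cderiv2// mulNr normcN normcM normc_real ger0_norm ?sqr_ge0// in h2.
rewrite [_ ^+ k.+1]exprSr mulrDr mulr1 [leLHS]mulrDl [leRHS]mulrDl; apply: lerD => //.
rewrite [leRHS]mulrAC ler_pdivlMr//; apply: le_trans h2.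
by rewrite le_eqVlt; apply/orP; left; apply/eqP; rewrite exprMn; ring.
Qed.

Lemma sch_schnorm f N : sch f -> exists M, schnorm_le N f M.
Proof.
move=> /schP[_ hf].
have H : forall k n, exists2 M : R, 0 <= M & forall x, `|x| ^+ k * normc (cderiv n f x) <= M.
  move=> k n; have [M HM] := hf k n; exists M => //.
  by apply: le_trans (HM 0); rewrite mulr_ge0 ?normc_ge0// exprn_ge0.
have H1 (K : nat) n : exists2 M : R, 0 <= M & forall k x, (k <= K)%N -> `|x| ^+ k * normc (cderiv n f x) <= M.
  elim: K => [|K [M M0 IH]].
    by have [M M0 HM] := H 0%N n; exists M => // k x; rewrite leqn0 => /eqP ->.
  have [M' M'0 HM] := H K.+1 n; exists (M + M'); first by rewrite addr_ge0.
  move=> k x; rewrite leq_eqVlt => /predU1P[->|kK]; first by rewrite (le_trans (HM x))// lerDr.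
  by rewrite (le_trans (IH _ x kK))// lerDl.
have H2 (K : nat) : exists2 M : R, 0 <= M & forall k n x, (k <= N)%N -> (n <= K)%N ->
    `|x| ^+ k * normc (cderiv n f x) <= M.
  elim: K => [|K [M M0 IH]].
    by have [M M0 HM] := H1 N 0%N; exists M => // k n x kN; rewrite leqn0 => /eqP ->; exact: HM.
  have [M' M'0 HM] := H1 N K.+1; exists (M + M'); first by rewrite addr_ge0.
  move=> k n x kN; rewrite leq_eqVlt => /predU1P[->|kK]; first by rewrite (le_trans (HM k x kN))// lerDr.
  by rewrite (le_trans (IH _ _ x kN kK))// lerDl.
by have [M _ HM] := H2 N; exists M => k n x; exact: HM.
Qed.

Lemma sch_fourier f : sch f -> sch (fourier f).
Proof.
move=> hf; apply: (@sch_class _ (fun h => exists2 g, sch g & h = fourier g)); last by exists f.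
- move=> _ [g hg ->].
  exists (fourier (fun x => (0 -i* (2 * pi)) * (x%:C * g x))); last by move=> x; exact: fourier_cdiff.
  by exists (fun x => (0 -i* (2 * pi)) * (x%:C * g x)) => //; apply/schZ/sch_mulx.
- move=> _ [g hg ->] k; have [N [c H]] := fourier_schnorm k.
  by have [M HM] := sch_schnorm N hg; exists (c * M); exact: H.
Qed.

(** The multiplication formula: Fubini, together with the symmetry of the character in its two
    arguments. *)
Lemma fourier_mult f g : cintegrable f -> cintegrable g ->
  cint (fun x => fourier f x * g x) = cint (fun x => f x * fourier g x).
Proof.
move=> hf hg.
transitivity (cint (fun xi => cint (fun x => f x * g xi * ph x xi))).
  apply: eq_cint => xi; rewrite fourierE mulrC -cintZ; last exact: cintegrable_ph.
  by apply: eq_cint => x; ring.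
rewrite (@cint_fubini _ _ (fun x y => normc (g x) * normc (f y))).
- apply: eq_cint => x; rewrite fourierE -cintZ; last exact: cintegrable_ph.
  by apply: eq_cint => y; rewrite phC; ring.
- apply: cmeasurable2M.
    apply: cmeasurable2M.
      exact: (cmeasurable2_2 (cintegrable_measurable hf)).
    exact: (cmeasurable2_1 (cintegrable_measurable hg)).
  have := @cmeasurable2_comp R (ph 1) (fun z => z.2 * z.1) (cmeasurable_ph 1).
  rewrite (_ : (fun x y => ph 1 _) = (fun x y => ph y x)); last first.
    by apply/funext => x; apply/funext => y; rewrite /ph mulr1 mulrA.
  by apply; apply: measurable_funM; [exact: measurable_snd|exact: measurable_fst].
- by move=> x y; rewrite !normcM normc_ph mulr1 mulrC.
by apply: prodint_tensor; [exact: cintegrable_normc..|move=> x; exact: normc_ge0|move=> x; exact: normc_ge0].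
Qed.

Lemma fourier_shift f b xi : cintegrable f ->
  fourier (fun x => f (x - b)) xi = ph b xi * fourier f xi.
Proof.
move=> hf; rewrite fourierE.
rewrite (cint_shift b); last by apply: cintegrable_ph; have := cintegrable_affine (- b) (@oner_neq0 R) hf; under eq_fun do rewrite mul1r.
rewrite fourierE -cintZ; last exact: cintegrable_ph.
by apply: eq_cint => x; rewrite addrK phD; ring.
Qed.

Lemma fourier_dilate f (a : R) xi : 0 < a -> cintegrable f ->
  fourier f (a * xi) = a%:C^-1 * fourier (fun x => f (a^-1 * x)) xi.
Proof.
move=> a0 hf; have a1 : a != 0 by rewrite gt_eqF.
rewrite fourierE (@cint_affine _ a^-1 0) ?invr_eq0//; last exact: cintegrable_ph.
rewrite gtr0_norm ?invr_gt0// fmorphV; congr (_ * _); rewrite fourierE.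
by apply: eq_cint => x; rewrite addr0 phZ mulrA mulVf// mul1r.
Qed.

Lemma fourier_opp f xi : cintegrable f -> fourier (fun x => f (- x)) xi = fourier f (- xi).
Proof.
move=> hf; rewrite !fourierE [RHS]cint_opp; last exact: cintegrable_ph.
by apply: eq_cint => x; rewrite -phN opprK.
Qed.

End fourier_transform.

(** * The Gaussian and Fourier inversion *)

Section fourier_inversion.
Context {R : realType}.
Local Notation C := (R[i]^o).
Local Notation mu := (@lebesgue_measure R).
Local Notation Re := complex.Re.
Local Notation Im := complex.Im.
Implicit Types (f g : R -> C) (x y xi : R).

Definition gauss (x : R) : C := (expR (- (pi * x ^+ 2)))%:C.

Lemma gauss_cdiff x : cdiff gauss x ((- (2 * pi))%:C * (x%:C * gauss x)).
Proof.
have -> : (- (2 * pi))%:C * (x%:C * gauss x) =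
    (- (2 * pi * x) * expR (- (pi * x ^+ 2)))%:C :> R[i].
  by rewrite /gauss mulrA -!rmorphM/= mulNr.
apply: cdiff_real.
have D : is_derive x 1 (fun x : R => - (pi * x ^+ 2)) (- (2 * pi * x)).
  have := is_deriveN (is_deriveZ pi (is_deriveX 2%N (is_derive_id x 1))).
  by move=> /is_derive_eqd; apply; rewrite /GRing.scale/= expr1 mulr1 mulr2n; ring.
apply: is_derive_eqd (is_derive1_comp (is_derive_expR _) D) _.
by rewrite /GRing.scale/= mulrC.
Qed.

(** Polynomial multiples of the Gaussian, generated by the operations that occur when one of them is
    differentiated. *)
Inductive gauss_class : (R -> C) -> Prop :=
| gauss_base : gauss_class gauss
| gauss_mulx f : gauss_class f -> gauss_class (fun x => x%:C * f x)
| gauss_scale (c : R[i]) f : gauss_class f -> gauss_class (fun x => c * f x)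
| gauss_add f g : gauss_class f -> gauss_class g -> gauss_class (fun x => f x + g x).

Lemma sch_gauss : sch gauss.
Proof.
apply: (@sch_class _ gauss_class); last exact: gauss_base.
- move=> f; elim => {f} [|f hf [f' hf' df]|c f hf [f' hf' df]|f g hf [f' hf' df] hg [g' hg' dg]].
  + exists (fun x => (- (2 * pi))%:C * (x%:C * gauss x)); last exact: gauss_cdiff.
    exact/gauss_scale/gauss_mulx/gauss_base.
  + exists (fun x => x%:C * f' x + f x); first by apply: gauss_add => //; exact: gauss_mulx.
    by move=> x; apply: cdiff_eq (cdiffM (cdiff_id x) (df x)) _; rewrite mul1r.
  + by exists (fun x => c * f' x); [exact: gauss_scale|move=> x; exact: cdiffZ].
  + by exists (fun x => f' x + g' x); [exact: gauss_add|move=> x; exact: cdiffD].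
- move=> f; elim => {f} [|f hf IH|c f hf IH|f g hf IHf hg IHg].
  + move=> k; exists (k.+1%:R ^+ k) => x.
    rewrite normc_real ger0_norm ?expR_ge0// expRN ler_pdivrMr ?expR_gt0//.
    have k0 : (0 : R) < k.+1%:R by [].
    (* From [1 + x^2 <= (k + 1) exp t], the [k]-th power is at most [(k + 1)^k exp (k t)], and
       [k t <= x^2 <= pi x^2]. Dividing by [k + 1] also covers [k = 0]. *)
    pose t : R := x ^+ 2 / k.+1%:R.
    have t0 : 0 <= t by rewrite divr_ge0 ?sqr_ge0.
    have h1 : 1 + x ^+ 2 <= k.+1%:R * expR t.
      apply: (@le_trans _ _ (k.+1%:R * (1 + t))).
        rewrite mulrDr mulr1 /t mulrCA divff ?gt_eqF// mulr1 lerD2r.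
        by rewrite ler1n.
      by rewrite ler_wpM2l// expR_ge1Dx.
    apply: (@le_trans _ _ ((k.+1%:R * expR t) ^+ k)).
      by rewrite lerXn2r// nnegrE ?mulr_ge0 ?expR_ge0// ltW// onesq_gt0.
    rewrite exprMn ler_wpM2l// ?exprn_ge0// -expRM_natl ler_expR.
    apply: (@le_trans _ _ (x ^+ 2)).
      rewrite /t mulrCA ler_piMr ?sqr_ge0// ler_pdivrMr// mul1r ler_nat.
      exact: leqnSn.
    by rewrite ler_peMl ?sqr_ge0// (le_trans _ (pi_ge2 R))// ler1n.
  + exact: rapid_mulx.
  + exact: rapidZ.
  + exact: rapidD.
Qed.

Lemma cint_gauss : cint gauss = 1.
Proof.
have p0 : Num.sqrt (pi : R) != 0 by rewrite gt_eqF// sqrtr_gt0 pi_gt0.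
have sp : 0 < Num.sqrt (pi : R) by rewrite sqrtr_gt0 pi_gt0.
apply: complex_ext => /=; last first.
  by rewrite (_ : ImF _ = cst 0) ?Rintegral_cst ?mul0r.
have := Rintegral_affine 0 p0 integrableT_gauss.
rewrite {1}/Rintegral integralT_gauss/= gtr0_norm// => /esym h.
apply: (mulfI p0); rewrite mulr1 -[RHS]h; congr (_ * _).
congr Rintegral; apply/funext => x.
by rewrite /ReF/= /gauss_fun addr0 exprMn sqr_sqrtr// ltW// pi_gt0.
Qed.

Lemma real_cst_of_derive0 (h : R -> R) : (forall x : R, is_derive x 1 h 0) ->
  forall x, h x = h 0.
Proof. by move=> dh x; exact: is_derive_0_is_cst. Qed.

(** The Gaussian and its transform solve the same equation [y' = - 2 pi x y]. Hence the transform
    times [exp (pi x^2)] is constant, and its value at 0 is the Gauss integral, which is 1. *)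
Lemma fourier_gauss : fourier gauss = gauss.
Proof.
have hg := sch_gauss.
have ig := sch_cintegrable hg.
have dG xi : cdiff (fourier gauss) xi ((- (2 * pi))%:C * (xi%:C * fourier gauss xi)).
  apply: cdiff_eq (fourier_cdiff xi hg) _.
  have -> : (fun x => (0 -i* (2 * pi)) * (x%:C * gauss x)) =
      (fun x => (0 +i* 1) * cderiv 1%N gauss x) :> (R -> C).
    apply/funext => x; rewrite (cdiff_cderiv1 (gauss_cdiff x)) [RHS]mulrA; congr (_ * _).
    by apply: complex_ext; rewrite ?cReM ?cImM/=; ring.
  rewrite fourierZ; last exact/sch_cintegrable/sch_cderiv.
  rewrite fourier_cderiv// !mulrA; congr (_ * _).
  by apply: complex_ext; rewrite ?cReM ?cImM/=; ring.
pose E x : C := (expR (pi * x ^+ 2))%:C.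
have dE x : cdiff E x ((2 * pi * x)%:C * E x).
  rewrite /E -rmorphM/=; apply: cdiff_real.
  have D : is_derive x 1 (fun x : R => pi * x ^+ 2) (2 * pi * x).
    have := is_deriveZ pi (is_deriveX 2%N (is_derive_id x 1)).
    by move=> /is_derive_eqd; apply; rewrite /GRing.scale/= expr1 mulr1 mulr2n; ring.
  apply: is_derive_eqd (is_derive1_comp (is_derive_expR _) D) _.
  by rewrite /GRing.scale/= mulrC.
have dGE x : cdiff (fun x => fourier gauss x * E x) x 0.
  apply: cdiff_eq (cdiffM (dG x) (dE x)) _.
  rewrite -[X in _ + X]mulrA; apply/eqP; rewrite -[X in _ == X](subrr 0); apply/eqP.
  by rewrite rmorphN rmorphM/=; ring.
have c0 x : fourier gauss x * E x = fourier gauss 0 * E 0.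
  apply: complex_ext.
    by apply: (@real_cst_of_derive0 (ReF (fun x => fourier gauss x * E x))) => y; have [] := dGE y.
  by apply: (@real_cst_of_derive0 (ImF (fun x => fourier gauss x * E x))) => y; have [] := dGE y.
have g0 : fourier gauss 0 = 1.
  rewrite fourierE -cint_gauss; apply: eq_cint => x.
  by rewrite phC ph0 mulr1.
apply/funext => x; have := c0 x.
rewrite g0 mul1r /E expr0n/= mulr0 expR0 => h.
rewrite -[LHS]mulr1 -(_ : (E x : R[i]) * gauss x = 1) ?mulrA ?h ?mul1r//.
by rewrite -rmorphM/= -expRD subrr expR0.
Qed.

(** Dominated convergence for the two components. Convergence is expressed by the modulus of the
    difference, so that limits are taken in the reals. *)
Lemma cint_dominated (u : nat -> R -> C) f (g : R -> R) :
  (forall n, cmeasurable (u n)) -> cmeasurable f ->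
  (forall n x, normc (u n x) <= g x) -> rint g ->
  (forall x, normc (u n x - f x) @[n --> \oo] --> (0 : R)) ->
  (normc (cint (u n) - cint f) @[n --> \oo] --> (0 : R)).
Proof.
move=> mu_ mf ug ig uf.
have rd (v : nat -> R -> R) (h : R -> R) : (forall n, measurable_fun setT (v n)) ->
    measurable_fun setT h -> (forall n x, `|v n x| <= g x) ->
    (forall x, `|v n x - h x| @[n --> \oo] --> (0 : R)) ->
    rint h /\ (`|\int[mu]_x v n x - \int[mu]_x h x| @[n --> \oo] --> (0 : R)).
  move=> mv mh vg vh.
  have cvx x : v n x @[n --> \oo] --> h x.
    apply/cvgrPdist_lt => e e0; have /cvgrPdist_lt/(_ e e0) := vh x.
    by apply: filterS => n; rewrite sub0r normrN normr_id distrC.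
  have := @dominated_convergence _ _ R mu setT measurableT
    (fun n => EFin \o v n) (EFin \o h) (EFin \o g).
  case=> //.
  - by move=> n; apply/measurable_EFinP; exact: mv.
  - by apply/measurable_EFinP; exact: mh.
  - by apply/aeW => x _; apply: cvg_EFin; [exact: nearW|exact: cvx].
  - by apply/aeW => x n _ /=; rewrite lee_fin; exact: vg.
  move=> ih _ cv; split=> //.
  have iv n : rint (v n) by apply: rint_le ig => //; exact: vg.
  have cvR : (\int[mu]_x v n x) @[n --> \oo] --> (\int[mu]_x h x).
    apply: fine_cvg; rewrite /Rintegral fineK; last exact: (integrable_fin_num measurableT ih).
    exact: cv.
  apply/cvgrPdist_lt => e e0; move/cvgrPdist_lt : cvR => /(_ e e0).
  by apply: filterS => n; rewrite sub0r normrN normr_id distrC.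
have squeeze (a b : nat -> R) : (forall n, 0 <= a n <= b n) ->
    b n @[n --> \oo] --> (0 : R) -> a n @[n --> \oo] --> (0 : R).
  move=> ab b0; apply: (squeeze_cvgr (f := fun=> 0) (h := b)) => //; last exact: cvg_cst.
  by apply: nearW.
have [iR cR] : rint (ReF f) /\ (`|\int[mu]_x ReF (u n) x - \int[mu]_x ReF f x| @[n --> \oo] --> (0 : R)).
  apply: rd.
  - by move=> n; have [] := mu_ n.
  - by have [] := mf.
  - by move=> n x; apply: le_trans (ug n x); exact: normc_Re.
  - move=> x; apply: squeeze (uf x) => n; rewrite normr_ge0/=.
    by have := normc_Re (u n x - f x); rewrite cReD cReN.
have [iI cI] : rint (ImF f) /\ (`|\int[mu]_x ImF (u n) x - \int[mu]_x ImF f x| @[n --> \oo] --> (0 : R)).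
  apply: rd.
  - by move=> n; have [] := mu_ n.
  - by have [] := mf.
  - by move=> n x; apply: le_trans (ug n x); exact: normc_Im.
  - move=> x; apply: squeeze (uf x) => n; rewrite normr_ge0/=.
    by have := normc_Im (u n x - f x); rewrite cImD cImN.
have h : `|\int[mu]_x ReF (u n) x - \int[mu]_x ReF f x| +
    `|\int[mu]_x ImF (u n) x - \int[mu]_x ImF f x| @[n --> \oo] --> (0 : R).
  by rewrite -[X in _ --> X](addr0 0); exact: (cvgD cR cI).
apply: squeeze h => n; rewrite normc_ge0 andTb; apply: le_trans (normc_le _) _.
by rewrite cReD cReN cImD cImN.
Qed.

Lemma normc_cvg_unique (u : nat -> R[i]) (a b : R[i]) :
  normc (u n - a) @[n --> \oo] --> (0 : R) ->
  normc (u n - b) @[n --> \oo] --> (0 : R) -> a = b.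
Proof.
move=> ua ub; apply/eqP; rewrite -subr_eq0 -[_ == 0]negbK -normc_gt0; apply/negP => ab.
have h : 0 < normc (a - b) / 2 by rewrite divr_gt0.
move/cvgrPdist_lt : ua => /(_ _ h) ua; move/cvgrPdist_lt : ub => /(_ _ h) ub.
near \oo => n.
have h1 : normc (u n - a) < normc (a - b) / 2.
  have : `|0 - normc (u n - a)| < normc (a - b) / 2 by near: n.
  by rewrite sub0r normrN ger0_norm ?normc_ge0.
have h2 : normc (u n - b) < normc (a - b) / 2.
  have : `|0 - normc (u n - b)| < normc (a - b) / 2 by near: n.
  by rewrite sub0r normrN ger0_norm ?normc_ge0.
have := le_normcD (a - u n) (u n - b); rewrite addrA subrK.
rewrite leNgt => /negP; apply; rewrite [ltRHS]splitr; apply: ltrD => //.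
by rewrite normcB.
Unshelve. all: by end_near. Qed.

Lemma cdiff_cvg f x d (t : nat -> R) : cdiff f x d -> t n @[n --> \oo] --> x ->
  normc (f (t n) - f x) @[n --> \oo] --> (0 : R).
Proof.
move=> df tx; have [c1 c2] := cdiff_continuous df.
have h1 : `|ReF f (t n) - ReF f x| @[n --> \oo] --> (0 : R).
  rewrite -[X in _ --> X](normr0 R) -(subrr (ReF f x)).
  by apply: cvg_norm; apply: cvgB; [exact: (cvg_comp _ _ tx c1)|exact: cvg_cst].
have h2 : `|ImF f (t n) - ImF f x| @[n --> \oo] --> (0 : R).
  rewrite -[X in _ --> X](normr0 R) -(subrr (ImF f x)).
  by apply: cvg_norm; apply: cvgB; [exact: (cvg_comp _ _ tx c2)|exact: cvg_cst].
have h : `|ReF f (t n) - ReF f x| + `|ImF f (t n) - ImF f x| @[n --> \oo] --> (0 : R).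
  by rewrite -[X in _ --> X](addr0 0); exact: (cvgD h1 h2).
apply: (squeeze_cvgr (f := fun=> 0) _ _ h); last exact: cvg_cst.
apply: nearW => n; rewrite normc_ge0 andTb; apply: le_trans (normc_le _) _.
by rewrite cReD cReN cImD cImN.
Qed.

(** The convergence factor [gauss (e n * xi)] is inserted. By the multiplication formula and
    scaling, the integral then equals that of [f (e n * x) * gauss x]; as [e n] tends to 0, one form
    tends to the integral of [fourier f] and the other to [f 0]. *)
Lemma cint_fourier f : sch f -> cint (fourier f) = f 0.
Proof.
move=> hf; have hF := sch_fourier hf; have iF := sch_cintegrable hF.
have ig := sch_cintegrable sch_gauss; have iff := sch_cintegrable hf.
pose e (n : nat) : R := n.+1%:R^-1.
have e0 n : 0 < e n by rewrite invr_gt0.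
have ecv : e n @[n --> \oo] --> (0 : R) by exact: cvg_harmonic.
have G01 x : normc (gauss x) <= 1.
  by rewrite normc_real ger0_norm ?expR_ge0// -expR0 ler_expR oppr_le0 mulr_ge0 ?sqr_ge0// ltW// pi_gt0.
have gauss0 : gauss 0 = 1 by rewrite /gauss expr0n/= mulr0 oppr0 expR0.
have mdil (g : R -> C) n : cmeasurable g -> cmeasurable (fun x => g (e n * x)).
  by move=> mg; apply: (cmeasurable_comp mg); exact: measurable_funM.
have dil0 (g : R -> C) x : sch g -> normc (g (e n * x) - g 0) @[n --> \oo] --> (0 : R).
  move=> hg; apply: (cdiff_cvg (t := fun n => e n * x) (sch_cdiff 0 hg)).
  by rewrite -[X in _ --> X](mul0r x); apply: cvgM => //; exact: cvg_cst.
have A : normc (cint (fun xi => fourier f xi * gauss (e n * xi)) - cint (fourier f))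
    @[n --> \oo] --> (0 : R).
  apply: (cint_dominated (g := fun xi => normc (fourier f xi))).
  - move=> n; apply: cmeasurableM; first exact: sch_cmeasurable.
    exact/mdil/sch_cmeasurable/sch_gauss.
  - exact: sch_cmeasurable.
  - by move=> n x; rewrite normcM ler_piMr ?normc_ge0.
  - exact: cintegrable_normc.
  - move=> x; have h := dil0 gauss x sch_gauss.
    have -> : (fun n => normc (fourier f x * gauss (e n * x) - fourier f x)) =
        (fun n => normc (fourier f x) * normc (gauss (e n * x) - gauss 0)).
      by apply/funext => n; rewrite -normcM gauss0 mulrBr mulr1.
    by rewrite -[X in _ --> X](mulr0 (normc (fourier f x))); apply: cvgM => //; exact: cvg_cst.
have B : normc (cint (fun x => f (e n * x) * gauss x) - f 0 * cint gauss)
    @[n --> \oo] --> (0 : R).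
  have [M M0 HM] := rapid_K0 (sch_rapid0 hf).
  rewrite -cintZ//.
  apply: (cint_dominated (g := fun x => M * normc (gauss x))).
  - move=> n; apply: cmeasurableM; last exact/sch_cmeasurable/sch_gauss.
    exact/mdil/sch_cmeasurable.
  - by apply: cmeasurableM; [exact: cmeasurable_cst|exact/sch_cmeasurable/sch_gauss].
  - move=> n x; rewrite normcM ler_wpM2r ?normc_ge0//.
    by rewrite (le_trans (HM _))// ler_piMr// /K0 invf_le1 ?onesq_gt0// onesq_ge1.
  - exact/rintZ/cintegrable_normc.
  - move=> x; have h := dil0 f x hf.
    have -> : (fun n => normc (f (e n * x) * gauss x - f 0 * gauss x)) =
        (fun n => normc (f (e n * x) - f 0) * normc (gauss x)).
      by apply/funext => n; rewrite -normcM mulrBl.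
    by rewrite -[X in _ --> X](mul0r (normc (gauss x))); apply: cvgM => //; exact: cvg_cst.
rewrite cint_gauss mulr1 in B.
have AB n : cint (fun xi => fourier f xi * gauss (e n * xi)) =
    cint (fun x => f (e n * x) * gauss x).
  have en1 : e n != 0 by rewrite gt_eqF.
  have sn : cintegrable (fun xi => gauss (e n * xi)).
    have := cintegrable_affine 0 en1 ig; under eq_fun do rewrite addr0.
    by [].
  rewrite fourier_mult//.
  have Fn x : fourier (fun xi => gauss (e n * xi)) x = (e n)%:C^-1 * gauss ((e n)^-1 * x).
    have h := @fourier_dilate R (fun xi => gauss (e n * xi)) (e n) ((e n)^-1 * x) (e0 n) sn.
    move: h; rewrite mulrA divff// mul1r => ->; congr (_ * _).
    rewrite -[RHS](_ : fourier gauss ((e n)^-1 * x) = _); last by rewrite fourier_gauss.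
    by rewrite !fourierE; apply: eq_cint => y; rewrite mulrA divff// mul1r.
  rewrite (@eq_cint _ _ (fun x => (e n)%:C^-1 * (f x * gauss ((e n)^-1 * x)))); last first.
    by move=> x; rewrite Fn; ring.
  have i1 : cintegrable (fun x => f x * gauss ((e n)^-1 * x)).
    apply: cintegrable_le (cintegrable_normc iff).
      apply: cmeasurableM; first exact: sch_cmeasurable.
      by apply: (cmeasurable_comp (sch_cmeasurable sch_gauss)); exact: measurable_funM.
    by move=> x; rewrite normcM ler_piMr ?normc_ge0.
  rewrite cintZ// (cint_affine 0 en1 i1) gtr0_norm// mulrA mulVf ?mul1r; last first.
    by rewrite (fmorph_eq0 (real_complex R)).
  by apply: eq_cint => x; rewrite addr0 mulrA mulVf// mul1r.
apply: normc_cvg_unique A _.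
have -> : (fun n => normc (cint (fun xi => fourier f xi * gauss (e n * xi)) - f 0)) =
    (fun n => normc (cint (fun x => f (e n * x) * gauss x) - f 0)).
  by apply/funext => n; rewrite AB.
exact: B.
Qed.

(** The case of the value at 0, applied to a translate of [f]: translation becomes multiplication by
    the character. *)
Theorem fourier_inversion f x : sch f -> fourier (fourier f) x = f (- x).
Proof.
move=> hf; have hs : sch (fun y => f (y - x)) by exact: sch_shift.
have := cint_fourier hs; rewrite sub0r => <-.
rewrite fourierE; apply: eq_cint => xi.
by rewrite fourier_shift 1?mulrC 1?phC//; exact: sch_cintegrable.
Qed.

Definition ifourier f : R -> C := fun x => fourier f (- x).

Lemma sch_ifourier f : sch f -> sch (ifourier f).
Proof. by move=> /sch_fourier/sch_opp. Qed.

Lemma ifourierK f : sch f -> fourier (ifourier f) = f.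
Proof.
move=> hf; apply/funext => x; rewrite fourier_opp; last exact/sch_cintegrable/sch_fourier.
by rewrite fourier_inversion// opprK.
Qed.

Lemma fourierK f : sch f -> ifourier (fourier f) = f.
Proof. by move=> hf; apply/funext => x; rewrite /ifourier fourier_inversion// opprK. Qed.

End fourier_inversion.

(** * Weighted square-integrable functions *)

Section real_L2.
Context {R : realType}.
Local Notation mu := (@lebesgue_measure R).
Implicit Types (a b : R -> R).

Definition l2 a := measurable_fun setT a /\ rint (fun x => a x ^+ 2).

Lemma l2M a b : l2 a -> l2 b -> rint (fun x => a x * b x).
Proof.
move=> [ma ia] [mb ib]; apply: rint_le (rintD ia ib); first exact: measurable_funM.
move=> x; rewrite normrM -[a x ^+ 2]real_normK ?num_real// -[b x ^+ 2]real_normK ?num_real//.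
rewrite -subr_ge0; have -> : `|a x| ^+ 2 + `|b x| ^+ 2 - `|a x| * `|b x| =
    (`|a x| - `|b x|) ^+ 2 + `|a x| * `|b x| by ring.
by rewrite addr_ge0 ?sqr_ge0// mulr_ge0.
Qed.

Lemma l2D a b : l2 a -> l2 b -> l2 (fun x => a x + b x).
Proof.
move=> ha hb; split; first by apply: measurable_funD; [exact: ha.1|exact: hb.1].
have -> : (fun x => (a x + b x) ^+ 2) = (fun x => a x ^+ 2 + (2 * (a x * b x) + b x ^+ 2)).
  by apply/funext => x; ring.
by apply: rintD; [exact: ha.2|apply: rintD; [exact/rintZ/l2M|exact: hb.2]].
Qed.

Lemma l2_le a b : measurable_fun setT a -> (forall x, `|a x| <= b x) -> l2 b -> l2 a.
Proof.
move=> ma ab [mb ib]; split => //; apply: rint_le ib.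
  exact: (measurable_funX 2%N ma).
by move=> x; rewrite normrX lerXn2r ?nnegrE// (le_trans (normr_ge0 _) (ab x)).
Qed.

Lemma l2Z (k : R) a : l2 a -> l2 (fun x => k * a x).
Proof.
move=> [ma ia]; split; first exact: measurable_funM.
by under eq_fun do rewrite exprMn; exact: rintZ.
Qed.

Definition l2norm a : R := Num.sqrt (\int[mu]_x (a x ^+ 2)).

Lemma l2norm_ge0 a : 0 <= l2norm a. Proof. exact: sqrtr_ge0. Qed.

Lemma sqr_l2norm a : l2norm a ^+ 2 = \int[mu]_x (a x ^+ 2).
Proof. by rewrite sqr_sqrtr// Rintegral_ge0// => x _; exact: sqr_ge0. Qed.

Lemma l2norm_le a b : (forall x, `|a x| <= b x) -> measurable_fun setT a -> l2 b ->
  l2norm a <= l2norm b.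
Proof.
move=> ab ma hb; have ha := l2_le ma ab hb; rewrite ler_wsqrtr//.
apply: le_Rintegral => //; [exact: ha.2|exact: hb.2|].
move=> x _; rewrite -[a x ^+ 2]real_normK ?num_real//.
by rewrite lerXn2r ?nnegrE// (le_trans (normr_ge0 _) (ab x)).
Qed.

(** The integral of [(t a + b)^2] is a nonnegative quadratic in [t]; evaluating it at its minimum
    [- P / A ^+ 2] gives the inequality when [A] is nonzero. *)
Lemma cauchy_schwarz a b : l2 a -> l2 b -> \int[mu]_x (a x * b x) <= l2norm a * l2norm b.
Proof.
move=> ha hb; have [_ ia] := ha; have [_ ib] := hb; have iab := l2M ha hb.
set P := Rintegral _ _ _; set A := l2norm a; set B := l2norm b.
have A0 : 0 <= A := l2norm_ge0 a; have B0 : 0 <= B := l2norm_ge0 b.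
have Q t : 0 <= t ^+ 2 * A ^+ 2 + 2 * t * P + B ^+ 2.
  rewrite !sqr_l2norm -!RintegralZl// -RintegralD//; [|exact: rintZ..].
  rewrite -RintegralD//; last by apply: rintD; exact: rintZ.
  apply: Rintegral_ge0 => x _.
  have -> : t ^+ 2 * a x ^+ 2 + 2 * t * (a x * b x) + b x ^+ 2 = (t * a x + b x) ^+ 2 by ring.
  exact: sqr_ge0.
have [P0|P0] := leP P 0; first by rewrite (le_trans P0)// mulr_ge0.
have [A1|A1] := eqVneq A 0.
  (* With [A = 0] the quadratic degenerates to an affine function of slope [2 P > 0]; at this [t]
     its value is [- (B^2 + 2)], which is negative. *)
  have := Q (- (B ^+ 2 + 1) / P); rewrite A1 expr0n/= mulr0 add0r.
  have -> : 2 * (- (B ^+ 2 + 1) / P) * P + B ^+ 2 = - (B ^+ 2 + 2).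
    by field; rewrite gt_eqF.
  by rewrite oppr_ge0 leNgt ltr_wpDl// sqr_ge0.
have := Q (- P / A ^+ 2).
have -> : (- P / A ^+ 2) ^+ 2 * A ^+ 2 + 2 * (- P / A ^+ 2) * P + B ^+ 2 =
    ((A * B) ^+ 2 - P ^+ 2) / A ^+ 2 by field.
rewrite pmulr_lge0 ?invr_gt0 ?exprn_even_gt0// subr_ge0.
by rewrite ler_pXn2r// nnegrE ?mulr_ge0// ltW.
Qed.

Lemma l2norm_triangle a b : l2 a -> l2 b ->
  l2norm (fun x => a x + b x) <= l2norm a + l2norm b.
Proof.
move=> ha hb; have [_ ia] := ha; have [_ ib] := hb; have iab := l2M ha hb.
rewrite -(ler_pXn2r (ltn0Sn 1)) ?nnegrE ?addr_ge0 ?l2norm_ge0//.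
rewrite sqr_l2norm.
have -> : (fun x => (a x + b x) ^+ 2) = (fun x => a x ^+ 2 + (2 * (a x * b x) + b x ^+ 2)).
  by apply/funext => x; ring.
rewrite RintegralD//; last by apply: rintD => //; exact: rintZ.
rewrite RintegralD//; last exact: rintZ.
rewrite RintegralZl// -!sqr_l2norm.
have h := cauchy_schwarz ha hb.
have -> : (l2norm a + l2norm b) ^+ 2 =
  l2norm a ^+ 2 + (2 * (l2norm a * l2norm b) + l2norm b ^+ 2) by ring.
by rewrite lerD2l lerD2r ler_wpM2l.
Qed.

Lemma l2normZ (k : R) a : l2 a -> l2norm (fun x => k * a x) = `|k| * l2norm a.
Proof.
move=> [_ ia]; rewrite /l2norm; under eq_Rintegral do rewrite exprMn.
by rewrite RintegralZl// sqrtrM ?sqr_ge0// sqrtr_sqr.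
Qed.

Lemma LnormE a : measurable_fun setT a -> (forall x, 0 <= a x) ->
  (Lnorm mu 2%:E (EFin \o a) < +oo)%E <-> rint (fun x => a x ^+ 2).
Proof.
move=> ma a0; have E : (\int[mu]_x (`|(EFin \o a) x| `^ 2) = \int[mu]_x (a x ^+ 2)%:E)%E.
  by apply: eq_integral => x _; rewrite /= ger0_norm// powR_mulrn.
have ms : measurable_fun setT (fun x => a x ^+ 2) by exact: (measurable_funX 2%N ma).
split=> [h|h].
  apply: rint_ge0P => //; first by move=> x; exact: sqr_ge0.
  rewrite -E -poweR_Lnorm//; exact: poweR_lty.
rewrite unlock E poweR_lty//.
by rewrite rint_EFin// ltry.
Qed.

Lemma fine_LnormE a : measurable_fun setT a -> (forall x, 0 <= a x) ->
  rint (fun x => a x ^+ 2) -> fine (Lnorm mu 2%:E (EFin \o a)) = l2norm a.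
Proof.
move=> ma a0 ia.
have E : (\int[mu]_x (`|(EFin \o a) x| `^ 2) = \int[mu]_x (a x ^+ 2)%:E)%E.
  by apply: eq_integral => x _; rewrite /= ger0_norm// powR_mulrn.
rewrite unlock E rint_EFin// poweR_EFin/= powR12_sqrt//.
by apply: Rintegral_ge0 => x _; exact: sqr_ge0.
Qed.

End real_L2.

(** * Sobolev weights *)

Section weights.
Context {R : realType}.
Implicit Types (s : R) (x y : R).

(** The Japanese bracket to the power [s], that is, the factor inside [weighted_norm]. *)
Definition wt s x : R := (1 + x ^+ 2) `^ (s / 2).

Lemma wt_gt0 s x : 0 < wt s x.
Proof. by rewrite powR_gt0// onesq_gt0. Qed.

Lemma wt_ge0 s x : 0 <= wt s x. Proof. exact/ltW/wt_gt0. Qed.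

Lemma wtNx s x : wt s (- x) = wt s x. Proof. by rewrite /wt sqrrN. Qed.

Lemma wtN s x : wt (- s) x = (wt s x)^-1.
Proof. by rewrite /wt mulNr powRN. Qed.

Lemma wtK s x : wt (- s) x * wt s x = 1.
Proof. by rewrite wtN mulVf// gt_eqF// wt_gt0. Qed.

Lemma wtVK s x : wt s x * wt (- s) x = 1.
Proof. by rewrite mulrC wtK. Qed.

Lemma wt_mono s s' x : s <= s' -> wt s x <= wt s' x.
Proof. by move=> ss; rewrite ler_powR ?onesq_ge1// ler_pM2r. Qed.

Lemma wt_le_nat s : exists N : nat, forall x, wt s x <= (1 + x ^+ 2) ^+ N.
Proof.
exists (Num.truncn `|s|).+1 => x; rewrite -powR_mulrn; last exact/ltW/onesq_gt0.
rewrite ler_powR ?onesq_ge1//; apply: le_trans (ltW (truncnS_gt _)).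
rewrite ler_pdivrMr// (le_trans (ler_norm _))// ler_peMr// ler1n//.
Qed.

Lemma wt_continuous s : continuous (wt s).
Proof.
move=> x; rewrite /wt.
apply: (@continuous_comp _ _ _ (fun x : R => 1 + x ^+ 2) (fun y : R => y `^ (s / 2))).
  by apply: continuous_oneDsqr.
apply/differentiable_continuous/derivable1_diffP; apply: derivable_powR.
by rewrite in_itv/= andbT onesq_gt0.
Qed.

Lemma measurable_wt s : measurable_fun setT (wt s).
Proof. by apply: continuous_measurable_fun; exact: wt_continuous. Qed.

(** Peetre's inequality raised to the power [t / 2] for [t >= 0]; for negative order, exchange [x]
    and [y] and take inverses. The real exponent of [1 + (y - x)^2] is rounded up to a natural
    number to match [rapid]. *)
Lemma peetre_wt s : exists (N : nat) (D : R), 0 <= D /\ forall x y,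
  wt s y <= D * (1 + (y - x) ^+ 2) ^+ N * wt s x.
Proof.
suff H t : 0 <= t -> exists (N : nat) (D : R), 0 <= D /\ forall x y,
    wt t y <= D * (1 + (y - x) ^+ 2) ^+ N * wt t x.
  have [s0|s0] := leP 0 s; first exact: H.
  have [|N [D [D0 h]]] := H (- s); first by rewrite oppr_ge0 ltW.
  exists N, D; split=> // x y; have := h y x.
  rewrite !wtN -[(x - y) ^+ 2]sqrrN opprB ler_pdivlMr ?wt_gt0//.
  by rewrite mulrC ler_pdivrMr ?wt_gt0.
move=> t0; have [N hN] := wt_le_nat t; exists N, (2 `^ (t / 2)); split; first exact: powR_ge0.
move=> x y; apply: (@le_trans _ _ ((2 * (1 + (y - x) ^+ 2) * (1 + x ^+ 2)) `^ (t / 2))).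
  apply: ge0_ler_powR; rewrite ?divr_ge0// ?nnegrE; last exact: peetre.
  - exact/ltW/onesq_gt0.
  - by rewrite !mulr_ge0// ltW// onesq_gt0.
rewrite !powRM ?mulr_ge0 ?(ltW (onesq_gt0 _))//.
rewrite ler_wpM2r ?powR_ge0// ler_wpM2l ?powR_ge0//.
exact: hN.
Qed.

End weights.

(** * Complex weighted L^2 spaces and their duality *)

Section complex_L2.
Context {R : realType}.
Local Notation C := (R[i]^o).
Local Notation mu := (@lebesgue_measure R).
Implicit Types (w v k : R -> C) (s : R).

(** The weighted L^2 space that is the Fourier image of [H^s(R)]; [nrm s] is its norm, and
    [wabs s w] the real function whose L^2 norm it is. *)
Definition cl2 s w := cmeasurable w /\ (weighted_norm s w < +oo)%E.
Definition wabs s w (x : R) : R := wt s x * normc (w x).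
Definition nrm s w : R := fine (weighted_norm s w).

Lemma aeS (P Q : R -> Prop) : {ae mu, forall x, P x} -> (forall x, P x -> Q x) ->
  {ae mu, forall x, Q x}.
Proof.
by move=> hP PQ; apply: (@filterS _ _ (ae_filter_ringOfSetsType mu) _ _ _ hP).
Qed.

Lemma aeS2 (P Q T : R -> Prop) : {ae mu, forall x, P x} -> {ae mu, forall x, Q x} ->
  (forall x, P x -> Q x -> T x) -> {ae mu, forall x, T x}.
Proof.
by move=> hP hQ PQ; apply: (@filterS2 _ _ (ae_filter_ringOfSetsType mu) _ _ _ _ hP hQ).
Qed.

Lemma wabs_ge0 s w x : 0 <= wabs s w x.
Proof. by rewrite mulr_ge0 ?wt_ge0 ?normc_ge0. Qed.

Lemma measurable_wabs s w : cmeasurable w -> measurable_fun setT (wabs s w).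
Proof.
by move=> mw; apply: measurable_funM; [exact: measurable_wt|exact: cmeasurable_normc].
Qed.

Lemma cl2P s w : cl2 s w <-> cmeasurable w /\ l2 (wabs s w).
Proof.
split=> [[mw h]|[mw [_ h]]]; split => //.
  split; first exact: measurable_wabs.
  by apply/LnormE => //; [exact: measurable_wabs|exact: wabs_ge0].
by apply/(@LnormE _ (wabs s w)) => //; [exact: measurable_wabs|exact: wabs_ge0].
Qed.

Lemma cl2_l2 s w : cl2 s w -> l2 (wabs s w). Proof. by move=> /cl2P[]. Qed.

Lemma nrmE s w : cl2 s w -> nrm s w = l2norm (wabs s w).
Proof.
move=> /cl2P[mw [m h]].
by rewrite /nrm /weighted_norm -[RHS]fine_LnormE//; exact: wabs_ge0.
Qed.

Lemma nrm_ge0 s w : 0 <= nrm s w.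
Proof. by rewrite fine_ge0// /weighted_norm Lnorm_ge0. Qed.

Lemma cl2_le s s' w v : cmeasurable w ->
  (forall x, wabs s w x <= wabs s' v x) -> cl2 s' v -> cl2 s w /\ nrm s w <= nrm s' v.
Proof.
move=> mw wv hv; have l := cl2_l2 hv.
have wv' x : `|wabs s w x| <= wabs s' v x by rewrite ger0_norm ?wabs_ge0.
have hw : cl2 s w.
  by apply/cl2P; split=> //; apply: l2_le l => //; exact: measurable_wabs.
by split=> //; rewrite !nrmE//; apply: l2norm_le => //; exact: measurable_wabs.
Qed.

Lemma wabs_sub s s' w x : s <= s' -> wabs s w x <= wabs s' w x.
Proof. by move=> ss; rewrite ler_wpM2r ?normc_ge0// wt_mono. Qed.

Lemma cl2_sub s s' w : s <= s' -> cl2 s' w -> cl2 s w /\ nrm s w <= nrm s' w.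
Proof. by move=> ss hw; apply: cl2_le => //; [exact: hw.1|move=> x; exact: wabs_sub]. Qed.

Lemma cl2D_nrm s w v : cl2 s w -> cl2 s v ->
  cl2 s (fun x => w x + v x) /\ nrm s (fun x => w x + v x) <= nrm s w + nrm s v.
Proof.
move=> hw hv; have lw := cl2_l2 hw; have lv := cl2_l2 hv.
have m : cmeasurable (fun x => w x + v x) by apply: cmeasurableD; [exact: hw.1|exact: hv.1].
have le x : `|wabs s (fun x => w x + v x) x| <= wabs s w x + wabs s v x.
  by rewrite ger0_norm ?wabs_ge0// -mulrDr ler_wpM2l ?wt_ge0// le_normcD.
have h : cl2 s (fun x => w x + v x).
  by apply/cl2P; split=> //; apply: l2_le (l2D lw lv) => //; exact: measurable_wabs.
split=> //; rewrite !nrmE//; apply: le_trans (l2norm_triangle lw lv).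
by apply: l2norm_le (l2D lw lv) => //; exact: measurable_wabs.
Qed.

Lemma cl2Z_nrm s (c : R[i]) w : cl2 s w ->
  cl2 s (fun x => c * w x) /\ nrm s (fun x => c * w x) = normc c * nrm s w.
Proof.
move=> hw; have lw := cl2_l2 hw.
have m : cmeasurable (fun x => c * w x).
  by apply: cmeasurableM; [exact: cmeasurable_cst|exact: hw.1].
have E : wabs s (fun x => c * w x) = fun x => normc c * wabs s w x.
  by apply/funext => x; rewrite /wabs normcM mulrCA.
have h : cl2 s (fun x => c * w x) by apply/cl2P; split=> //; rewrite E; exact: l2Z.
by split=> //; rewrite !nrmE// E l2normZ// ger0_norm ?normc_ge0.
Qed.

Lemma cl2B_nrm s w v : cl2 s w -> cl2 s v ->
  cl2 s (fun x => w x - v x) /\ nrm s (fun x => w x - v x) <= nrm s w + nrm s v.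
Proof.
move=> hw hv; have [hv' nv'] := cl2Z_nrm (-1) hv.
have := cl2D_nrm hw hv'; rewrite nv' normcN normc1 mul1r.
by under eq_fun do rewrite mulN1r.
Qed.

Lemma rapid_cl2 s w : cmeasurable w -> rapid w -> cl2 s w.
Proof.
move=> mw rw; apply/cl2P; split=> //.
have [N hN] := wt_le_nat s; have [M HM] := rw N.+1.
have le x : `|wabs s w x| <= M * K0 x.
  rewrite ger0_norm ?wabs_ge0// /K0 ler_pdivlMr ?onesq_gt0//.
  apply: le_trans (HM x); rewrite [_ ^+ N.+1]exprSr mulrAC ler_wpM2r ?normc_ge0//.
  by rewrite ler_wpM2r// ltW// onesq_gt0.
split; first exact: measurable_wabs.
apply: rint_le (rintZ (M ^+ 2) (rint_K0)).
  by apply: (measurable_funX 2%N); exact: measurable_wabs.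
move=> x; rewrite normrX; apply: (@le_trans _ _ ((M * K0 x) ^+ 2)).
  by rewrite lerXn2r ?nnegrE// (le_trans (normr_ge0 _) (le x)).
rewrite exprMn ler_wpM2l ?sqr_ge0// expr2 ler_piMr ?K0_ge0//.
by rewrite /K0 invf_le1 ?onesq_gt0// onesq_ge1.
Qed.

Lemma sch_cl2 s w : sch w -> cl2 s w.
Proof. by move=> hw; apply: rapid_cl2; [exact: sch_cmeasurable|exact: sch_rapid0]. Qed.

Lemma cl2_opp s w : cl2 s w -> cl2 s (fun x => w (- x)) /\ nrm s (fun x => w (- x)) = nrm s w.
Proof.
move=> hw; have [mw [m i]] := (cl2P s w).1 hw.
have m1 : (-1 : R) != 0 by rewrite oppr_eq0 oner_neq0.
have mw' : cmeasurable (fun x => w (- x)).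
  apply: (cmeasurable_comp mw); have := @measurable_affine R (-1) 0.
  by under eq_fun do rewrite mulN1r addr0.
have E : (fun x => wabs s (fun x => w (- x)) x ^+ 2) = fun x => wabs s w (-1 * x + 0) ^+ 2.
  by apply/funext => x; rewrite mulN1r addr0 /wabs wtNx.
have h : cl2 s (fun x => w (- x)).
  apply/cl2P; split=> //; split; first exact: measurable_wabs.
  by rewrite E; exact: (rint_affine 0 m1 i).
split=> //; rewrite !nrmE// /l2norm E (Rintegral_affine 0 m1 i).
by rewrite normrN1 mul1r.
Qed.

(** The weights of orders [- s] and [s] cancel pointwise, which reduces the estimate to the
    Cauchy-Schwarz inequality. *)
Lemma cl2_pair s w v : cl2 (- s) w -> cl2 s v ->
  cintegrable (fun x => w x * v x) /\
  normc (cint (fun x => w x * v x)) <= nrm (- s) w * nrm s v.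
Proof.
move=> hw hv; have lw := cl2_l2 hw; have lv := cl2_l2 hv.
have m : cmeasurable (fun x => w x * v x) by apply: cmeasurableM; [exact: hw.1|exact: hv.1].
have le x : normc (w x * v x) <= wabs (- s) w x * wabs s v x.
  by rewrite /wabs mulrACA wtK mul1r normcM.
have i := l2M lw lv; split; first exact: cintegrable_le le i.
by apply: le_trans (normc_cint_le m le i) _; rewrite !nrmE//; exact: cauchy_schwarz.
Qed.

Lemma cl2_pair_le s w v : cl2 s w -> cl2 (- s) v ->
  cintegrable (fun x => w x * v x) /\
  normc (cint (fun x => w x * v x)) <= nrm s w * nrm (- s) v.
Proof.
move=> hw hv; have := @cl2_pair (- s) w v; rewrite opprK; exact.
Qed.

Lemma ae_cint w v : cmeasurable w -> cmeasurable v ->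
  {ae mu, forall x, w x = v x} -> cint w = cint v.
Proof.
move=> [w1 w2] [v1 v2] wv; apply: complex_ext => /=; congr fine.
  apply: ae_eq_integral => //; [exact/measurable_EFinP..|].
  by apply: (aeS wv) => x h _; rewrite /ReF h.
apply: ae_eq_integral => //; [exact/measurable_EFinP..|].
by apply: (aeS wv) => x h _; rewrite /ImF h.
Qed.

Lemma ae_nrm s w v : cmeasurable w -> cmeasurable v ->
  {ae mu, forall x, w x = v x} -> weighted_norm s w = weighted_norm s v.
Proof.
move=> mw mv wv; rewrite /weighted_norm unlock; congr (_ `^ _)%E.
apply: ae_eq_integral => //.
- apply: (measurableT_comp (measurable_poweR _)).
  by apply: measurableT_comp => //; apply/measurable_EFinP; exact: (measurable_wabs s mw).
- apply: (measurableT_comp (measurable_poweR _)).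
  by apply: measurableT_comp => //; apply/measurable_EFinP; exact: (measurable_wabs s mv).
by apply: (aeS wv) => x h _; rewrite h.
Qed.

Lemma nrm_eq0 s w : cl2 s w -> nrm s w = 0 -> {ae mu, forall x, w x = 0}.
Proof.
move=> hw n0; have e0 : weighted_norm s w = 0%E.
  have : weighted_norm s w \is a fin_num by rewrite ge0_fin_numE ?Lnorm_ge0//; exact: hw.2.
  by move=> /fineK <-; rewrite -/(nrm s w) n0.
have := @Lnorm_eq0_eq0 _ _ _ mu (EFin \o wabs s w) 2%:E.
move=> /(_ _ _ e0) h; have {}h := h _ _.
have {}h : (EFin \o wabs s w = \0 %[ae mu])%E.
  by apply: h => //; apply/measurable_EFinP; exact: (measurable_wabs s hw.1).
apply: (aeS h) => x /(_ I) /= -[] /eqP.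
rewrite mulf_eq0 gt_eqF ?wt_gt0//= => /eqP.
exact: eq0_normc.
Qed.

End complex_L2.

(** * Kernel estimates and Fubini for convolutions *)

Section convolution.
Context {R : realType}.
Local Notation C := (R[i]^o).
Local Notation mu := (@lebesgue_measure R).
Implicit Types (w v k : R -> C) (s : R) (x y : R).

Definition conv k w : R -> C := fun y => cint (fun x => w x * k (y - x)).

(** The decay of [k] absorbs the factor of Peetre's inequality. One more power than Peetre's
    exponent is used, and it leaves the integrable factor [K0]: up to weights, [k] acts like the
    Cauchy kernel. *)
Lemma kernel_bound s k : rapid k -> exists2 M, 0 <= M & forall x y,
  normc (k (y - x)) <= M * K0 (y - x) * wt s x * wt (- s) y.
Proof.
move=> rk; have [N [D [D0 hD]]] := peetre_wt s; have [M HM] := rk N.+1.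
have M0 : 0 <= M by apply: le_trans (HM 0); rewrite mulr_ge0 ?normc_ge0// exprn_ge0// ltW// onesq_gt0.
exists (M * D); first by rewrite mulr_ge0.
move=> x y; set z := y - x.
have z0 := onesq_gt0 z.
have hk : normc (k z) * (1 + z ^+ 2) ^+ N <= M * K0 z.
  rewrite /K0 ler_pdivlMr//; apply: le_trans (HM z).
  by rewrite [_ ^+ N.+1]exprSr; rewrite le_eqVlt; apply/orP; left; apply/eqP; ring.
rewrite wtN ler_pdivlMr ?wt_gt0//.
apply: (@le_trans _ _ (normc (k z) * (D * (1 + z ^+ 2) ^+ N * wt s x))).
  by rewrite ler_wpM2l ?normc_ge0//; exact: hD.
have -> : normc (k z) * (D * (1 + z ^+ 2) ^+ N * wt s x) =
  D * wt s x * (normc (k z) * (1 + z ^+ 2) ^+ N) by ring.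
have -> : M * D * K0 z * wt s x = D * wt s x * (M * K0 z) by ring.
by rewrite ler_wpM2l// mulr_ge0// wt_ge0.
Qed.

Lemma integral_K0_shift y : (\int[mu]_x (K0 (y - x))%:E = pi%:E)%E.
Proof.
have m1 : (-1 : R) != 0 by rewrite oppr_eq0 oner_neq0.
rewrite -(@integral_K0 R) (@ge0_integral_affine R (-1) y m1 (EFin \o K0)).
- rewrite normrN1 mul1e; apply: eq_integral => x _ /=.
  by rewrite mulN1r addrC.
- by apply/measurable_EFinP; exact: measurable_K0.
- by move=> x; rewrite lee_fin K0_ge0.
Qed.

Lemma integral_K0_shiftr x : (\int[mu]_y (K0 (y - x))%:E = pi%:E)%E.
Proof.
rewrite -(integral_K0_shift x); apply: eq_integral => y _.
by rewrite -K0N opprB.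
Qed.

Lemma measurable_K0_sub : measurable_fun setT
  (fun z : measurableTypeR R * measurableTypeR R => K0 (z.2 - z.1)).
Proof.
apply: (measurableT_comp measurable_K0).
by apply: measurable_funB; [exact: measurable_snd|exact: measurable_fst].
Qed.

Lemma measurable_K0_subr y : measurable_fun setT (fun x : R => K0 (y - x)).
Proof. by apply: (measurableT_comp measurable_K0); exact: measurable_funB. Qed.

Lemma measurable_K0_subl x : measurable_fun setT (fun y : R => K0 (y - x)).
Proof. by apply: (measurableT_comp measurable_K0); exact: measurable_funB. Qed.

Lemma integral_K0_mulr (a : R -> R) : rint a -> (forall x, 0 <= a x) ->
  (\int[mu]_x \int[mu]_y (K0 (y - x) * a x)%:E = (pi * \int[mu]_x a x)%:E)%E.
Proof.
move=> ia a0; rewrite -RintegralZl// -rint_EFin; last exact: rintZ.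
apply: eq_integral => x _; under eq_integral do rewrite mulrC EFinM.
rewrite ge0_integralZl ?lee_fin//=; last 2 first.
- by apply/measurable_EFinP; exact: measurable_K0_subl.
- by move=> y _; rewrite lee_fin K0_ge0.
by rewrite integral_K0_shiftr -EFinM mulrC.
Qed.

Lemma prodint_K0_1 (a : R -> R) : rint a -> (forall x, 0 <= a x) ->
  prodint (fun x y => K0 (y - x) * a x).
Proof.
move=> ia a0; apply: prodint_ge0.
- apply: measurable_funM; first exact: measurable_K0_sub.
  exact: (measurableT_comp (rint_measurable ia) measurable_fst).
- by move=> x y; rewrite mulr_ge0 ?K0_ge0.
by rewrite integral_K0_mulr// ltry.
Qed.

Lemma prodint_K0_2 (b : R -> R) : rint b -> (forall x, 0 <= b x) ->
  prodint (fun x y => K0 (y - x) * b y).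
Proof.
move=> ib b0; apply: prodint_ge0'.
- apply: measurable_funM; first exact: measurable_K0_sub.
  exact: (measurableT_comp (rint_measurable ib) measurable_snd).
- by move=> x y; rewrite mulr_ge0 ?K0_ge0.
rewrite (_ : (\int[mu]_y _)%E = (\int[mu]_x \int[mu]_y (K0 (y - x) * b x)%:E)%E).
  by rewrite integral_K0_mulr// ltry.
by apply: eq_integral => x _; apply: eq_integral => y _; rewrite -K0N opprB.
Qed.

(** After the weights are distributed, the integrand is [K0 (y - x)] times a product of two
    square-integrable functions. Bounding [a b] by [a^2 + b^2] separates the variables, and [K0] has
    finite mass in each of them. *)
Lemma conv_prodint s k w v : rapid k -> cl2 s w -> cl2 (- s) v ->
  exists2 g, prodint g & forall x y, normc (w x * k (y - x) * v y) <= g x y.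
Proof.
move=> rk hw hv; have [M M0 hM] := kernel_bound s rk.
have [_ iw] := cl2_l2 hw; have [_ iv] := cl2_l2 hv.
exists (fun x y => M * (K0 (y - x) * wabs s w x ^+ 2 + K0 (y - x) * wabs (- s) v y ^+ 2)).
  apply/prodintZ/prodintD; first by apply: prodint_K0_1 => // x; exact: sqr_ge0.
  by apply: prodint_K0_2 => // x; exact: sqr_ge0.
move=> x y; rewrite !normcM.
apply: (@le_trans _ _ (normc (w x) * (M * K0 (y - x) * wt s x * wt (- s) y) * normc (v y))).
  by rewrite ler_wpM2r ?normc_ge0// ler_wpM2l ?normc_ge0.
have -> : normc (w x) * (M * K0 (y - x) * wt s x * wt (- s) y) * normc (v y) =
  M * (K0 (y - x) * (wabs s w x * wabs (- s) v y)) by rewrite /wabs; ring.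
rewrite ler_wpM2l// -mulrDr ler_wpM2l ?K0_ge0// -subr_ge0.
set a := wabs s w x; set b := wabs (- s) v y.
have -> : a ^+ 2 + b ^+ 2 - a * b = (a - b) ^+ 2 + a * b by ring.
by rewrite addr_ge0 ?sqr_ge0// mulr_ge0// wabs_ge0.
Qed.

Lemma conv_integrand s k w y : sch k -> cl2 s w ->
  cintegrable (fun x => w x * k (y - x)).
Proof.
move=> hk hw; have [M M0 hM] := kernel_bound s (sch_rapid0 hk).
have [_ iw] := cl2_l2 hw.
have mk := sch_cmeasurable hk.
apply: (@cintegrable_le _ _ (fun x => (M * wt (- s) y) * (wabs s w x ^+ 2 + K0 (y - x)))).
- apply: cmeasurableM; first exact: hw.1.
  by apply: (cmeasurable_comp mk); exact: measurable_funB.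
- move=> x; rewrite normcM.
  apply: (@le_trans _ _ (normc (w x) * (M * K0 (y - x) * wt s x * wt (- s) y))).
    by rewrite ler_wpM2l ?normc_ge0.
  have -> : normc (w x) * (M * K0 (y - x) * wt s x * wt (- s) y) =
    (M * wt (- s) y) * (wabs s w x * K0 (y - x)) by rewrite /wabs; ring.
  rewrite ler_wpM2l ?mulr_ge0 ?wt_ge0//.
  set a := wabs s w x; set b := K0 (y - x).
  have b0 : 0 <= b by exact: K0_ge0.
  have b1 : b <= 1 by rewrite /b /K0 invf_le1 ?onesq_gt0// onesq_ge1.
  have hb : b ^+ 2 <= b by rewrite expr2 ler_piMr.
  apply: (@le_trans _ _ (a ^+ 2 + b ^+ 2)); last by rewrite lerD2l.
  rewrite -subr_ge0.
  have -> : a ^+ 2 + b ^+ 2 - a * b = (a - b) ^+ 2 + a * b by ring.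
  by rewrite addr_ge0 ?sqr_ge0// mulr_ge0// wabs_ge0.
apply/rintZ/rintD => //.
have m1 : (-1 : R) != 0 by rewrite oppr_eq0 oner_neq0.
have := rint_affine y m1 (@rint_K0 R).
by under eq_fun do rewrite mulN1r addrC.
Qed.

Lemma conv_fubini s k w v : sch k -> cl2 s w -> cl2 (- s) v ->
  cint (fun y => conv k w y * v y) =
  cint (fun x => w x * cint (fun y => k (y - x) * v y)).
Proof.
move=> hk hw hv; have [g ig hg] := conv_prodint (sch_rapid0 hk) hw hv.
have mk := sch_cmeasurable hk.
transitivity (cint (fun y => cint (fun x => w x * k (y - x) * v y))).
  apply: eq_cint => y; rewrite /conv mulrC -cintZ; last exact: conv_integrand hw.
  by apply: eq_cint => x; rewrite mulrC.
rewrite -(@cint_fubini _ (fun x y => w x * k (y - x) * v y) g)//; last first.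
  apply: cmeasurable2M; last exact: (cmeasurable2_2 hv.1).
  by apply: cmeasurable2M; [exact: (cmeasurable2_1 hw.1)|exact: cmeasurable2_sub].
apply: eq_cint => x; rewrite -cintZ.
  by apply: eq_cint => y; rewrite mulrA.
have := @conv_integrand (- s) (fun z => k (- z)) v x (sch_opp hk) hv.
by under eq_fun do rewrite mulrC opprB.
Qed.

End convolution.

(** * Convolution *)

Section convolution_estimates.
Context {R : realType}.
Local Notation C := (R[i]^o).
Local Notation mu := (@lebesgue_measure R).
Implicit Types (w v k : R -> C) (s : R) (x y : R).

Lemma conv_integrand_bound s k w : sch k -> exists2 M, 0 <= M & forall x y,
  normc (w x * k (y - x)) <= M * wt (- s) y * (wabs s w x ^+ 2 + K0 (y - x)).
Proof.
move=> hk; have [M M0 hM] := kernel_bound s (sch_rapid0 hk); exists M => // x y.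
rewrite normcM.
apply: (@le_trans _ _ (normc (w x) * (M * K0 (y - x) * wt s x * wt (- s) y))).
  by rewrite ler_wpM2l ?normc_ge0.
have -> : normc (w x) * (M * K0 (y - x) * wt s x * wt (- s) y) =
  (M * wt (- s) y) * (wabs s w x * K0 (y - x)) by rewrite /wabs; ring.
rewrite ler_wpM2l ?mulr_ge0 ?wt_ge0//.
set a := wabs s w x; set b := K0 (y - x).
have b0 : 0 <= b by exact: K0_ge0.
have b1 : b <= 1 by rewrite /b /K0 invf_le1 ?onesq_gt0// onesq_ge1.
have hb : b ^+ 2 <= b by rewrite expr2 ler_piMr.
apply: (@le_trans _ _ (a ^+ 2 + b ^+ 2)); last by rewrite lerD2l.
rewrite -subr_ge0.
have -> : a ^+ 2 + b ^+ 2 - a * b = (a - b) ^+ 2 + a * b by ring.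
by rewrite addr_ge0 ?sqr_ge0// mulr_ge0// wabs_ge0.
Qed.

Lemma rint_K0_sub y : rint (fun x : R => K0 (y - x)).
Proof.
have m1 : (-1 : R) != 0 by rewrite oppr_eq0 oner_neq0.
have := rint_affine y m1 (@rint_K0 R).
by under eq_fun do rewrite mulN1r addrC.
Qed.

Lemma K0_le1 x : K0 x <= 1.
Proof. by rewrite /K0 invf_le1 ?onesq_gt0// onesq_ge1. Qed.

(** The derivative falls on the kernel. A majorant valid for all [z] within 1 of [y] is required:
    there [1 + (z - y)^2 <= 2], so Peetre's inequality moves the weight from [z] to [y] at the cost
    of [D * 2 ^+ N], and [K0 (z - x)] is at most [4 * K0 (y - x)]. *)
Lemma conv_cdiff s k w y : sch k -> cl2 s w -> cdiff (conv k w) y (conv (cderiv 1%N k) w y).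
Proof.
move=> hk hw; have hk' := sch_cderiv 1%N hk.
have [M M0 hM] := conv_integrand_bound s w hk'.
have [N [D [D0 hD]]] := peetre_wt (- s).
have [_ iw] := cl2_l2 hw.
apply: (@cint_diff R (fun y x => w x * k (y - x)) (fun y x => w x * cderiv 1%N k (y - x)) y
  (fun x => (M * (D * 2 ^+ N * wt (- s) y)) * (wabs s w x ^+ 2 + 4 * K0 (y - x)))).
- by move=> z _; exact: conv_integrand hw.
- move=> z x _; apply: cdiffZ.
  have := @cdiff_affine R k 1 (- x) z (cderiv 1%N k (z - x)).
  rewrite !mul1r => /(_ (sch_cdiff _ hk)).
  by under eq_fun do rewrite mul1r.
- by apply/rintZ/rintD => //; apply/rintZ; exact: rint_K0_sub.
- move=> z x zy; apply: le_trans (hM x z) _.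
  have zy2 : 1 + (z - y) ^+ 2 <= 2.
    rewrite (_ : 2 = 1 + 1)// lerD2l -[_ ^+ 2]real_normK ?num_real//.
    by rewrite exprn_ile1// ltW.
  apply: ler_pM.
  + by rewrite mulr_ge0 ?wt_ge0.
  + by rewrite addr_ge0 ?sqr_ge0 ?K0_ge0.
  + rewrite ler_wpM2l//; apply: le_trans (hD y z) _; rewrite ler_wpM2r ?wt_ge0//.
    by rewrite ler_wpM2l// lerXn2r ?nnegrE// ltW// onesq_gt0.
  rewrite lerD2l /K0 -ler_pdivrMl// -invfM lef_pV2 ?posrE ?mulr_gt0 ?onesq_gt0//.
  apply: le_trans (peetre (y - x) (z - x)) _.
  rewrite ler_wpM2r ?(ltW (onesq_gt0 _))//.
  have -> : y - x - (z - x) = - (z - y) by ring.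
  by rewrite sqrrN (_ : 4 = 2 * 2)// ?ler_wpM2l// -natrM.
Qed.

Lemma conv_smooth s k w : sch k -> cl2 s w -> smooth_on setT (conv k w).
Proof.
move=> hk hw.
have H f : (exists2 k, sch k & f = conv k w) -> exists2 f', (exists2 k, sch k & f' = conv k w) &
    forall x, cdiff f x (f' x).
  move=> [k' hk' ->]; exists (conv (cderiv 1%N k') w).
    by exists (cderiv 1%N k') => //; exact: sch_cderiv.
  by move=> x; exact: conv_cdiff hw.
by have [] := derivative_closed_class H (ex_intro2 _ _ k hk erefl).
Qed.

Lemma prodint_rintr (f : R -> R -> R) : prodint f -> (forall y, rint (f^~ y)) ->
  rint (fun y => \int[mu]_x f x y).
Proof.
move=> hf fy; have := prodint_integralr hf; apply: eq_integrable => // y _.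
by rewrite rint_EFin.
Qed.

(** Schur's test. The kernel bound is split as [sqrt K0] times [sqrt K0 * A], and Cauchy-Schwarz in
    [x] yields one factor [pi] and the function [Q]; integrating [Q] over [y] by Fubini yields the
    second [pi]. The square root of their product appears in the constant. *)
Lemma conv_nrm s k : sch k -> exists2 M, 0 <= M & forall w, cl2 s w ->
  cl2 s (conv k w) /\ nrm s (conv k w) <= M * nrm s w.
Proof.
move=> hk; have [M M0 hM] := kernel_bound s (sch_rapid0 hk).
exists (M * pi); first by rewrite mulr_ge0 ?pi_ge0.
move=> w hw; set A := wabs s w; have [mA iA] := cl2_l2 hw; rewrite -/A in mA iA.
have A0 x : 0 <= A x by exact: wabs_ge0.
have mc : cmeasurable (conv k w) by apply: smooth_cmeasurable; exact: conv_smooth hw.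
pose Q y := \int[mu]_x (K0 (y - x) * A x ^+ 2).
have iK y : rint (fun x => K0 (y - x) * A x ^+ 2).
  apply: rint_le iA.
    by apply: measurable_funM; [exact: measurable_K0_subr|exact: (measurable_funX 2%N mA)].
  by move=> x /=; rewrite ger0_norm; [rewrite ler_piMl ?sqr_ge0 ?K0_le1|rewrite mulr_ge0 ?K0_ge0 ?sqr_ge0].
have pK : prodint (fun x y => K0 (y - x) * A x ^+ 2).
  by apply: prodint_K0_1 => // x; exact: sqr_ge0.
have iQ : rint Q by exact: prodint_rintr.
have Q0 y : 0 <= Q y by apply: Rintegral_ge0 => x _; rewrite mulr_ge0 ?K0_ge0 ?sqr_ge0.
have EQ : \int[mu]_y Q y = pi * \int[mu]_x A x ^+ 2.
  apply: EFin_inj; rewrite -(integral_K0_mulr iA) => [|x]; last exact: sqr_ge0.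
  rewrite /Q -(Rintegral_fubini pK) -rint_EFin.
    apply: eq_integral => x _; rewrite rint_EFin//.
    under eq_fun do rewrite mulrC; apply/rintZ.
    by have := rint_K0_sub x; under eq_fun do rewrite -K0N opprB.
  have -> : (fun x => \int[mu]_y (K0 (y - x) * A x ^+ 2)) = (fun x => pi * A x ^+ 2).
    apply/funext => x; rewrite RintegralZr//.
      by rewrite /Rintegral integral_K0_shiftr.
    by have := rint_K0_sub x; under eq_fun do rewrite -K0N opprB.
  exact: rintZ.
have l2a y : l2 (fun x => Num.sqrt (K0 (y - x))).
  have ms : measurable_fun setT (@Num.sqrt R).
    by apply: continuous_measurable_fun; exact: sqrt_continuous.
  split; first exact: (measurableT_comp ms (measurable_K0_subr y)).
  by under eq_fun do rewrite sqr_sqrtr ?K0_ge0//; exact: rint_K0_sub.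
have l2b y : l2 (fun x => Num.sqrt (K0 (y - x)) * A x).
  split; first by apply: measurable_funM => //; exact: (l2a y).1.
  by under eq_fun do rewrite exprMn sqr_sqrtr ?K0_ge0//; exact: iK.
have bnd y : wabs s (conv k w) y ^+ 2 <= M ^+ 2 * pi * Q y.
  have i1 : rint (fun x => K0 (y - x) * A x).
    have := l2M (l2a y) (l2b y).
    by under eq_fun do rewrite mulrA -expr2 sqr_sqrtr ?K0_ge0//.
  have h1 : normc (conv k w y) <= M * wt (- s) y * \int[mu]_x (K0 (y - x) * A x).
    rewrite -RintegralZl//; apply: normc_cint_le; last exact: rintZ.
      exact: (cintegrable_measurable (conv_integrand y hk hw)).
    move=> x; rewrite normcM.
    apply: (@le_trans _ _ (normc (w x) * (M * K0 (y - x) * wt s x * wt (- s) y))).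
      by rewrite ler_wpM2l ?normc_ge0.
    by rewrite le_eqVlt; apply/orP; left; apply/eqP; rewrite /A /wabs; ring.
  have h2 := cauchy_schwarz (l2a y) (l2b y).
  have E1 : \int[mu]_x (K0 (y - x) * A x) =
      \int[mu]_x (Num.sqrt (K0 (y - x)) * (Num.sqrt (K0 (y - x)) * A x)).
    by apply: eq_Rintegral => x _; rewrite mulrA -expr2 sqr_sqrtr ?K0_ge0.
  have E2 : (l2norm (fun x => Num.sqrt (K0 (y - x))) *
       l2norm (fun x => Num.sqrt (K0 (y - x)) * A x)) ^+ 2 = pi * Q y.
    rewrite exprMn !sqr_l2norm; congr (_ * _).
      under eq_Rintegral do rewrite sqr_sqrtr ?K0_ge0//.
      by rewrite /Rintegral integral_K0_shift.
    by apply: eq_Rintegral => x _; rewrite exprMn sqr_sqrtr ?K0_ge0.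
  have h3 : wabs s (conv k w) y <= M * (l2norm (fun x => Num.sqrt (K0 (y - x))) *
       l2norm (fun x => Num.sqrt (K0 (y - x)) * A x)).
    apply: (@le_trans _ _ (wt s y * (M * wt (- s) y * \int[mu]_x (K0 (y - x) * A x)))).
      by rewrite ler_wpM2l ?wt_ge0.
    have -> : wt s y * (M * wt (- s) y * \int[mu]_x (K0 (y - x) * A x)) =
      (wt s y * wt (- s) y) * (M * \int[mu]_x (K0 (y - x) * A x)) by ring.
    by rewrite wtVK mul1r E1 ler_wpM2l.
  rewrite -mulrA -E2 -exprMn lerXn2r ?nnegrE ?wabs_ge0//.
  by rewrite !mulr_ge0// l2norm_ge0.
have mw : measurable_fun setT (wabs s (conv k w)) by exact: measurable_wabs.
have hc : cl2 s (conv k w).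
  apply/cl2P; split=> //; split=> //.
  apply: rint_le (rintZ (M ^+ 2 * pi) iQ); first exact: (measurable_funX 2%N mw).
  by move=> y; rewrite ger0_norm ?sqr_ge0.
split=> //; rewrite !nrmE// -(ler_pXn2r (ltn0Sn 1)) ?nnegrE ?mulr_ge0 ?pi_ge0 ?l2norm_ge0//.
rewrite exprMn !sqr_l2norm.
apply: (@le_trans _ _ (\int[mu]_y (M ^+ 2 * pi * Q y))).
  apply: le_Rintegral => //; last exact: rintZ.
  by have [_ []] := (cl2P s (conv k w)).1 hc.
rewrite RintegralZl// EQ le_eqVlt; apply/orP; left; apply/eqP.
by rewrite exprMn; ring.
Qed.

End convolution_estimates.

(** * Bump functions *)

Section bumps.
Context {R : realType}.
Local Notation C := (R[i]^o).
Local Notation mu := (@lebesgue_measure R).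
Local Notation Re := complex.Re.
Local Notation Im := complex.Im.

(** The outer radius is normalized to 1, while the radius [d] of the plateau is whatever the
    exhaustion provides. *)
Definition bump (b : R -> R) (d : R) := [/\ sch (fun x => (b x)%:C), 0 < d,
  forall x, `|x| <= d -> b x = 1, forall x, 1 <= `|x| -> b x = 0 & forall x, 0 <= b x].

(** The square of the modulus of [exh_fun e 0] is smooth, real and nonnegative, whereas
    [exh_fun e 0] may take complex values. An affine change of variable centres its plateau at the
    origin. *)
Lemma exhaustion_bump (I : set R) (e : exhaustion I) : exists b d, bump b d.
Proof.
pose phi := exh_fun e 0.
pose a0 := exh_left e 0; pose b0 := exh_right e 0.
pose a1 := exh_left e 1; pose b1 := exh_right e 1.
have ab0 : a0 < b0 := exh_lt e 0.
have phi1 x : a0 <= x <= b0 -> phi x = 1 by move=> h; apply: exh_eq1; rewrite in_itv.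
have phi0 x : ~ (a1 < x < b1) -> phi x = 0.
  move=> nx; apply: contrapT => /eqP px; apply: nx.
  have : tsupport phi x by apply: subset_closure.
  by move=> /(exh_support (j := 0)) /=; rewrite in_itv.
pose c := (a0 + b0) / 2; pose r := (b0 - a0) / 2.
have r0 : 0 < r by rewrite divr_gt0// subr_gt0.
(* Large enough for [|x| >= 1] to place [rho * x + c] outside []a1, b1[]. *)
pose rho := `|a1 - c| + `|b1 - c|.
have rho0 : 0 < rho.
  have /= := exh_nested (e := e) (j := 0) => sub.
  have : `]a1, b1[%classic a0 by apply: sub; rewrite /= in_itv/= lexx ltW.
  rewrite /= in_itv/= => /andP[aa _].
  rewrite ltr_pwDl// normr_gt0 subr_eq0 lt_eqF// (lt_trans aa)//.
  by rewrite -subr_gt0 (_ : c - a0 = r)// /c /r; field.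
have rho1 : rho != 0 by rewrite gt_eqF.
exists (fun x => normc (phi (rho * x + c)) ^+ 2), (r / rho); split.
- have -> : (fun x => (normc (phi (rho * x + c)) ^+ 2)%:C) =
      (fun x => (fun y => phi y * conjc (phi y)) (rho * x + c)) :> (R -> C).
    apply/funext => x; rewrite sqr_normcE.
    by case: (phi _) => u v; apply: complex_ext; rewrite ?cReM ?cImM/=; ring.
  apply: (@sch_affine _ (fun y => phi y * conjc (phi y))) => //.
  pose h := Schwartz (sch_conj (test_sch phi)).
  exact: (test_sch (test_mul phi h)).
- by rewrite divr_gt0.
- move=> x hx; rewrite phi1 ?normc1 ?expr1n//.
  have : `|rho * x| <= r by rewrite normrM gtr0_norm// mulrC -ler_pdivlMr.
  rewrite ler_norml => /andP[h1 h2]; apply/andP; split.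
    by rewrite -lerBlDr (_ : a0 - c = - r)// /c /r; field.
  by rewrite -lerBrDr (_ : b0 - c = r)// /c /r; field.
- move=> x hx; rewrite phi0 ?normc0 ?expr0n// => /andP[h1 h2].
  have : rho <= `|rho * x| by rewrite normrM (gtr0_norm rho0) ler_peMr// ltW.
  rewrite leNgt => /negP; apply; rewrite ltr_norml; apply/andP; split.
    rewrite -subr_gt0 opprK; move: h1; rewrite -subr_gt0 => h1.
    apply: lt_le_trans h1 _; rewrite -subr_ge0.
    have -> : rho * x + rho - (rho * x + c - a1) = (`|a1 - c| + (a1 - c)) + `|b1 - c|.
      by rewrite /rho; ring.
    by rewrite addr_ge0// -lerBlDr sub0r -normrN ler_norm.
  rewrite -subr_gt0; move: h2; rewrite -subr_gt0 => h2.
  apply: lt_le_trans h2 _; rewrite -subr_ge0.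
  have -> : rho - rho * x - (b1 - (rho * x + c)) = (`|b1 - c| - (b1 - c)) + `|a1 - c|.
    by rewrite /rho; ring.
  by rewrite addr_ge0// subr_ge0 ler_norm.
- by move=> x; exact: sqr_ge0.
Qed.

Lemma sch_dilated_bump b d t : bump b d -> 0 < t -> sch (fun x => (b (t * x))%:C).
Proof. by case=> hb _ _ _ _ t0; apply: (@sch_dilate _ (fun x => (b x)%:C)); rewrite ?gt_eqF. Qed.

Lemma dilated_bump0 b d t x : bump b d -> 0 < t -> ~ `[- t^-1, t^-1]%classic x -> b (t * x) = 0.
Proof.
case=> _ _ _ b0 _ t0 nx; rewrite b0// leNgt; apply/negP => hx; apply: nx.
rewrite /= in_itv/= -ler_norml ltW//.
by move: hx; rewrite normrM gtr0_norm// -ltr_pdivlMl// mulr1.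
Qed.

Lemma smooth_bump_sch b d t (f : R -> C) : bump b d -> 0 < t -> smooth_on setT f ->
  sch (fun x => (b (t * x))%:C * f x).
Proof.
move=> hB t0 sf; have p : (fun x => (b (t * x))%:C) \in test_pred (setT : set R).
  apply/test_predP; exists `[- t^-1, t^-1]%classic.
  split; [exact/sch_smooth/(sch_dilated_bump hB)|exact: segment_compact|by []|].
  by move=> x /(dilated_bump0 hB t0) ->.
exact: (sch_test_mul (Test p) sf).
Qed.

Lemma bump_bounded b d : bump b d -> exists2 M, 0 < M & forall x, b x <= M.
Proof.
move=> [hb _ _ _ b0]; have [M HM] := sch_rapid0 hb 0%N; exists (`|M| + 1) => [|x].
  by rewrite ltr_wpDl.
have := HM x; rewrite expr0 mul1r normc_real ger0_norm// => /le_trans; apply.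
by rewrite (le_trans (ler_norm _))// lerDl.
Qed.

Lemma rint_bump b d : bump b d -> rint b.
Proof. by move=> [hb _ _ _ _]; have [] := sch_cintegrable hb. Qed.

Lemma integral_bump_gt0 b d : bump b d -> 0 < \int[mu]_x b x.
Proof.
move=> hB; have ib := rint_bump hB; have [hb d0 b1 b0 bge0] := hB.
apply: (@lt_le_trans _ _ (2 * d)); first by rewrite mulr_gt0.
rewrite -lee_fin -rint_EFin//.
have -> : ((2 * d)%:E = \int[mu]_(x in `[(- d)%R, d]) (cst 1%E x))%E.
  rewrite integral_cst//= mul1e lebesgue_measure_itv/= lte_fin ifT.
    by rewrite -EFinB; congr EFin; ring.
  by rewrite -subr_gt0 opprK addr_gt0.
rewrite integral_mkcond; apply: ge0_le_integral => //.
- by move=> x _; rewrite patchE; case: ifP.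
- by apply/(measurable_restrictT _ _).1.
- by apply/measurable_EFinP; exact: rint_measurable.
- move=> x _; rewrite patchE; case: ifPn => [|_]; last by rewrite lee_fin.
  by rewrite inE/= in_itv/= -ler_norml => hx; rewrite b1.
Qed.

(** [N] powers of [K0] absorb the weight [wt (- s)], and the last one is paired with [wabs s w]
    through [a b <= a^2 + b^2]. This yields the local integrability that Lebesgue differentiation
    asks for. *)
Lemma cl2_local s (w : R -> C) : cl2 s w -> exists N, rint (fun x => normc (w x) * K0 x ^+ N).
Proof.
move=> hw; have [N hN] := wt_le_nat (- s); exists N.+1.
have [_ iw] := cl2_l2 hw.
apply: rint_le (rintD iw (@rint_K0 R)).
  apply: measurable_funM; first exact: (cmeasurable_normc hw.1).
  exact: (measurable_funX _ measurable_K0).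
move=> x; rewrite ger0_norm ?mulr_ge0 ?normc_ge0 ?exprn_ge0 ?K0_ge0//.
have -> : normc (w x) = wt (- s) x * wabs s w x by rewrite /wabs mulrA wtK mul1r.
set a := wabs s w x; have a0 : 0 <= a := wabs_ge0 s w x.
have hk : wt (- s) x * K0 x ^+ N <= 1.
  by rewrite /K0 exprVn ler_pdivrMr ?mul1r// exprn_gt0// onesq_gt0.
have -> : wt (- s) x * a * K0 x ^+ N.+1 = (wt (- s) x * K0 x ^+ N) * (a * K0 x).
  by rewrite exprSr; ring.
apply: (@le_trans _ _ (a * K0 x)); first by rewrite ler_piMl// mulr_ge0 ?K0_ge0.
apply: (@le_trans _ _ (a ^+ 2 + K0 x ^+ 2)).
  rewrite -subr_ge0; have -> : a ^+ 2 + K0 x ^+ 2 - a * K0 x = (a - K0 x) ^+ 2 + a * K0 x by ring.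
  by rewrite addr_ge0 ?sqr_ge0// mulr_ge0 ?K0_ge0.
by rewrite lerD2l expr2 ler_piMr ?K0_ge0 ?K0_le1.
Qed.

Lemma locally_integrable_weighted (h : R -> R) N : measurable_fun setT h ->
  rint (fun x => `|h x| * K0 x ^+ N) -> locally_integrable setT h.
Proof.
move=> mh ih; split => //; first exact: openT.
move=> K _ cK; have [M [_ HM]] := compact_bounded cK.
have mK : measurable K by apply: closed_measurable; apply: compact_closed => //; exact: Rhausdorff.
pose B := (1 + (`|M| + 1) ^+ 2) ^+ N.
apply: (@le_lt_trans _ _ (\int[mu]_x (B * (`|h x| * K0 x ^+ N))%:E)%E).
  rewrite integral_mkcond; apply: ge0_le_integral => //.
  - by move=> x _; rewrite patchE; case: ifP.
  - apply/(measurable_restrictT _ _).1 => //; apply: measurable_funTS.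
    by apply/measurable_EFinP; exact: measurableT_comp.
  - by apply/measurable_EFinP; exact: (measurable_funM _ (rint_measurable ih)).
  move=> x _; rewrite patchE; case: ifPn => [|_].
    rewrite inE => Kx; rewrite lee_fin mulrCA ler_peMr//.
    rewrite /K0 exprVn ler_pdivlMr ?exprn_gt0 ?onesq_gt0// mul1r.
    rewrite lerXn2r ?nnegrE ?(ltW (onesq_gt0 _))// lerD2l -[x ^+ 2]real_normK ?num_real//.
    rewrite lerXn2r ?nnegrE ?addr_ge0//; apply: (HM (`|M| + 1)) => //.
    by rewrite (le_lt_trans (ler_norm _))// ltrDl.
  by rewrite lee_fin !mulr_ge0 ?exprn_ge0 ?K0_ge0// addr_ge0// sqr_ge0.
by rewrite rint_EFin ?ltry//; exact: rintZ.
Qed.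

(* at a Lebesgue point, averaging against shrinking bumps recovers the value *)
Lemma ae_eq0_of_bump (h : R -> R) b d : bump b d -> locally_integrable setT h ->
  (forall x0 e, 0 < e -> rint (fun x => h x * b (e^-1 * x - e^-1 * x0)) /\
     \int[mu]_x (h x * b (e^-1 * x - e^-1 * x0)) = 0) ->
  {ae mu, forall x, h x = 0}.
Proof.
move=> hB lh hz; apply: (aeS (lebesgue_differentiation lh)) => x0 lx.
have [hb d0 b1 b0 bge0] := hB; have ib := rint_bump hB.
have [B B0 hBd] := bump_bounded hB; have c0 := integral_bump_gt0 hB.
set c := Rintegral _ _ _ in c0.
have mh : measurable_fun setT h by case: lh.
(* As [h * be] has integral 0, the integral of [(h x0 - h) * be] is [h x0 * (e * c)]. It is at most
   [B] times the integral of [|h - h x0|] over the ball of radius [e], whose measure is [2 e]. *)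
have key e : 0 < e -> (((`|h x0| * c) / (2 * B))%:E <= davg h x0 e)%E.
  move=> e0; have e1 : e^-1 != 0 by rewrite invr_eq0 gt_eqF.
  have [ih iz] := hz x0 e e0; set be := fun x => b (e^-1 * x - e^-1 * x0).
  have ibe : rint be by exact: (rint_affine (- (e^-1 * x0)) e1 ib).
  have Ebe : \int[mu]_x be x = e * c.
    rewrite /c (Rintegral_affine (- (e^-1 * x0)) e1 ib) gtr0_norm ?invr_gt0//.
    by rewrite mulrA divff ?gt_eqF// mul1r.
  have i1 : rint (fun x => (h x0 - h x) * be x).
    by under eq_fun do rewrite mulrBl; apply: rintB => //; exact: rintZ.
  have E1 : \int[mu]_x ((h x0 - h x) * be x) = h x0 * (e * c).
    under eq_Rintegral do rewrite mulrBl.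
    by rewrite RintegralB// ?iz ?subr0; [rewrite RintegralZl// Ebe|exact: rintZ].
  rewrite /davg /iavg lebesgue_measure_ball ?(ltW e0)//.
  rewrite inver mulrn_eq0/= gt_eqF//=.
  rewrite lee_pdivlMl ?mulrn_wgt0// -EFinM.
  have -> : e *+ 2 * (`|h x0| * c / (2 * B)) = B^-1 * `|h x0 * (e * c)|.
    rewrite !normrM (gtr0_norm e0) (gtr0_norm c0) -mulr_natl.
    by field; rewrite gt_eqF.
  rewrite EFinM -E1 lee_pdivrMl//.
  have mball : measurable (ball x0 e : set R) by exact: measurable_ball.
  have mc : measurable_fun setT (fun y => `|(h y - h x0)%:E|%E).
    by apply: measurableT_comp => //; apply/measurable_EFinP; exact: measurable_funB.
  have mc' := measurable_funTS mc (D := ball x0 e).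
  rewrite -ge0_integralZl//; last by rewrite lee_fin ltW.
  rewrite EFin_normr_Rintegral//; apply: le_trans.
    apply: le_abse_integral => //.
    by apply/measurable_EFinP; exact: rint_measurable.
  rewrite [leRHS]integral_mkcond; apply: ge0_le_integral => //.
  - apply: measurableT_comp => //.
    by apply/measurable_EFinP; exact: rint_measurable.
  - apply/(measurable_restrictT _ _).1 => //; apply: measurable_funTS.
    exact: measurable_funeM.
  move=> x _; rewrite patchE; case: ifPn => [_|].
    rewrite /= -EFinM lee_fin normrM distrC mulrC ler_wpM2r// ger0_norm//.
    + exact: hBd.
    + exact: bge0.
  rewrite notin_setE /ball/= => /negP; rewrite -leNgt => hx.
  rewrite /be b0 ?mulr0 ?normr0//.
  rewrite -mulrBr normrM gtr0_norm ?invr_gt0// -ler_pdivrMl ?invr_gt0//.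
  by rewrite invrK mulr1 distrC.
have lim0 : (((`|h x0| * c) / (2 * B))%:E <= 0)%E.
  apply: (cvge_ge (F := (0:R)^'+) (f := davg h x0)) lx.
  by near=> e; apply: key; near: e; exact: nbhs_right_gt.
move: lim0; rewrite lee_fin pmulr_lle0 ?invr_gt0 ?mulr_gt0// pmulr_lle0//.
by rewrite normr_le0 => /eqP.
Unshelve. all: by end_near. Qed.

(** The translated and dilated bumps are real, so testing [w] against them tests its real and
    imaginary parts separately. *)
Lemma cl2_ae0 s (w : R -> C) b d : bump b d -> cl2 s w ->
  (forall psi, sch psi -> cint (fun x => w x * psi x) = 0) ->
  {ae mu, forall x, w x = 0}.
Proof.
move=> hB hw hz; have [N iN] := cl2_local hw; have [hb _ _ _ _] := hB.
have loc (h : R -> R) : measurable_fun setT h -> (forall x, `|h x| <= normc (w x)) ->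
    locally_integrable setT h.
  move=> mh hle; apply: (@locally_integrable_weighted _ N) => //; apply: rint_le iN.
    apply: measurable_funM; first exact: measurableT_comp.
    exact: (measurable_funX _ measurable_K0).
  move=> x; rewrite ger0_norm ?mulr_ge0 ?exprn_ge0 ?K0_ge0//.
  by rewrite ler_wpM2r ?exprn_ge0 ?K0_ge0.
have hpsi x0 e : 0 < e -> sch (fun x => (b (e^-1 * x - e^-1 * x0))%:C).
  move=> e0; apply: (@sch_affine _ (fun x => (b x)%:C) e^-1 (- (e^-1 * x0))) => //.
  by rewrite invr_eq0 gt_eqF.
have z x0 e : 0 < e -> let psi := fun x => (b (e^-1 * x - e^-1 * x0))%:C in
    cintegrable (fun x => w x * psi x) /\ cint (fun x => w x * psi x) = 0.
  move=> e0 psi; split; last by apply: hz; exact: hpsi.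
  by have [] := cl2_pair_le hw (sch_cl2 (- s) (hpsi x0 e e0)).
have hR : {ae mu, forall x, ReF w x = 0}.
  apply: (ae_eq0_of_bump hB).
    by apply: loc => [|x]; [have [] := hw.1|exact: normc_Re].
  move=> x0 e e0; have [[i1 _] /(congr1 (@complex.Re R))/= c1] := z x0 e e0.
  have E : ReF (fun x => w x * (b (e^-1 * x - e^-1 * x0))%:C) =
      fun x => ReF w x * b (e^-1 * x - e^-1 * x0).
    by apply/funext => x; rewrite /ReF cReM/= mulr0 subr0.
  by rewrite E in i1 c1.
have hI : {ae mu, forall x, ImF w x = 0}.
  apply: (ae_eq0_of_bump hB).
    by apply: loc => [|x]; [have [] := hw.1|exact: normc_Im].
  move=> x0 e e0; have [[_ i1] /(congr1 (@complex.Im R))/= c1] := z x0 e e0.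
  have E : ImF (fun x => w x * (b (e^-1 * x - e^-1 * x0))%:C) =
      fun x => ImF w x * b (e^-1 * x - e^-1 * x0).
    by apply/funext => x; rewrite /ImF cImM/= mulr0 add0r.
  by rewrite E in i1 c1.
by apply: (aeS2 hR hI) => x h1 h2; apply: complex_ext.
Qed.

End bumps.

(** * Sobolev spaces through the Fourier transform *)

Section fourier_representation.
Context {R : realType}.
Local Notation C := (R[i]^o).
Local Notation mu := (@lebesgue_measure R).
Implicit Types (s : R) (w z f : R -> C) (T g v : schwartz R -> C).

Definition mks f (hf : sch f) : schwartz R := Schwartz hf.

Lemma schwartz_sch (chi : schwartz R) : sch chi.
Proof. exact: schwartzP. Qed.

Lemma schwartz_ext (p q : schwartz R) : (forall x, p x = q x) -> p = q.
Proof. by move=> pq; apply: val_inj => /=; apply/funext. Qed.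

Lemma linear_at0 T : linear T -> T 0 = 0.
Proof. by move=> lT; have := lT (-1) 0 0; rewrite !scaleN1r !addNr. Qed.

Lemma test_ext (I : set R) (p q : test I) : (forall x, p x = q x) -> p = q.
Proof. by move=> pq; apply: val_inj => /=; apply/funext. Qed.

Lemma frep_cl2 s T w : fourier_repr s T w -> cl2 s w.
Proof. by case. Qed.

(** By inversion every Schwartz function is a Fourier transform, so the defining relation of
    [fourier_repr] evaluates [T] everywhere. *)
Lemma frep_eval s T w (chi : schwartz R) : fourier_repr s T w ->
  T chi = cint (fun x => w x * ifourier chi x).
Proof.
case=> _ _ h; apply: (h (mks (sch_ifourier (schwartz_sch chi)))).
by rewrite /= ifourierK//; exact: schwartz_sch.
Qed.

Lemma frepI s T w : cl2 s w ->
  (forall chi : schwartz R, T chi = cint (fun x => w x * ifourier chi x)) ->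
  fourier_repr s T w.
Proof.
move=> [mw hw] h; split=> // psi chi E; rewrite h; apply: eq_cint => x.
by rewrite E fourierK//; exact: schwartz_sch.
Qed.

Lemma cl2_cintegrable s w f : cl2 s w -> sch f -> cintegrable (fun x => w x * f x).
Proof. by move=> hw hf; have [] := cl2_pair_le hw (sch_cl2 (- s) hf). Qed.

Lemma tempered_of_fun_repr s f : sch f ->
  fourier_repr s (tempered_of_fun f) (fourier f).
Proof.
move=> hf; apply: frepI; first exact/sch_cl2/sch_fourier.
move=> chi; have hc := schwartz_sch chi; rewrite fourier_mult.
- by rewrite ifourierK.
- exact: sch_cintegrable.
- by apply: sch_cintegrable; exact: sch_ifourier.
Qed.

Lemma frepD s T g w z (c : R[i]) : fourier_repr s T w -> fourier_repr s g z ->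
  fourier_repr s (fun chi => c * T chi + g chi) (fun x => c * w x + z x).
Proof.
move=> hT hg; have hw := frep_cl2 hT; have hz := frep_cl2 hg.
have [hcw _] := cl2Z_nrm c hw; have [hs _] := cl2D_nrm hcw hz.
apply: frepI => // chi; rewrite (frep_eval chi hT) (frep_eval chi hg).
have hi : sch (ifourier chi) by apply: sch_ifourier; exact: schwartz_sch.
rewrite -cintZ; last exact: cl2_cintegrable hw _.
rewrite -cintD; last 2 first.
- by apply: cintegrableZ; exact: cl2_cintegrable hw _.
- exact: cl2_cintegrable hz _.
by apply: eq_cint => x; ring.
Qed.

Lemma nrm_le_rapid s : exists (k : nat) (c : R), 0 <= c /\ forall f M, cmeasurable f ->
  (forall x, (1 + x ^+ 2) ^+ k * normc (f x) <= M) -> nrm s f <= c * M.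
Proof.
have [N hN] := wt_le_nat s; exists N.+1, (l2norm (@K0 R)); split; first exact: l2norm_ge0.
move=> f M mf hM.
have rK : rint (fun x : R => K0 x ^+ 2).
  apply: rint_le (@rint_K0 R); first exact: (measurable_funX 2%N measurable_K0).
  by move=> x; rewrite ger0_norm ?sqr_ge0// expr2 ler_piMr ?K0_ge0 ?K0_le1.
have lK : l2 (@K0 R) by split=> //; exact: measurable_K0.
have M0 : 0 <= M.
  by apply: le_trans (hM 0); rewrite mulr_ge0 ?normc_ge0// exprn_ge0// ltW// onesq_gt0.
have le x : `|wabs s f x| <= M * K0 x.
  rewrite ger0_norm ?wabs_ge0// /K0 ler_pdivlMr ?onesq_gt0//.
  apply: le_trans (hM x); rewrite [_ ^+ N.+1]exprSr mulrAC ler_wpM2r ?normc_ge0//.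
  by rewrite ler_wpM2r// ltW// onesq_gt0.
have hl : l2 (wabs s f) by apply: l2_le (l2Z M lK) => //; exact: measurable_wabs.
rewrite nrmE; last by apply/cl2P.
apply: le_trans (l2norm_le le (measurable_wabs s mf) (l2Z M lK)) _.
by rewrite l2normZ// ger0_norm// mulrC.
Qed.

Lemma tempered_frep s T w : linear T -> fourier_repr s T w -> tempered T.
Proof.
move=> lT hT; split=> //; have hw := frep_cl2 hT.
have [k [c [c0 hc]]] := nrm_le_rapid (- s).
have [N [c' hc']] := @fourier_schnorm R k.
exists N, (nrm s w * (c * c')) => psi M hM; rewrite (frep_eval psi hT).
have hp := schwartz_sch psi; have hi := sch_ifourier hp.
have [_ h] := cl2_pair_le hw (sch_cl2 (- s) hi).
apply: le_trans h _; rewrite -mulrA ler_wpM2l ?nrm_ge0// -mulrA.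
apply: hc; first exact: sch_cmeasurable.
by move=> x; have := hc' psi M hp hM (- x); rewrite sqrrN.
Qed.

Section with_bump.
Variables (b : R -> R) (d : R).
Hypothesis hB : bump b d.

(** Both representatives lie in the weighted space of the smaller order, where their difference
    annihilates all Schwartz functions. Allowing two orders makes norms of different orders
    comparable. *)
Lemma frep_ae s s' T w z : fourier_repr s T w -> fourier_repr s' T z ->
  {ae mu, forall x, w x = z x}.
Proof.
move=> hT hT'; pose t := Num.min s s'.
have [hw _] : cl2 t w /\ nrm t w <= nrm s w.
  by apply: cl2_sub (frep_cl2 hT); rewrite ge_min lexx.
have [hz _] : cl2 t z /\ nrm t z <= nrm s' z.
  by apply: cl2_sub (frep_cl2 hT'); rewrite ge_min lexx orbT.
have [hwz _] := cl2B_nrm hw hz.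
have h : {ae mu, forall x, w x - z x = 0}.
  apply: (cl2_ae0 hB hwz) => psi hpsi.
  have E : (fun x => (w x - z x) * psi x) = (fun x => w x * psi x - z x * psi x).
    by apply/funext => x; rewrite mulrBl.
  rewrite E cintB; [|exact: cl2_cintegrable hw _|exact: cl2_cintegrable hz _].
  have h1 := frep_eval (mks (sch_fourier hpsi)) hT.
  have h2 := frep_eval (mks (sch_fourier hpsi)) hT'.
  by rewrite /= fourierK// in h1 h2; rewrite -h1 -h2 subrr.
by apply: (aeS h) => x /eqP; rewrite subr_eq0 => /eqP.
Qed.

Lemma Hs_fourier_fun s T : Hs s T -> fourier_repr s T (fourier_fun s T).
Proof.
move=> [_ [w hw]]; rewrite /fourier_fun; exact: (@xgetPex _ (cst 0) _ (ex_intro _ w hw)).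
Qed.

Lemma Hs_normE s T w : fourier_repr s T w -> Hs_norm s T = nrm s w.
Proof.
move=> hT; have hf : fourier_repr s T (fourier_fun s T).
  by rewrite /fourier_fun; exact: (@xgetPex _ (cst 0) _ (ex_intro _ w hT)).
rewrite /Hs_norm /nrm (@ae_nrm _ s (fourier_fun s T) w)//; [exact: (frep_cl2 hf).1|exact: (frep_cl2 hT).1|].
exact: frep_ae hf hT.
Qed.

Lemma Hs_pairingE s g v w z : fourier_repr (- s) g w -> fourier_repr s v z ->
  Hs_pairing s g v = cint (fun x => w x * z (- x)).
Proof.
move=> hg hv.
have hg' : fourier_repr (- s) g (fourier_fun (- s) g).
  by rewrite /fourier_fun; exact: (@xgetPex _ (cst 0) _ (ex_intro _ w hg)).
have hv' : fourier_repr s v (fourier_fun s v).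
  by rewrite /fourier_fun; exact: (@xgetPex _ (cst 0) _ (ex_intro _ z hv)).
rewrite /Hs_pairing; set w' := fourier_fun _ g in hg' *; set z' := fourier_fun s v in hv' *.
have hw := frep_cl2 hg; have hw' := frep_cl2 hg'.
have hz := frep_cl2 hv; have hz' := frep_cl2 hv'.
have [oz nz] := cl2_opp hz; have [oz' nz'] := cl2_opp hz'.
transitivity (cint (fun x => w x * z' (- x))).
  apply: ae_cint.
  - by apply: cmeasurableM; [exact: hw'.1|exact: oz'.1].
  - by apply: cmeasurableM; [exact: hw.1|exact: oz'.1].
  by apply: (aeS (frep_ae hg' hg)) => x ->.
have [i1 _] := cl2_pair hw oz'; have [i2 _] := cl2_pair hw oz.
(* The second representative occurs reflected. Rather than transporting a null set through the
   reflection, the difference is estimated by its norm, which is invariant under reflection and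
   equals 0. *)
apply/eqP; rewrite -subr_eq0 -cintB//; apply/eqP/eq0_normc/eqP.
have [hd _] := cl2B_nrm hz' hz; have [od nd] := cl2_opp hd.
have [_ le] := cl2_pair hw od.
have E : (fun x => w x * z' (- x) - w x * z (- x)) = (fun x => w x * (z' (- x) - z (- x))).
  by apply/funext => x; rewrite mulrBr.
rewrite eq_le normc_ge0 andbT E; apply: le_trans le _; rewrite nd.
have m0 : cmeasurable (fun=> 0 : C) by exact: cmeasurable_cst.
rewrite /nrm (@ae_nrm _ s _ (fun=> 0))//; last 2 first.
- exact: hd.1.
- by apply: (aeS (frep_ae hv' hv)) => x ->; rewrite subrr.
have -> : weighted_norm s (fun=> 0 : C) = 0%E.
  rewrite /weighted_norm -[RHS](@Lnorm0 _ _ _ mu 2%:E)//.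
  by apply: eq_Lnorm => x; rewrite -[normc _]/(normc (0 : R[i])) normc0 mulr0.
by rewrite mulr0.
Qed.

Lemma Hs_pairing_le s g v : Hs (- s) g -> Hs s v ->
  normc (Hs_pairing s g v) <= Hs_norm (- s) g * Hs_norm s v.
Proof.
move=> /Hs_fourier_fun hg /Hs_fourier_fun hv.
have [oz nz] := cl2_opp (frep_cl2 hv).
have [_] := cl2_pair (frep_cl2 hg) oz; rewrite nz.
by rewrite (Hs_normE hg) (Hs_normE hv) (Hs_pairingE hg hv).
Qed.

Lemma Hs_pairing_funr s g f : Hs (- s) g -> forall hf : sch f,
  Hs_pairing s g (tempered_of_fun f) = g (mks hf).
Proof.
move=> /Hs_fourier_fun hg hf.
by rewrite (Hs_pairingE hg (tempered_of_fun_repr s hf)) (frep_eval _ hg).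
Qed.

Lemma Hs_pairing_funl s v f : Hs s v -> forall hf : sch f,
  Hs_pairing s (tempered_of_fun f) v = v (mks hf).
Proof.
move=> /Hs_fourier_fun hv hf; have hz := frep_cl2 hv.
rewrite (Hs_pairingE (tempered_of_fun_repr (- s) hf) hv) (frep_eval _ hv) cint_opp.
  by apply: eq_cint => x; rewrite opprK mulrC.
have [oz _] := cl2_opp hz.
by have [] := cl2_pair (sch_cl2 (- s) (sch_fourier hf)) oz.
Qed.

Lemma Hs_norm0_eq0 s T : Hs s T -> Hs_norm s T = 0 -> forall chi, T chi = 0.
Proof.
move=> /Hs_fourier_fun hT; rewrite (Hs_normE hT) => n0 chi.
have hw := frep_cl2 hT; have h := nrm_eq0 hw n0.
rewrite (frep_eval chi hT) (@ae_cint _ _ (fun=> 0)) ?cint0//.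
- apply: cmeasurableM; first exact: hw.1.
  by apply: sch_cmeasurable; apply: sch_ifourier; exact: schwartz_sch.
- exact: cmeasurable_cst.
- by apply: (aeS h) => x ->; rewrite mul0r.
Qed.

Lemma Hs_norm_ge0 s T : 0 <= Hs_norm s T.
Proof. by rewrite /Hs_norm fine_ge0// Lnorm_ge0. Qed.

End with_bump.

Lemma Hs_lin s T g (c : R[i]) : Hs s T -> Hs s g -> Hs s (fun chi => c * T chi + g chi).
Proof.
move=> [[lT _] [w hw]] [[lg _] [z hz]].
have h := frepD c hw hz; split; last by exists (fun x => c * w x + z x).
apply: tempered_frep h => a u v; rewrite lT lg /GRing.scale/=; ring.
Qed.

Lemma Hs_sub s s' T : s <= s' -> Hs s' T -> Hs s T.
Proof.
move=> ss [hT [w hw]]; split=> //; exists w.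
have [hc _] := cl2_sub ss (frep_cl2 hw).
by apply: frepI => // chi; exact: frep_eval hw.
Qed.

Lemma frep_sub s s' T w : s <= s' -> fourier_repr s' T w -> fourier_repr s T w.
Proof.
move=> ss hw; have [hc _] := cl2_sub ss (frep_cl2 hw).
by apply: frepI => // chi; exact: frep_eval hw.
Qed.

Lemma linear_tempered_of_fun f : sch f -> linear (@tempered_of_fun R f).
Proof.
move=> hf a u v; rewrite /tempered_of_fun.
have hT := tempered_of_fun_repr 0 hf.
have i (p : schwartz R) : cintegrable (fun x => f x * p x).
  apply: (cl2_cintegrable (s := 0)); first exact: sch_cl2.
  exact: schwartz_sch.
rewrite [RHS](_ : _ = a * cint (fun x => f x * u x) + cint (fun x => f x * v x))//.
rewrite -cintZ// -cintD//; last exact: cintegrableZ.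
by apply: eq_cint => x; rewrite mulrDr; congr (_ + _); rewrite mulrCA.
Qed.

Lemma Hs_tempered_of_fun s f : sch f -> Hs s (tempered_of_fun f).
Proof.
move=> hf; have h := tempered_of_fun_repr s hf; split; last by exists (fourier f).
by apply: tempered_frep h; exact: linear_tempered_of_fun.
Qed.

End fourier_representation.

(** * Locality *)

Section locality.
Context {R : realType}.
Local Notation C := (R[i]^o).
Implicit Types (f a : R -> C) (T : schwartz R -> C).

Lemma cderivM1 f g x : smooth_on setT f -> smooth_on setT g ->
  cderiv 1%N (fun y => f y * g y : C) x = f x * cderiv 1%N g x + cderiv 1%N f x * g x.
Proof.
move=> sf sg; apply: cdiff_cderiv1.
exact: cdiffM (smooth_cdiff0 x sf) (smooth_cdiff0 x sg).
Qed.

Lemma smoothD f g : smooth_on setT f -> smooth_on setT g ->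
  smooth_on setT (fun x => f x + g x).
Proof.
move=> sf sg; have := smooth_lin 1 sf sg; rewrite scale1r.
by [].
Qed.

Lemma cderivD f g n x : smooth_on setT f -> smooth_on setT g ->
  cderiv n (fun y => f y + g y) x = cderiv n f x + cderiv n g x.
Proof.
move=> sf sg; have := cderivE 1 n sf sg; rewrite !scale1r => h.
by rewrite -[RHS]/((cderiv n f + cderiv n g) x) -h.
Qed.

Lemma cderiv_dilate f (t : R) n : smooth_on setT f ->
  cderiv n (fun x => f (t * x)) = (fun x => (t ^+ n)%:C * cderiv n f (t * x)) :> (R -> C).
Proof.
move=> sf; elim: n => [|n IH]; first by rewrite !cderiv_0; apply/funext => x; rewrite expr0 mul1r.
rewrite cderivS IH; apply/funext => x; apply: cdiff_cderiv1.
have := @cdiff_affine R (cderiv n f) t 0 x (cderiv n.+1 f (t * x)).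
rewrite addr0 => /(_ (smooth_cdiff n (t * x) sf)).
under eq_fun do rewrite addr0.
move=> /(cdiffZ (t ^+ n)%:C) /cdiff_eq; apply.
by rewrite mulrA -rmorphM/= exprSr.
Qed.

(** Smallness relative to [1 + x^2]: the functions [1 - beta (x / n)] do not tend to 0 uniformly,
    but they do in this sense, and a Schwartz factor absorbs the growth. *)
Definition deriv_small (n : nat) (e : R) a :=
  forall j x, (j <= n)%N -> normc (cderiv j a x) <= e * (1 + x ^+ 2).

Lemma leibniz_small n f k : sch f -> exists2 D, 0 <= D & forall e a, 0 <= e ->
  smooth_on setT a -> deriv_small n e a ->
  forall x, `|x| ^+ k * normc (cderiv n (fun y => a y * f y : C) x) <= D * e.
Proof.
elim: n f => [|n IH] f hf.
  have [M HM] := sch_rapid0 hf k.+1; exists M.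
    by apply: le_trans (HM 0); rewrite mulr_ge0 ?normc_ge0// exprn_ge0// ltW// onesq_gt0.
  move=> e a e0 sa ha x; rewrite cderiv_0 normcM.
  have := ha 0%N x isT; rewrite cderiv_0 => h0.
  apply: (@le_trans _ _ (`|x| ^+ k * (e * (1 + x ^+ 2) * normc (f x)))).
    by rewrite ler_wpM2l ?exprn_ge0// ler_wpM2r ?normc_ge0.
  have -> : `|x| ^+ k * (e * (1 + x ^+ 2) * normc (f x)) =
    e * (`|x| ^+ k * ((1 + x ^+ 2) * normc (f x))) by ring.
  rewrite mulrC ler_wpM2r//; apply: le_trans (HM x).
  rewrite [_ ^+ k.+1]exprSr -mulrA ler_wpM2r ?mulr_ge0 ?normc_ge0 ?(ltW (onesq_gt0 _))//.
  by rewrite lerXn2r ?nnegrE ?(ltW (onesq_gt0 _))// norm_le_onesq.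
have hf' := sch_cderiv 1%N hf.
have [D1 D10 H1] := IH f hf; have [D2 D20 H2] := IH _ hf'.
exists (D1 + D2); first exact: addr_ge0.
move=> e a e0 sa ha x; have sf := sch_smooth hf.
have sa' : smooth_on setT (cderiv 1%N a) by exact: smooth_cderiv.
have ha1 : deriv_small n e (cderiv 1%N a).
  by move=> j y jn; rewrite cderiv_add addn1; exact: ha.
have ha2 : deriv_small n e a by move=> j y jn; apply: ha; exact: leqW.
have E : cderiv n.+1 (fun y => a y * f y : C) =
    cderiv n (fun y => a y * cderiv 1%N f y + cderiv 1%N a y * f y).
  rewrite -(addn1 n) -cderiv_add; congr (cderiv n).
  by apply/funext => y; exact: cderivM1.
have sf' := sch_smooth hf'.
rewrite E cderivD; [|exact: smoothM..].
apply: (@le_trans _ _ (`|x| ^+ k * (normc (cderiv n (fun y => a y * cderiv 1%N f y : C) x) +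
    normc (cderiv n (fun y => cderiv 1%N a y * f y : C) x)))).
  by rewrite ler_wpM2l ?exprn_ge0// le_normcD.
rewrite mulrDr addrC mulrDl; apply: lerD; first exact: H1.
exact: H2.
Qed.

Lemma leibniz_schnorm N f : sch f -> exists2 D, 0 <= D & forall e a, 0 <= e ->
  smooth_on setT a -> deriv_small N e a -> schnorm_le N (fun y => a y * f y) (D * e).
Proof.
move=> hf.
have H1 n (K : nat) : exists2 D, 0 <= D & forall e a, 0 <= e -> smooth_on setT a ->
    deriv_small n e a -> forall k x, (k <= K)%N ->
    `|x| ^+ k * normc (cderiv n (fun y => a y * f y : C) x) <= D * e.
  elim: K => [|K [D D0 IH]].
    have [D D0 HD] := leibniz_small n 0 hf; exists D => // e a e0 sa ha k x.
    by rewrite leqn0 => /eqP ->; exact: HD.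
  have [D' D'0 HD] := leibniz_small n K.+1 hf; exists (D + D'); first exact: addr_ge0.
  move=> e a e0 sa ha k x; rewrite leq_eqVlt mulrDl => /predU1P[->|kK].
    by apply: le_trans (HD e a e0 sa ha x) _; rewrite lerDr mulr_ge0.
  by apply: le_trans (IH e a e0 sa ha _ x kK) _; rewrite lerDl mulr_ge0.
have H2 (K : nat) : exists2 D, 0 <= D & forall e a, 0 <= e -> smooth_on setT a ->
    deriv_small K e a -> forall k n x, (k <= N)%N -> (n <= K)%N ->
    `|x| ^+ k * normc (cderiv n (fun y => a y * f y : C) x) <= D * e.
  elim: K => [|K [D D0 IH]].
    have [D D0 HD] := H1 0%N N; exists D => // e a e0 sa ha k n x kN.
    by rewrite leqn0 => /eqP ->; exact: HD.
  have [D' D'0 HD] := H1 K.+1 N; exists (D + D'); first exact: addr_ge0.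
  move=> e a e0 sa ha k n x kN; rewrite leq_eqVlt mulrDl => /predU1P[->|nK].
    by apply: le_trans (HD e a e0 sa ha k x kN) _; rewrite lerDr mulr_ge0.
  apply: le_trans (IH e a e0 sa _ k n x kN nK) _; last by rewrite lerDl mulr_ge0.
  by move=> j y jK; apply: ha; exact: leqW.
have [D D0 HD] := H2 N; exists D => // e a e0 sa ha k n x; exact: HD.
Qed.

Lemma smooth_cst (c : R[i]) : smooth_on setT (fun=> c : C).
Proof.
have [] := @derivative_closed_class R (fun h => exists c, h = fun=> c) _ (fun=> c) => //; last by exists c.
by move=> _ [z ->]; exists (fun=> 0); [exists 0|move=> y; exact: cdiff_cst].
Qed.

Variables (b : R -> R) (d : R).
Hypothesis hB : bump b d.

Let beta x : C := (b x)%:C.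
Let hbeta : sch beta. Proof. by case: hB. Qed.

(** Off the plateau [|x| > d (n + 1)], so the constant bound [1 + B] is at most
    [(1 + B) (1 + x^2) / (d (n + 1))]; derivatives of positive order bring out at least one factor
    [1 / (n + 1)], and [M] bounds those of [beta]. *)
Lemma one_sub_bump_small N : exists2 c, 0 <= c & forall n : nat,
  deriv_small N (c / n.+1%:R) (fun x => 1 - beta (n.+1%:R^-1 * x)).
Proof.
have [hb d0 b1 b0 bge0] := hB; have [B B0 hBd] := bump_bounded hB.
have [M HM] := sch_schnorm N hbeta.
have M0 : 0 <= M.
  by apply: le_trans (HM 0%N 0%N 0 _ _) => //; rewrite mulr_ge0 ?normc_ge0.
exists ((1 + B) / d + M) => [|n]; first by rewrite addr_ge0// divr_ge0 ?addr_ge0// ltW.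
have n0 : (0 : R) < n.+1%:R by [].
have sb := sch_smooth hbeta.
have st : smooth_on setT (fun x => beta (n.+1%:R^-1 * x)).
  by apply: sch_smooth; apply: (sch_dilated_bump hB); rewrite invr_gt0.
have s1 := smooth_cst 1.
have sN : smooth_on setT (fun x => - beta (n.+1%:R^-1 * x)).
  have := smooth_lin (-1) st (@smooth0 R); rewrite addr0 scaleN1r.
  by [].
have ninv : n.+1%:R^-1 <= 1 :> R by rewrite invf_le1// ler1n.
move=> [|j] x jN.
  rewrite cderiv_0; have [hx|hx] := leP `|n.+1%:R^-1 * x| d.
    rewrite /beta b1// subrr normc0 mulr_ge0 ?(ltW (onesq_gt0 _))//.
    by rewrite divr_ge0// addr_ge0// divr_ge0 ?addr_ge0// ltW.
  apply: (@le_trans _ _ (1 + B)).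
    apply: le_trans (le_normcD _ _) _; rewrite normcN normc1 lerD2l normc_real ger0_norm//.
  move: hx; rewrite normrM gtr0_norm ?invr_gt0// mulrC ltr_pdivlMr// => hx.
  apply: (@le_trans _ _ ((1 + B) / d / n.+1%:R * (1 + x ^+ 2))); last first.
    rewrite ler_wpM2r ?(ltW (onesq_gt0 _))// ler_wpM2r ?invr_ge0//.
    by rewrite lerDl.
  have -> : (1 + B) / d / n.+1%:R * (1 + x ^+ 2) = (1 + B) * ((1 + x ^+ 2) / (d * n.+1%:R)).
    by field; rewrite !gt_eqF.
  rewrite ler_peMr ?addr_ge0 ?(ltW B0)// ler_pdivlMr ?mulr_gt0// mul1r.
  by rewrite (le_trans (ltW hx))// norm_le_onesq.
have E : cderiv j.+1 (fun x => 1 - beta (n.+1%:R^-1 * x)) x =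
    - ((n.+1%:R^-1 ^+ j.+1)%:C * cderiv j.+1 beta (n.+1%:R^-1 * x)).
  rewrite (cderivD _ _ s1 sN).
  have -> : cderiv j.+1 (fun=> 1 : C) x = 0.
    rewrite -addn1 -cderiv_add (_ : cderiv 1%N (fun=> 1 : C) = 0) ?cderiv0//.
    by apply/funext => y; apply: cdiff_cderiv1; exact: cdiff_cst.
  have := @cderivE R (fun x => beta (n.+1%:R^-1 * x)) 0 (-1) j.+1 st (@smooth0 R).
  rewrite addr0 cderiv0 addr0 !scaleN1r => h.
  by rewrite add0r -[LHS]/(cderiv j.+1 (- (fun x => beta (n.+1%:R^-1 * x))) x) h cderiv_dilate.
rewrite E normcN normcM normc_real.
have hM := HM 0%N j.+1 (n.+1%:R^-1 * x) isT jN.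
rewrite expr0 mul1r in hM.
apply: (@le_trans _ _ (n.+1%:R^-1 * M)).
  apply: ler_pM => //; first exact: normc_ge0.
  by rewrite ger0_norm ?exprn_ge0 ?invr_ge0// exprS ler_piMr ?invr_ge0// exprn_ile1// invr_ge0.
apply: (@le_trans _ _ (((1 + B) / d + M) / n.+1%:R)).
  by rewrite mulrC ler_wpM2r ?invr_ge0// lerDr divr_ge0 ?addr_ge0// ltW.
rewrite ler_peMr ?onesq_ge1//.
by rewrite divr_ge0// addr_ge0// divr_ge0 ?addr_ge0// ltW.
Qed.

(* a partition of unity by translated bumps, peeled off one ball at a time *)
Lemma vanish_on_cover T (l : seq (R * R)) : linear T ->
  (forall p, p \in l -> 0 < p.2 /\ forall h : R -> C, smooth_on setT h ->
     (forall y, p.2 <= `|y - p.1| -> h y = 0) -> forall hh : sch h, T (mks hh) = 0) ->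
  forall h (hh : sch h), (forall y, h y != 0 -> exists2 p, p \in l & `|y - p.1| <= d * p.2) ->
  T (mks hh) = 0.
Proof.
move=> lT; have [_ d0 b1 b0 _] := hB.
elim: l => [|p l IH] Hl h hh hl.
  have -> : mks hh = 0.
    apply: schwartz_ext => x /=; apply: contrapT => /eqP /hl[p].
    by rewrite in_nil.
  exact: linear_at0.
have [p0 Hp] := Hl p (mem_head _ _).
pose bp x : C := beta (p.2^-1 * x + - (p.2^-1 * p.1)).
have hbp : sch bp by apply: sch_affine => //; rewrite invr_eq0 gt_eqF.
have ebp x : p.2^-1 * x + - (p.2^-1 * p.1) = p.2^-1 * (x - p.1) by rewrite mulrBr.
have sbh : smooth_on setT (fun x => bp x * h x) by apply: smoothM; exact: sch_smooth.
have zbh y : p.2 <= `|y - p.1| -> bp y * h y = 0.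
  move=> hy; rewrite /bp /beta ebp b0 ?mul0r//.
  by rewrite normrM gtr0_norm ?invr_gt0// ler_pdivlMl// mulr1.
have tbh : (fun x => bp x * h x) \in test_pred (setT : set R).
  apply/test_predP; exists `[p.1 - p.2, p.1 + p.2]%classic; split=> //.
  - exact: segment_compact.
  - move=> x nx; apply: zbh; rewrite leNgt; apply/negP => hx; apply: nx.
    by rewrite /= in_itv/= -ler_distl ltW.
have hbh : sch (fun x => bp x * h x) := test_sch (Test tbh).
have hrest : sch (fun x => h x - bp x * h x) by exact: schB.
have -> : mks hh = 1 *: mks hbh + mks hrest.
  by apply: schwartz_ext => x; rewrite scale1r /= !fctE addrC subrK.
rewrite lT scale1r (Hp _ sbh zbh) add0r; apply: IH => [q ql|y].
  by apply: Hl; rewrite inE ql orbT.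
move=> hy; have hy0 : h y != 0.
  by apply: contraNneq hy => ->; rewrite mulr0 subr0.
have [q] := hl y hy0; rewrite inE => /predU1P[-> hq|ql hq]; last by exists q.
exfalso; move/eqP : hy; apply; rewrite /bp /beta ebp b1 ?mul1r ?subrr//.
by rewrite normrM gtr0_norm ?invr_gt0// ler_pdivrMl// mulrC.
Qed.

(** Each point of [K] has a ball on which [T] vanishes, and compactness leaves finitely many of them
    for the partition of unity. *)
Lemma vanish_off_dsupport T (K : set R) h (hh : sch h) : linear T -> compact K ->
  (forall x, K x -> ~ dsupport T x) -> (forall x, ~ K x -> h x = 0) -> T (mks hh) = 0.
Proof.
move=> lT cK KT h0; have [_ d0 _ _ _] := hB.
pose P (p : R * R) := 0 < p.2 /\ forall h : R -> C, smooth_on setT h ->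
     (forall y, p.2 <= `|y - p.1| -> h y = 0) -> forall hh : sch h, T (mks hh) = 0.
have : cover_compact K by rewrite -compact_cover.
(* The covering balls are shrunk by the factor [d], because a bump rescaled to radius [p.2] equals 1
   up to the radius [d * p.2]. *)
move=> /(_ _ [set p : R * R | P p] (fun p => ball p.1 (d * p.2)))[||D DP KD].
- by move=> p _; exact: ball_open.
- move=> x Kx; have /contrapT [V [oV Vx TV]] := KT x Kx.
  have /nbhs_ballP[r /= r0 rV] : nbhs x V by exact: open_nbhs_nbhs.
  exists (x, r / 2) => /=; last by apply: ballxx; rewrite mulr_gt0// divr_gt0.
  split=> [|f sf f0 hf] /=; first by rewrite divr_gt0.
  have tf : f \in test_pred V.
    apply/test_predP; exists `[x - r / 2, x + r / 2]%classic; split=> //.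
    + exact: segment_compact.
    + move=> y; rewrite /= in_itv/= -ler_distl => hy; apply: rV => /=.
      rewrite /ball/= distrC; apply: le_lt_trans hy _.
      by rewrite ltr_pdivrMr// ltr_pMr// ltr1n.
    + move=> y ny; apply: f0; rewrite leNgt; apply/negP => hy; apply: ny.
      by rewrite /= in_itv/= -ler_distl ltW.
  rewrite (_ : mks hf = test_schwartz (Test tf)); last exact: schwartz_ext.
  exact: TV.
apply: (@vanish_on_cover T (finmap.enum_fset D)) => //.
  by move=> p pD; apply: set_mem; exact: DP.
move=> y hy; have Ky : K y by apply: contrapT => /h0 /eqP; rewrite (negbTE hy).
have [p /= pD hp] := KD _ Ky; exists p => //.
by move: hp; rewrite /ball/= distrC => /ltW.
Qed.

(** The truncation [eta * f] lives on a compact set disjoint from the support of [T], so [T]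
    vanishes on it. The remainder [(1 - eta) * f] tends to 0 in the finitely many seminorms that
    control [T]. *)
Lemma tempered_off_dsupport T f (hf : sch f) (U : set R) : tempered T -> open U ->
  dsupport T `<=` U -> (forall x, U x -> f x = 0) -> T (mks hf) = 0.
Proof.
move=> [lT [N [c hc]]] oU TU f0; have [hb d0 b1 b0 bge0] := hB.
have [c' c'0 hs] := one_sub_bump_small N.
have [D D0 hD] := leibniz_schnorm N hf.
have key n : normc (T (mks hf)) <= c * (D * (c' / n.+1%:R)).
  have n0 : (0 : R) < n.+1%:R by [].
  pose eta x : C := beta (n.+1%:R^-1 * x).
  have t0 : (0 : R) < n.+1%:R^-1 by rewrite invr_gt0.
  have heta : sch eta := sch_dilated_bump hB t0.
  pose J : set R := `[- n.+1%:R^-1^-1, n.+1%:R^-1^-1]%classic.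
  have zJ x : ~ J x -> eta x = 0 by move=> /(dilated_bump0 hB t0); rewrite /eta /beta => ->.
  have cJ : compact J by exact: segment_compact.
  have hef : sch (fun x => eta x * f x) := smooth_bump_sch hB t0 (sch_smooth hf).
  have T0 : T (mks hef) = 0.
    apply: (@vanish_off_dsupport T (J `&` ~` U)) => //.
    - apply: (subclosed_compact _ cJ); last exact: subIsetl.
      by apply: closedI; [exact: itv_closed|exact: open_closedC].
    - by move=> x [_ nU] /TU.
    - move=> x nx; have [Jx|/zJ ->] := pselect (J x); last by rewrite mul0r.
      rewrite f0 ?mulr0//; apply: contrapT => nU; exact: nx.
  have h1 : sch (fun x => (1 - eta x) * f x).
    have := schB hf hef; rewrite (_ : (fun x => f x - _) = (fun x => (1 - eta x) * f x))//.
    by apply/funext => x; rewrite mulrBl mul1r.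
  have -> : mks hf = 1 *: mks hef + mks h1.
    by apply: schwartz_ext => x; rewrite scale1r /= !fctE mulrBl mul1r addrC subrK.
  rewrite lT scale1r T0 add0r; apply: hc => k j x kN jN.
  apply: (hD (c' / n.+1%:R) (fun x => 1 - eta x)) => //; first by rewrite divr_ge0.
  have se := sch_smooth heta.
  have s1 := smooth_cst 1.
  have := smooth_lin (-1) se s1.
  rewrite (_ : -1 *: eta + _ = fun x => 1 - eta x)//.
  by apply/funext => y; rewrite scaleN1r !fctE addrC.
apply: eq0_normc; apply/eqP; rewrite eq_le normc_ge0 andbT; apply/ler_addgt0Pl => e e0.
rewrite addr0.
pose Z := `|c * (D * c')|.
pose n := Num.truncn ((Z + 1) / e).
have hn : (Z + 1) / e < n.+1%:R by exact: truncnS_gt.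
apply: le_trans (key n) _.
have -> : c * (D * (c' / n.+1%:R)) = c * (D * c') * n.+1%:R^-1 by ring.
apply: (@le_trans _ _ ((Z + 1) * n.+1%:R^-1)).
  by rewrite ler_wpM2r ?invr_ge0// (le_trans (ler_norm _))// lerDl.
by rewrite ler_pdivrMr// mulrC -ler_pdivrMr// ltW.
Qed.

End locality.

(** * Cut-offs and the local pairing *)

Section multiplication.
Context {R : realType}.
Local Notation C := (R[i]^o).
Implicit Types (s : R) (w z f : R -> C) (T g v : schwartz R -> C) (I : set R).

Lemma fourier_ph_mul f x y : fourier (fun xi => f xi * ph xi (- x)) y = fourier f (y - x).
Proof.
rewrite !fourierE; apply: eq_cint => xi.
by rewrite -mulrA phC (phC xi y) -phD addrC phC.
Qed.

(** Transforms turn products into convolutions: the multiplication formula, with the character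
    attached to [f], where it acts as a translation of the transform. *)
Lemma ifourierM f (g : R -> C) x : sch f -> sch g ->
  ifourier (fun y => f y * g y) x = cint (fun y => fourier f (y - x) * ifourier g y).
Proof.
move=> hf hg; rewrite /ifourier fourierE -/(ifourier g).
have hi := sch_ifourier hg.
have ip : cintegrable (fun xi => f xi * ph xi (- x)).
  by apply: cintegrable_ph; exact: sch_cintegrable.
have := fourier_mult ip (sch_cintegrable hi); rewrite ifourierK// => h.
rewrite [RHS](_ : _ = cint (fun y => fourier (fun xi => f xi * ph xi (- x)) y * ifourier g y)).
  by rewrite h; apply: eq_cint => y; rewrite mulrAC.
by apply: eq_cint => y; rewrite fourier_ph_mul.
Qed.

(** The product [phi T], written through [cutoff] so that it is convertible to the expression
    occurring in [Hloc] when [u] is a restriction from the line. *)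
Definition tmul I (phi : test I) T : schwartz R -> C := cutoff phi (@dist_restrict R I T).

(** Multiplication by [phi] is convolution with [fourier phi] on the Fourier side. It is therefore
    bounded on every [H^s], and it makes representatives smooth. *)
Lemma tmul_frep s I (phi : test I) T w : fourier_repr s T w ->
  fourier_repr s (tmul phi T) (conv (fourier phi) w).
Proof.
move=> hT; have hw := frep_cl2 hT; have hp := test_sch phi; have hF := sch_fourier hp.
have [M M0 hM] := conv_nrm s hF; have [hc _] := hM w hw.
apply: frepI => // chi; have hc' := schwartz_sch chi; have hi := sch_ifourier hc'.
rewrite /tmul /cutoff /dist_restrict (frep_eval _ hT) (conv_fubini hF hw); last exact: sch_cl2.
by apply: eq_cint => x; congr (_ * _); exact: ifourierM.
Qed.

Lemma test_mulD I (phi : test I) (c : R[i]) (p q : schwartz R) :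
  test_mul phi (c *: p + q) = c *: test_mul phi p + test_mul phi q.
Proof.
apply: test_ext => x.
rewrite -[LHS]/(phi x * (c * p x + q x)) -[RHS]/(c * (phi x * p x) + phi x * q x).
by ring.
Qed.

Lemma test_schwartzD I (c : R[i]) (p q : test I) :
  test_schwartz (c *: p + q) = c *: test_schwartz p + test_schwartz q.
Proof. exact: schwartz_ext. Qed.

Lemma dist_restrict_linear I T : linear T -> linear (@dist_restrict R I T).
Proof. by move=> lT c p q; rewrite /dist_restrict test_schwartzD lT. Qed.

Lemma cutoff_linear I (phi : test I) (u : test I -> C) : linear u -> linear (cutoff phi u).
Proof. by move=> lu c p q; rewrite /cutoff test_mulD lu. Qed.

Lemma Hs_tmul s I (phi : test I) T : Hs s T -> Hs s (tmul phi T).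
Proof.
move=> [[lT _] [w hw]]; have h := tmul_frep phi hw; split; last by exists (conv (fourier phi) w).
by apply: tempered_frep h; exact/cutoff_linear/dist_restrict_linear.
Qed.

Lemma distr_on_restrict I T : tempered T -> distr_on I (dist_restrict T).
Proof.
move=> [lT [N [c hc]]]; split; first exact: dist_restrict_linear.
move=> K cK KI; have [B [_ HB]] := compact_bounded cK.
pose B1 := `|B| + 1; have B10 : 1 <= B1 by rewrite lerDr.
exists N, (c * B1 ^+ N) => phi M phiK hM; rewrite -mulrA; apply: hc => k n x kN nN.
have M0 : 0 <= M by apply: le_trans (hM 0%N x isT); exact: normc_ge0.
have [Sx|nSx] := pselect (tsupport phi x); last first.
  rewrite (_ : cderiv n (test_schwartz phi) x = 0) ?normc0 ?mulr0.
    by rewrite mulr_ge0// exprn_ge0// (le_trans ler01).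
  exact: (@cderiv_out _ phi).
apply: ler_pM; [by rewrite exprn_ge0|exact: normc_ge0| |exact: hM].
apply: (@le_trans _ _ (B1 ^+ k)); last exact: ler_weXn2l.
have B1_ge0 : 0 <= B1 by exact: le_trans B10.
rewrite lerXn2r ?nnegrE//; apply: (HB (`|B| + 1)); last exact: phiK.
by rewrite (le_lt_trans (ler_norm _))// ltrDl.
Qed.

Lemma Hloc_restrict s I T : Hs s T -> Hloc s I (dist_restrict T).
Proof.
by move=> hT; split; [exact: distr_on_restrict hT.1|move=> phi; exact: Hs_tmul].
Qed.

Lemma dist_of_funE I f : @dist_of_fun R I f = dist_restrict (tempered_of_fun f).
Proof. by []. Qed.

Lemma cutoff_lin I (phi : test I) (u v : test I -> C) (c : R[i]) :
  cutoff phi (c *: u + v) = fun chi => c * cutoff phi u chi + cutoff phi v chi.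
Proof. by []. Qed.

Lemma cutoff_dist I (phi : test I) f : cutoff phi (@dist_of_fun R I f) = tempered_of_fun (fun x => phi x * f x).
Proof.
apply/funext => chi; rewrite /cutoff /dist_of_fun /tempered_of_fun.
by apply: eq_cint => x /=; rewrite mulrCA mulrA.
Qed.

Lemma cutoff_absorb I (phi theta : test I) (u : test I -> C) :
  (forall x, theta x * phi x = phi x) -> tmul phi (cutoff theta u) = cutoff phi u.
Proof.
move=> h; apply/funext => chi; rewrite /tmul /cutoff /dist_restrict; congr u.
by apply: test_ext => x /=; rewrite mulrA h.
Qed.

Lemma tmulC I (phi theta : test I) (u : test I -> C) :
  tmul phi (cutoff theta u) = tmul theta (cutoff phi u).
Proof.
apply/funext => chi; rewrite /tmul /cutoff /dist_restrict; congr u.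
by apply: test_ext => x /=; rewrite mulrCA.
Qed.

Section with_bump.
Variables (b : R -> R) (d : R).
Hypothesis hB : bump b d.

Lemma tmul_norm s I (phi : test I) : exists2 M, 0 <= M & forall T, Hs s T ->
  Hs_norm s (tmul phi T) <= M * Hs_norm s T.
Proof.
have [M M0 hM] := conv_nrm s (sch_fourier (test_sch phi)); exists M => // T [_ [w hw]].
rewrite (Hs_normE hB hw) (Hs_normE hB (tmul_frep phi hw)).
by have [_] := hM w (frep_cl2 hw).
Qed.

Lemma Hs_norm_lin s T g (c : R[i]) : Hs s T -> Hs s g ->
  Hs_norm s (fun chi => c * T chi + g chi) <= normc c * Hs_norm s T + Hs_norm s g.
Proof.
move=> [_ [w hw]] [_ [z hz]].
rewrite (Hs_normE hB hw) (Hs_normE hB hz) (Hs_normE hB (frepD c hw hz)).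
have [hcw <-] := cl2Z_nrm c (frep_cl2 hw).
by have [_] := cl2D_nrm hcw (frep_cl2 hz).
Qed.

Lemma Hs_norm_sub s s' T : s <= s' -> Hs s' T -> Hs_norm s T <= Hs_norm s' T.
Proof.
move=> ss [_ [w hw]]; rewrite (Hs_normE hB hw) (Hs_normE hB (frep_sub ss hw)).
by have [_] := cl2_sub ss (frep_cl2 hw).
Qed.

Lemma Hs_normZ s T (c : R[i]) : Hs s T -> Hs_norm s (fun chi => c * T chi) = normc c * Hs_norm s T.
Proof.
move=> [_ [w hw]]; have [hcw nE] := cl2Z_nrm c (frep_cl2 hw).
have hr : fourier_repr s (fun chi => c * T chi) (fun x => c * w x).
  apply: frepI => // chi; rewrite (frep_eval chi hw) -cintZ.
    by apply: eq_cint => x; rewrite mulrA.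
  by apply: cl2_cintegrable (frep_cl2 hw) _; apply: sch_ifourier; exact: schwartz_sch.
by rewrite (Hs_normE hB hr) (Hs_normE hB hw).
Qed.

Lemma Hs_pairing_tmul s I (phi : test I) g v : Hs (- s) g -> Hs s v ->
  Hs_pairing s (tmul phi g) v = Hs_pairing s g (tmul phi v).
Proof.
move=> [_ [w hw]] [_ [z hz]]; have hF := sch_fourier (test_sch phi).
have cw := frep_cl2 hw; have cz := frep_cl2 hz.
have [oz _] := cl2_opp cz.
rewrite (Hs_pairingE hB (tmul_frep phi hw) hz) (Hs_pairingE hB hw (tmul_frep phi hz)).
rewrite (conv_fubini hF cw); last by rewrite opprK.
apply: eq_cint => x; congr (_ * _); rewrite /conv [RHS]cint_opp.
  by apply: eq_cint => y; rewrite mulrC opprK addrC.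
exact: (conv_integrand (- x) hF cz).
Qed.

(** [chi - phi * chi] vanishes in a neighbourhood of the support of [T], hence is annihilated by
    [T]. *)
Lemma tmul_id I (phi : test I) T : tempered T ->
  set_nbhs (dsupport T) [set x | phi x = 1] -> tmul phi T = T.
Proof.
move=> hT /set_nbhsP[U [oU TU Uphi]]; have [lT _] := hT.
apply/funext => chi; rewrite /tmul /cutoff /dist_restrict.
have hc := schwartz_sch chi.
have hpc : sch (fun x => phi x * chi x) := test_sch (test_mul phi chi).
have hr : sch (fun x => chi x - phi x * chi x) by exact: schB.
have r0 : T (mks hr) = 0.
  apply: (tempered_off_dsupport hB hr hT oU TU) => x /Uphi /= ->.
  by rewrite mul1r subrr.
have E : chi = 1 *: test_schwartz (test_mul phi chi) + mks hr.
  by apply: schwartz_ext => x; rewrite scale1r /= !fctE addrC subrK.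
by rewrite [in RHS]E lT r0 addr0 scale1r.
Qed.

Section local_pairing.
Variables (I : set R) (e : exhaustion I) (s : R).
Implicit Types (u : test I -> C).

Lemma exhaustion_mono j k x : (j <= k)%N ->
  exh_left e j <= x <= exh_right e j -> exh_left e k <= x <= exh_right e k.
Proof.
move=> /subnK <-; elim: (k - j)%N => [//|n IH] /IH h; rewrite addSn.
have : `[exh_left e (n + j), exh_right e (n + j)]%classic x by rewrite /= in_itv.
by move=> /exh_nested; rewrite /= in_itv/= => /andP[/ltW -> /ltW ->].
Qed.

Lemma exh_fun_support j x : exh_fun e j x != 0 ->
  exh_left e j.+1 < x < exh_right e j.+1.
Proof.
move=> hx; have : tsupport (exh_fun e j) x by exact: subset_closure.
by move=> /exh_support; rewrite /= in_itv.
Qed.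

Lemma exh_fun_absorb j k x : (j < k)%N -> exh_fun e k x * exh_fun e j x = exh_fun e j x.
Proof.
move=> jk; have [->|/exh_fun_support /andP[h1 h2]] := eqVneq (exh_fun e j x) 0.
  by rewrite mulr0.
rewrite (exh_eq1 (e := e) (j := k)) ?mul1r// in_itv/=.
by apply: exhaustion_mono jk _; rewrite !ltW.
Qed.

Lemma compact_exhaustion K : compact K -> K `<=` I -> exists j, forall k, (j <= k)%N ->
  set_nbhs K [set x | exh_fun e k x = 1].
Proof.
move=> cK KI.
have : cover_compact K by rewrite -compact_cover.
move=> /(_ _ setT (fun j : nat => `]exh_left e j, exh_right e j[%classic))[||D _ KD].
- by move=> j _; exact: itv_open.
- move=> x /KI; rewrite [in X in X -> _](exh_cover e) => -[j _ hj].
  by exists j.+1 => //; exact: exh_nested hj.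
exists (\max_(i <- finmap.enum_fset D) i)%N => k jk; apply/set_nbhsP.
exists `]exh_left e k, exh_right e k[%classic; split; first exact: itv_open.
  move=> x /KD[i /= iD]; rewrite /= !in_itv/=.
  have ik : (i <= k)%N by apply: leq_trans jk; exact: leq_bigmax_seq.
  move: ik; rewrite leq_eqVlt => /predU1P[->//|ik /andP[h1 h2]].
  have : `[exh_left e k.-1, exh_right e k.-1]%classic x.
    rewrite /= in_itv/=; apply: (@exhaustion_mono i); last by rewrite !ltW.
    by rewrite -ltnS prednK// (leq_ltn_trans _ ik).
  by move=> /exh_nested; rewrite prednK ?(leq_ltn_trans _ ik)//= in_itv.
move=> x; rewrite /= in_itv/= => /andP[h1 h2]; apply: exh_eq1.
by rewrite in_itv/= !ltW.
Qed.

(** Replace [g] by [phi2 g], move [phi2] to the other argument, commute it with [phi1], move [phi1]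
    back and absorb it in [g]. *)
Lemma pairing_indep g u (phi1 phi2 : test I) : Hs (- s) g -> Hloc s I u ->
  set_nbhs (dsupport g) [set x | phi1 x = 1] ->
  set_nbhs (dsupport g) [set x | phi2 x = 1] ->
  Hs_pairing s g (cutoff phi1 u) = Hs_pairing s g (cutoff phi2 u).
Proof.
move=> hg [_ hu] h1 h2; have [tg _] := hg.
rewrite -{1}(tmul_id tg h2) Hs_pairing_tmul//.
rewrite tmulC -Hs_pairing_tmul//.
by rewrite (tmul_id tg h1).
Qed.

Lemma pairingE g u (phi : test I) : Hc (- s) I g -> Hloc s I u ->
  set_nbhs (dsupport g) [set x | phi x = 1] ->
  pairing s g u = Hs_pairing s g (cutoff phi u).
Proof.
move=> [hg _ _] hu hphi; rewrite /pairing.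
case: (@xgetPex _ 0 [set z | exists2 phi : test I,
    set_nbhs (dsupport g) [set x | phi x = 1] &
    z = Hs_pairing s g (cutoff phi u)]); first by exists (Hs_pairing s g (cutoff phi u)), phi.
by move=> phi' hphi' ->; exact: pairing_indep.
Qed.

(** All large indices are allowed, so that several pairings can be evaluated with a common
    cut-off. *)
Lemma pairing_large g : Hc (- s) I g -> exists j, forall k, (j <= k)%N ->
  forall u, Hloc s I u -> pairing s g u = Hs_pairing s g (cutoff (exh_fun e k) u).
Proof.
move=> hg; have [_ cg gI] := hg.
have [j hj] := compact_exhaustion cg gI; exists j => k jk u hu.
by apply: pairingE => //; exact: hj.
Qed.

Lemma pairing_bound g : Hc (- s) I g -> exists j (c : R), 0 <= c /\ forall u, Hloc s I u ->
  normc (pairing s g u) <= c * Hs_norm s (cutoff (exh_fun e j) u).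
Proof.
move=> hg; have [j hj] := pairing_large hg; have [hgs _ _] := hg.
exists j, (Hs_norm (- s) g); split; first exact: Hs_norm_ge0.
move=> u hu; rewrite (hj j (leqnn j) u hu); by apply: (Hs_pairing_le hB) => //; exact: hu.2.
Qed.

Lemma pairing_test g (phi : test I) : Hc (- s) I g ->
  pairing s g (@dist_of_fun R I phi) = g (test_schwartz phi).
Proof.
move=> hg; have [hgs cg gI] := hg; have [j hj] := compact_exhaustion cg gI.
have hu : Hloc s I (@dist_of_fun R I phi).
  rewrite dist_of_funE; apply: Hloc_restrict; apply: Hs_tempered_of_fun.
  exact: test_sch.
have hn := hj j (leqnn j).
rewrite (pairingE hg hu hn) cutoff_dist.
pose h : sch (fun x => exh_fun e j x * phi x) := test_sch (test_mul (exh_fun e j) (test_schwartz phi)).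
rewrite (Hs_pairing_funr hB hgs h).
have [tg _] := hgs.
rewrite -[RHS](_ : tmul (exh_fun e j) g (test_schwartz phi) = _); last by rewrite tmul_id.
by congr g; exact: schwartz_ext.
Qed.

Lemma Hc_lin g g' (c : R[i]) : Hc (- s) I g -> Hc (- s) I g' ->
  Hc (- s) I (fun chi => c * g chi + g' chi).
Proof.
move=> [h1 c1 s1] [h2 c2 s2].
have sub : dsupport (fun chi => c * g chi + g' chi) `<=` dsupport g `|` dsupport g'.
  move=> x hx; apply: contrapT => nx; apply: hx.
  have /contrapT[V [oV Vx gV]] : ~ dsupport g x by move=> h; apply: nx; left.
  have /contrapT[W [oW Wx gW]] : ~ dsupport g' x by move=> h; apply: nx; right.
  exists (V `&` W); split; [exact: openI|by []|].
  move=> phi; have /test_predP[K [sf cK KVW f0]] := testP phi.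
  have tV : (phi : R -> C) \in test_pred V.
    by apply/test_predP; exists K; split => // y /KVW[].
  have tW : (phi : R -> C) \in test_pred W.
    by apply/test_predP; exists K; split => // y /KVW[].
  have := gV (Test tV); have := gW (Test tW); rewrite /dist_restrict.
  rewrite (_ : test_schwartz (Test tV) = test_schwartz phi); last exact: schwartz_ext.
  rewrite (_ : test_schwartz (Test tW) = test_schwartz phi); last exact: schwartz_ext.
  by move=> -> ->; rewrite mulr0 addr0.
split; [exact: Hs_lin| |by move=> x /sub[/s1|/s2]].
apply: (subclosed_compact _ (compactU c1 c2) sub).
rewrite -openC /dsupport setCK.
rewrite openE => x [V [oV Vx hV]]; rewrite /interior.
apply: (@filterS _ (nbhs x) _ V); last exact: open_nbhs_nbhs.
by move=> y Vy; exists V.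
Qed.

Lemma pairing_lin g g' (c : R[i]) u : Hc (- s) I g -> Hc (- s) I g' -> Hloc s I u ->
  pairing s (fun chi => c * g chi + g' chi) u = c * pairing s g u + pairing s g' u.
Proof.
move=> hg hg' hu; have hgg := Hc_lin c hg hg'.
have [j1 h1] := pairing_large hg; have [j2 h2] := pairing_large hg'.
have [j3 h3] := pairing_large hgg.
pose k := maxn j1 (maxn j2 j3).
have k1 : (j1 <= k)%N by rewrite leq_maxl.
have k2 : (j2 <= k)%N by rewrite /k maxnC -maxnA leq_maxl.
have k3 : (j3 <= k)%N by rewrite /k !leq_max leqnn !orbT.
rewrite (h1 k k1 u hu) (h2 k k2 u hu) (h3 k k3 u hu).
have [[_ [w hw]] _ _] := hg; have [[_ [w' hw']] _ _] := hg'.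
have [_ [z hz]] := hu.2 (exh_fun e k).
have [oz _] := cl2_opp (frep_cl2 hz).
rewrite (Hs_pairingE hB hw hz) (Hs_pairingE hB hw' hz) (Hs_pairingE hB (frepD c hw hw') hz).
have [i1 _] := cl2_pair (frep_cl2 hw) oz; have [i2 _] := cl2_pair (frep_cl2 hw') oz.
rewrite -cintZ// -cintD//; last exact: cintegrableZ.
by apply: eq_cint => x; ring.
Qed.

Lemma pairing_linr g (c : R[i]) u (v : test I -> C) : Hc (- s) I g -> Hloc s I u -> Hloc s I v ->
  Hloc s I (c *: u + v) ->
  pairing s g (c *: u + v) = c * pairing s g u + pairing s g v.
Proof.
move=> hg hu hv huv; have [j hj] := pairing_large hg.
rewrite !(hj j (leqnn j))//.
have [[_ [w hw]] _ _] := hg.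
have [_ [y hy]] := hu.2 (exh_fun e j); have [_ [z hz]] := hv.2 (exh_fun e j).
have [oy _] := cl2_opp (frep_cl2 hy); have [oz _] := cl2_opp (frep_cl2 hz).
rewrite cutoff_lin (Hs_pairingE hB hw hy) (Hs_pairingE hB hw hz) (Hs_pairingE hB hw (frepD c hy hz)).
have [i1 _] := cl2_pair (frep_cl2 hw) oy; have [i2 _] := cl2_pair (frep_cl2 hw) oz.
rewrite -cintZ// -cintD//; last exact: cintegrableZ.
by apply: eq_cint => x; ring.
Qed.

Lemma Hc_test (theta : test I) : Hc (- s) I (tempered_of_fun theta).
Proof.
have hth := test_sch theta; have /test_predP[K [sf cK KI f0]] := testP theta.
have sub : dsupport (tempered_of_fun theta) `<=` K.
  move=> x hx; apply: contrapT => nKx; apply: hx; exists (~` K); split=> //.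
    by apply: closed_openC; apply: compact_closed => //; exact: Rhausdorff.
  move=> phi; rewrite /dist_restrict /tempered_of_fun.
  rewrite (@eq_cint _ _ (fun=> 0)) ?cint0// => x'.
  have [Kx|/f0 ->] := pselect (K x'); last by rewrite mul0r.
  have /test_predP[L [_ _ LK L0]] := testP phi.
  by rewrite /= L0 ?mulr0// => /LK.
split; [exact: Hs_tempered_of_fun| |by move=> x /sub/KI].
apply: (subclosed_compact _ cK sub).
rewrite -openC /dsupport setCK openE => x [V [oV Vx hV]]; rewrite /interior.
apply: (@filterS _ (nbhs x) _ V); last exact: open_nbhs_nbhs.
by move=> y Vy; exists V.
Qed.

(** Test functions, viewed in the dual, evaluate [u]; they are the points from which a nonzero [u]
    will be detected in the weak* topology. *)
Lemma pairing_fun (theta : test I) u : Hloc s I u ->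
  pairing s (tempered_of_fun theta) u = u theta.
Proof.
move=> hu; have hg := Hc_test theta.
have /test_predP[K [sf cK KI f0]] := testP theta.
have [j hj] := compact_exhaustion cK KI; have [j' hj'] := pairing_large hg.
pose k := maxn j j'.
rewrite (hj' k (leq_maxr _ _) u hu) (Hs_pairing_funl hB (hu.2 _) (test_sch theta)).
rewrite /cutoff; congr u; apply: test_ext => x /=.
have [Kx|/f0 ->] := pselect (K x); last by rewrite mulr0.
have /set_nbhsP[U [_ KU Uphi]] := hj k (leq_maxl _ _).
by rewrite (Uphi _ (KU _ Kx)) mul1r.
Qed.

End local_pairing.
End with_bump.
End multiplication.

(** * Constant coefficient differential equations *)

Section constant_coefficient_ode.
Context {R : realType}.
Local Notation C := (R[i]^o).
Local Notation mu := (@lebesgue_measure R).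
Implicit Types (f g y : R -> C) (r : R[i]) (q : {poly R[i]}).

Lemma smoothZ (c : R[i]) f : smooth_on setT f -> smooth_on setT (fun x => c * f x).
Proof.
move=> sf; have := smooth_lin c sf (@smooth0 R); rewrite addr0.
by [].
Qed.

Lemma cderivZ (c : R[i]) f n x : smooth_on setT f ->
  cderiv n (fun z => c * f z : C) x = c * cderiv n f x.
Proof.
move=> sf; have := cderivE c n sf (@smooth0 R); rewrite cderiv0 !addr0 => h.
by rewrite -[RHS]/((c *: cderiv n f) x) -h.
Qed.

Lemma smoothB f g : smooth_on setT f -> smooth_on setT g ->
  smooth_on setT (fun x => f x - g x).
Proof.
move=> sf sg; have := smoothD sf (smoothZ (-1) sg).
by under eq_fun do rewrite mulN1r.
Qed.

Lemma cderivB f g n x : smooth_on setT f -> smooth_on setT g ->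
  cderiv n (fun z => f z - g z : C) x = cderiv n f x - cderiv n g x.
Proof.
move=> sf sg; have := cderivD n x sf (smoothZ (-1) sg).
rewrite cderivZ// mulN1r => <-; congr (cderiv n _ x).
by apply/funext => z; rewrite mulN1r.
Qed.

Lemma cderiv_local f g (U : set R) n x : smooth_on setT f -> smooth_on setT g ->
  open U -> (forall z, U z -> f z = g z) -> U x -> cderiv n f x = cderiv n g x.
Proof.
move=> sf sg oU fg Ux; apply/eqP; rewrite -subr_eq0 -cderivB//; apply/eqP.
rewrite /cderiv !(derive1n_open0 (U := U))//.
- by move=> z Uz; rewrite /ImF fg// subrr.
- by move=> z Uz; rewrite /ReF fg// subrr.
Qed.

Definition polyD q f : R -> C := fun x => \sum_(k < size q) q`_k * cderiv k f x.

Lemma polyD_widen q f x n : (size q <= n)%N ->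
  polyD q f x = \sum_(k < n) q`_k * cderiv k f x.
Proof.
move=> qn; rewrite /polyD (big_ord_widen n (fun k => q`_k * cderiv k f x))//.
rewrite big_mkcond; apply: eq_bigr => k _; case: ltnP => // h.
by rewrite nth_default// mul0r.
Qed.

(** [polyD q] is the operator [q (d/dx)]; a linear factor of the polynomial becomes a first order
    operator applied beforehand. *)
Lemma polyD_mulXsub q r f x : smooth_on setT f ->
  polyD (q * ('X - r%:P)) f x = polyD q (fun z => cderiv 1%N f z - r * f z) x.
Proof.
move=> sf; have sf1 := smooth_cderiv 1%N sf.
have sz : (size (q * ('X - r%:P))%R <= (size q).+1)%N.
  by apply: leq_trans (size_polyMleq _ _) _; rewrite size_XsubC addn2.
rewrite (polyD_widen _ _ sz) (polyD_widen _ _ (leqnSn (size q))).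
have E k : (q * ('X - r%:P))`_k = (if k is j.+1 then q`_j else 0) - r * q`_k.
  by rewrite mulrBr coefB coefMX coefMC; case: k => [|k]; rewrite mulrC.
under eq_bigr do rewrite E mulrBl.
rewrite sumrB big_ord_recl/= mul0r add0r.
have E2 k : cderiv k (fun z => cderiv 1%N f z - r * f z) x =
    cderiv k.+1 f x - r * cderiv k f x.
  rewrite cderivB; [|exact: sf1|exact: smoothZ].
  by rewrite cderivZ// cderiv_add addn1.
under [RHS]eq_bigr do rewrite E2 mulrBr.
rewrite sumrB; congr (_ - _).
  by rewrite [RHS]big_ord_recr/= nth_default// mul0r addr0.
by apply: eq_bigr => k _; ring.
Qed.

Lemma polyD_local q f g (U : set R) x : smooth_on setT f -> smooth_on setT g ->
  open U -> (forall z, U z -> f z = g z) -> U x -> polyD q f x = polyD q g x.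
Proof.
move=> sf sg oU fg Ux; apply: eq_bigr => k _; congr (_ * _).
exact: cderiv_local fg Ux.
Qed.

(** The exponential [exp (r x)] with complex rate [r]. *)
Definition cexp r (x : R) : C :=
  (expR (complex.Re r * x))%:C * (cos (complex.Im r * x) +i* sin (complex.Im r * x)).

Lemma cexp_cdiff r x : cdiff (cexp r) x (r * cexp r x).
Proof.
have L (t : R) : is_derive x 1 (fun x : R => t * x) t.
  apply: is_derive_eqd (is_deriveZ t (is_derive_id x 1)) _.
  by rewrite /GRing.scale/= mulr1.
have h1 := cdiff_real (is_derive1_comp (is_derive_expR _) (L (complex.Re r))).
have h2 : cdiff (fun x => (cos (complex.Im r * x) +i* sin (complex.Im r * x) : C)) x
   ((0 +i* complex.Im r) * (cos (complex.Im r * x) +i* sin (complex.Im r * x))).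
  split; rewrite ?cReM ?cImM/=.
    apply: is_derive_eqd (is_derive1_comp (is_derive_cos _) (L _)) _.
    by rewrite /GRing.scale/=; ring.
  apply: is_derive_eqd (is_derive1_comp (is_derive_sin _) (L _)) _.
  by rewrite /GRing.scale/=; ring.
apply: cdiff_eq (cdiffM h1 h2) _; rewrite /cexp /GRing.scale/=.
by apply: complex_ext; rewrite ?cReD ?cImD ?cReM ?cImM/=; ring.
Qed.

Lemma cexp_smooth r : smooth_on setT (cexp r) /\ forall k, cderiv k (cexp r) = (fun x => r ^+ k * cexp r x).
Proof.
have H f : (exists c : R[i], f = fun x => c * cexp r x) -> exists2 f',
    (exists c : R[i], f' = fun x => c * cexp r x) & forall x, cdiff f x (f' x).
  move=> [c ->]; exists (fun x => c * r * cexp r x); first by exists (c * r).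
  by move=> x; apply: cdiff_eq (cdiffZ c (cexp_cdiff r x)) _; rewrite mulrA.
have e1 : exists c : R[i], cexp r = fun x => c * cexp r x.
  by exists 1; apply/funext => x; rewrite mul1r.
have [sE _] := derivative_closed_class H e1.
split=> //; elim=> [|k IH]; first by rewrite cderiv_0; apply/funext => x; rewrite expr0 mul1r.
rewrite cderivS IH; apply/funext => x; apply: cdiff_cderiv1.
by apply: cdiff_eq (cdiffZ _ (cexp_cdiff r x)) _; rewrite exprSr mulrA.
Qed.

Lemma cexp_neq0 r x : cexp r x != 0.
Proof.
rewrite -normc_gt0 /cexp normcM normc_real ger0_norm ?expR_ge0// mulr_gt0 ?expR_gt0//.
by rewrite normcE /= cos2Dsin2 sqrtr1.
Qed.

Lemma cexpN r x : cexp (- r) x * cexp r x = 1.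
Proof.
rewrite /cexp; have -> : complex.Re (- r) = - complex.Re r by case: r.
have -> : complex.Im (- r) = - complex.Im r by case: r.
rewrite !mulNr cosN sinN mulrACA -rmorphM/= -expRD addNr expR0 mul1r.
apply: complex_ext; rewrite ?cReM ?cImM/=; last by ring.
by rewrite mulNr opprK -!expr2 cos2Dsin2.
Qed.

Lemma polyD_cexp q r x : polyD q (cexp r) x = q.[r] * cexp r x.
Proof.
rewrite horner_coef mulr_suml; apply: eq_bigr => k _.
by have [_ ->] := cexp_smooth r; rewrite mulrA.
Qed.

Lemma real_primitive (g : R -> R) : continuous g -> rint g ->
  exists G : R -> R, forall x : R, is_derive x 1 G (g x).
Proof.
move=> cg ig; exists (fun x => \int[mu]_(t in `]-oo, x]) g t)%R => x.
have iu : mu.-integrable [set` Interval (BInfty R true) (BRight (x + 1))] (EFin \o g).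
  by apply: integrableS ig.
have x1 : x < x + 1 by rewrite ltrDl.
have [||d1 d2] := @continuous_FTC1 R g -oo%O x (x + 1) x1 iu.
- first [by rewrite bnd_simp | exact: ltNyr | exact: ltNybnd].
- exact: cg.
by apply: DeriveDef; [exact: d1|rewrite -derive1E].
Qed.

Lemma complex_primitive f (f' : R -> C) : (forall x, cdiff f x (f' x)) -> cintegrable f ->
  exists G : R -> C, forall x, cdiff G x (f x).
Proof.
move=> df [i1 i2].
have c1 : continuous (ReF f) by move=> x; have [] := cdiff_continuous (df x).
have c2 : continuous (ImF f) by move=> x; have [] := cdiff_continuous (df x).
have [G1 h1] := real_primitive c1 i1; have [G2 h2] := real_primitive c2 i2.
by exists (fun x => G1 x +i* G2 x) => x; split; [exact: h1|exact: h2].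
Qed.

Section with_bump.
Variables (b : R -> R) (d : R).
Hypothesis hB : bump b d.

(** Variation of constants: [cexp r] times a primitive of [cexp (- r) * f]. The integrand is
    multiplied by a bump to become integrable on the line, so that the primitive may start at minus
    infinity. *)
Lemma first_order_solution r f (N : R) : 0 < N -> smooth_on setT f ->
  exists2 y, smooth_on setT y & forall x, `|x| < N -> cderiv 1%N y x - r * y x = f x.
Proof.
move=> N0 sf; have [hb d0 b1 b0 _] := hB.
(* Scaled so that the plateau of the bump covers [|x| < N]. *)
pose t := d / N; have t0 : t != 0 by rewrite mulf_neq0 ?invr_eq0 ?gt_eqF.
have tp : 0 < t by rewrite divr_gt0.
pose beta x : C := (b (t * x))%:C.
have hbeta : sch beta by exact: (sch_dilated_bump hB).
have sE := (cexp_smooth r).1; have sE' := (cexp_smooth (- r)).1.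
pose g x : C := beta x * (cexp (- r) x * f x).
have hg : sch g by apply: (smooth_bump_sch hB tp); exact: smoothM.
have sg := sch_smooth hg.
have [G dG] := complex_primitive (fun x => smooth_cdiff0 x sg)
  (sch_cintegrable hg).
have sG : smooth_on setT G.
  have H h : (h = G \/ smooth_on setT h) -> exists2 h', (h' = G \/ smooth_on setT h') &
      forall x, cdiff h x (h' x).
    move=> [->|sh]; first by exists g; [right|exact: dG].
    exists (cderiv 1%N h); first by right; exact: smooth_cderiv.
    by move=> x; exact: smooth_cdiff0.
  by have [] := derivative_closed_class H (or_introl erefl).
exists (fun x => cexp r x * G x); first exact: smoothM.
move=> x xN; rewrite (cdiff_cderiv1 (cdiffM (cexp_cdiff r x) (dG x))).
rewrite /g /beta b1 ?mul1r; last first.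
  by rewrite normrM gtr0_norm// /t mulrAC ler_pdivrMr// ler_wpM2l ?ltW.
have -> : cexp r x * (cexp (- r) x * f x) + r * cexp r x * G x - r * (cexp r x * G x) =
  (cexp (- r) x * cexp r x) * f x by ring.
by rewrite cexpN mul1r.
Qed.

(** A complex root is split off: the equation for the quotient is solved by induction, then the
    first order equation with that solution as right-hand side. *)
Lemma polyD_solution q f (N : R) : q != 0 -> 0 < N -> smooth_on setT f ->
  exists2 y, smooth_on setT y & forall x, `|x| < N -> polyD q y x = f x.
Proof.
move=> + N0; move: {2}(size q) (leqnn (size q)) f => n.
elim: n q => [|n IH] q.
  by rewrite leqn0 size_poly_eq0 => /eqP ->; rewrite eqxx.
move=> sq f q0 sf; have [s1|s1] := boolP (size q == 1)%N.
  have /size_poly1P[c c0 ->] := s1.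
  exists (fun x => c^-1 * f x); first exact: smoothZ.
  move=> x _; rewrite /polyD size_polyC c0 big_ord1 coefC eqxx cderiv_0.
  by rewrite mulrA divff// mul1r.
have [r /factor_theorem[q1 E]] := closed_rootP q s1.
have q10 : q1 != 0 by apply: contraNneq q0 => h; rewrite E h mul0r.
have sq1 : (size q1 <= n)%N.
  have := sq; rewrite E size_Mmonic// ?monicXsubC// size_XsubC addn2.
  by [].
have [z sz hz] := IH q1 sq1 f q10 sf.
have [y sy hy] := first_order_solution r N0 sz.
exists y => // x xN; rewrite E polyD_mulXsub// -hz//.
apply: (@polyD_local q1 _ _ `]- N, N[%classic).
- apply: smoothB; first exact: smooth_cderiv.
  exact: smoothZ.
- exact: sz.
- exact: itv_open.
- by move=> t; rewrite /= in_itv/= -ltr_norml; exact: hy.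
- by rewrite /= in_itv/= -ltr_norml.
Qed.

End with_bump.

Lemma integration_by_parts_test (I : set R) f (phi : test I) k : sch f ->
  cint (fun x => f x * cderiv k phi x) = (-1) ^+ k * cint (fun x => cderiv k f x * phi x).
Proof.
elim: k f phi => [|k IH] f phi hf.
  by rewrite expr0 mul1r !cderiv_0.
pose psi := test_deriv k phi.
have hp := test_sch psi.
have hprod : sch (fun x => psi x * f x) := test_sch (test_mul psi (mks hf)).
have hprod1 : sch (fun x => psi x * cderiv 1%N f x) :=
  test_sch (test_mul psi (mks (sch_cderiv 1%N hf))).
have hprod2 : sch (fun x => cderiv 1%N psi x * f x) :=
  test_sch (test_mul (test_deriv 1%N psi) (mks hf)).
have z := cint_cderiv0 hprod.
have E : cderiv 1%N (fun x => psi x * f x) = fun x => psi x * cderiv 1%N f x + cderiv 1%N psi x * f x.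
  by apply/funext => x; apply: cderivM1; exact: sch_smooth.
rewrite E cintD in z; [|exact: sch_cintegrable..].
transitivity (cint (fun x => cderiv 1%N psi x * f x)).
  by apply: eq_cint => x; rewrite mulrC.
move/eqP : z; rewrite addrC addr_eq0 => /eqP ->.
rewrite (_ : cint (fun x => psi x * cderiv 1%N f x) = cint (fun x => cderiv 1%N f x * cderiv k phi x)).
  rewrite (IH _ phi (sch_cderiv 1%N hf)) exprS mulN1r mulNr; congr (- (_ * _)).
  by apply: eq_cint => x; rewrite cderiv_add addn1.
by apply: eq_cint => x; rewrite mulrC.
Qed.

Lemma diff_op_dist (I : set R) m (c : 'I_m.+1 -> R[i]) f (phi : test I) : sch f ->
  diff_op c (@dist_of_fun R I f) phi =
  cint (fun x => (\sum_(k < m.+1) c k * cderiv k f x) * phi x).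
Proof.
move=> hf.
have hi k : cintegrable (fun x => cderiv k f x * phi x).
  apply: (cl2_cintegrable (s := 0)); last exact: test_sch.
  by apply: sch_cl2; exact: sch_cderiv.
have hs (l : seq 'I_m.+1) : cintegrable (fun x => (\sum_(k <- l) c k * cderiv k f x) * phi x) /\
    cint (fun x => (\sum_(k <- l) c k * cderiv k f x) * phi x) =
    \sum_(k <- l) c k * cint (fun x => cderiv k f x * phi x).
  elim: l => [|k l [ih1 ih2]].
    rewrite big_nil; split; last first.
      by rewrite (@eq_cint _ _ (fun=> 0)) ?cint0// => x; rewrite big_nil mul0r.
    rewrite (_ : (fun x => _) = (fun=> 0)); last by apply/funext => x; rewrite big_nil mul0r.
    by split; exact: rint0.
  have E : (fun x => (\sum_(j <- k :: l) c j * cderiv j f x) * phi x) =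
      (fun x => c k * (cderiv k f x * phi x) + (\sum_(j <- l) c j * cderiv j f x) * phi x).
    by apply/funext => x; rewrite big_cons mulrDl mulrA.
  have i1 := cintegrableZ (c k) (hi k).
  rewrite E; split; first exact: cintegrableD.
  by rewrite cintD// cintZ// ih2 big_cons.
have [_ ->] := hs (index_enum _).
apply: eq_bigr => k _; congr (_ * _).
rewrite /dist_of_fun (integration_by_parts_test phi k hf) mulrA -exprMn mulrNN mul1r expr1n mul1r.
by [].
Qed.

End constant_coefficient_ode.

(** * Topology of the local Sobolev space *)

Section seminorm_topology.
Context {R : realType} (X : lcs R).

Definition lcs_pt (u : lcs_ambient X) (hu : @lcs_set R X u) : X :=
  @exist _ (fun v => v \in @lcs_set R X) u (mem_set hu).

Lemma lcs_ball_nbhs (j : lcs_index X) (x y : X) (r : R) : 0 < r -> lcs_ball j x r y ->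
  nbhs y (lcs_ball j x r).
Proof.
move=> r0 yB; apply: open_nbhs_nbhs; split=> //.
exists [set lcs_ball j x r].
  move=> B /= ->; apply: (@finI_from1 _ _ (@lcs_subbase R X) id).
  by exists j, x, r.
by rewrite bigcup_set1.
Qed.

Lemma lcs_nbhsE (x : X) (U : set X) : nbhs x U -> exists D : seq (set X),
  (forall B, B \in D -> lcs_subbase B /\ B x) /\
  (forall z, (forall B, B \in D -> B z) -> U z).
Proof.
rewrite nbhsE => -[B [oB Bx] BU].
have [D' sD' E] := oB.
have [B' D'B' B'x] : (\bigcup_(i in D') i) x by rewrite E.
have [F FD FE] := sD' _ D'B'.
exists (finmap.enum_fset F); split.
  move=> G GF; split; first by apply: set_mem; exact: FD.
  by move: B'x; rewrite -FE; apply.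
move=> z hz; apply: BU; rewrite -E.
suff zB : (B' : set X) z by exact: (ex_intro2 _ _ B' D'B' zB).
by rewrite -FE => G GF; exact: hz.
Qed.

End seminorm_topology.

Section local_sobolev_topology.
Context {R : realType}.
Local Notation C := (R[i]^o).
Variables (I : set R) (e : exhaustion I) (s : R).
Implicit Types (u v : test I -> C).

Definition pj (j : nat) u : R := Hs_norm s (cutoff (exh_fun e j) u).

Lemma Hs_cutoffB (phi : test I) u v : Hs s (cutoff phi u) -> Hs s (cutoff phi v) ->
  Hs s (cutoff phi (u - v)).
Proof.
move=> hu hv; have := Hs_lin (-1) hv hu.
rewrite (_ : (fun chi => _) = cutoff phi (u - v))//.
by apply/funext => chi; rewrite mulN1r addrC.
Qed.

Section with_bump.
Variables (b : R -> R) (d : R).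
Hypothesis hB : bump b d.

Lemma pj_triangle j u v w : Hloc s I u -> Hloc s I v -> Hloc s I w ->
  pj j (u - w) <= pj j (u - v) + pj j (v - w).
Proof.
move=> [_ hu] [_ hv] [_ hw].
have huv := Hs_cutoffB (hu (exh_fun e j)) (hv (exh_fun e j)).
have hvw := Hs_cutoffB (hv (exh_fun e j)) (hw (exh_fun e j)).
have := Hs_norm_lin hB 1 huv hvw; rewrite normc1 mul1r; apply: le_trans.
rewrite /pj (_ : cutoff _ (u - w) = (fun chi => 1 * cutoff (exh_fun e j) (u - v) chi +
  cutoff (exh_fun e j) (v - w) chi))//.
apply/funext => chi; rewrite mul1r -[RHS]/(u _ - v _ + (v _ - w _)).
by rewrite addrA subrK.
Qed.

(** A neighbourhood contains a finite intersection of balls with arbitrary centres; the triangle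
    inequality recentres them at [x], and [J] and [rho] are the largest index and the smallest
    remaining radius. *)
Lemma Hloc_nbhsP (x : Hloc_space s e) (U : set (Hloc_space s e)) : nbhs x U ->
  exists (J : nat) (rho : R), 0 < rho /\ forall z : Hloc_space s e,
    (forall j, (j <= J)%N -> pj j (lcs_val z - lcs_val x) < rho) -> U z.
Proof.
move=> /lcs_nbhsE[D [HD HU]].
suff [J [rho [rho0 H]]] : exists (J : nat) (rho : R), 0 < rho /\ forall z : Hloc_space s e,
    (forall j, (j <= J)%N -> pj j (lcs_val z - lcs_val x) < rho) -> forall B, B \in D -> B z.
  by exists J, rho; split=> // z hz; apply: HU; exact: H.
elim: D HD {HU} => [|B D IH] HD.
  by exists 0%N, 1; split=> // z _ B; rewrite in_nil.
have [J [rho [rho0 H]]] := IH (fun B' hB' => HD B' (mem_behead (s := B :: D) hB')).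
have [[j [y [r [r0 EB]]]] Bx] := HD B (mem_head _ _).
pose r' := r - pj j (lcs_val x - lcs_val y).
have r'0 : 0 < r' by rewrite subr_gt0; move: Bx; rewrite EB.
exists (maxn j J), (Num.min rho r'); split; first by rewrite lt_min rho0.
move=> z hz B'; rewrite inE => /predU1P[->|B'D]; last first.
  apply: H => // k kJ; have := hz k (leq_trans kJ (leq_maxr _ _)).
  by rewrite lt_min => /andP[].
rewrite EB /lcs_ball /= -/(pj j _).
apply: le_lt_trans (pj_triangle j (set_valP z) (set_valP x) (set_valP y)) _.
have := hz j (leq_maxl _ _); rewrite lt_min => /andP[_].
by rewrite /r' ltrBrDr.
Qed.

Lemma pj_ball_nbhs j (x : Hloc_space s e) (r : R) : 0 < r ->
  nbhs x [set z : Hloc_space s e | pj j (lcs_val z - lcs_val x) < r].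
Proof.
move=> r0; apply: (@lcs_ball_nbhs R (Hloc_space s e) j x x r r0).
rewrite /lcs_ball /= subrr.
have h0 : Hs s (cutoff (exh_fun e j) (lcs_val x)) := (set_valP x).2 _.
have := Hs_normZ hB 0 h0; rewrite normc0 mul0r.
rewrite (_ : (fun chi => _) = cutoff (exh_fun e j) 0); first by move=> ->.
by apply/funext => chi; rewrite mul0r.
Qed.

Lemma Hloc_dist f : sch f -> Hloc s I (@dist_of_fun R I f).
Proof. by move=> hf; rewrite dist_of_funE; apply: Hloc_restrict; exact: Hs_tempered_of_fun. Qed.

Lemma Hloc_lin (c : R[i]) u v : Hloc s I u -> Hloc s I v -> Hloc s I (c *: u + v).
Proof.
move=> [[lu bu] hu] [[lv bv] hv]; split; last first.
  by move=> phi; rewrite cutoff_lin; exact: Hs_lin.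
split=> [a p q|K cK KI].
  rewrite -[LHS]/(c * u (a *: p + q) + v (a *: p + q)) lu lv /GRing.scale/=.
  by rewrite -[RHS]/(a * (c * u p + v p) + (c * u q + v q)); ring.
have [N1 [c1 h1]] := bu K cK KI; have [N2 [c2 h2]] := bv K cK KI.
exists (maxn N1 N2), (normc c * c1 + c2) => phi M sp hM.
apply: le_trans (le_normcD _ _) _; rewrite mulrDl; apply: lerD.
  rewrite -[normc (_ *: _)]/(normc (c * u phi)) normcM -mulrA ler_wpM2l ?normc_ge0//.
  by apply: h1 => // n x nN; apply: hM; exact: leq_trans nN (leq_maxl _ _).
by apply: h2 => // n x nN; apply: hM; exact: leq_trans nN (leq_maxr _ _).
Qed.

Section domain.
Variables (m : nat) (a : 'I_m.+1 -> R[i]).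
Let A := aD s e a.

Lemma dom_test (phi : test I) : op_dom A (@dist_of_fun R I phi).
Proof.
have h : HI (s + m%:R) I (@dist_of_fun R I phi).
  by exists (tempered_of_fun phi) => //; apply: Hs_tempered_of_fun; exact: test_sch.
exists (@lcs_pt R (HI_space (s + m%:R) I) _ h) => //.
by apply: subset_closure; exists phi.
Qed.

Lemma dom_restrict u : op_dom A u -> exists2 T, Hs (s + m%:R) T & u = dist_restrict T.
Proof. by move=> [x _ <-]; have [T hT E] := set_valP x; exists T. Qed.

Lemma dom_Hloc u : op_dom A u -> Hloc s I u.
Proof.
move=> /dom_restrict[T hT ->]; apply: Hloc_restrict; apply: Hs_sub hT.
by rewrite lerDl.
Qed.

Lemma max_bound (M : nat -> R) (J : nat) : exists2 B, 0 < B & forall j, (j <= J)%N -> M j <= B.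
Proof.
elim: J => [|J [B B0 IH]].
  exists (`|M 0%N| + 1); first by rewrite ltr_wpDl.
  by move=> j; rewrite leqn0 => /eqP ->; rewrite (le_trans (ler_norm _))// lerDl.
exists (B + `|M J.+1|); first by rewrite ltr_wpDr.
move=> j; rewrite leq_eqVlt => /predU1P[->|jJ].
  by rewrite (le_trans (ler_norm _))// lerDr ltW.
by rewrite (le_trans (IH j jJ))// lerDl.
Qed.

(** Closeness in the quotient norm supplies an extension [T] of the difference to the whole line
    with small norm. Each seminorm of index at most [J] is the norm of a product with [T], hence at
    most [B] times the norm of [T]. *)
Lemma dom_approx u (J : nat) (r : R) : op_dom A u -> 0 < r ->
  exists phi : test I, forall j, (j <= J)%N -> pj j (@dist_of_fun R I phi - u) < r.
Proof.
move=> [x cx <-] r0.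
have [M HM] : exists M : nat -> R, forall j, 0 <= M j /\ forall T, Hs s T ->
    Hs_norm s (tmul (exh_fun e j) T) <= M j * Hs_norm s T.
  have H j : exists M, 0 <= M /\ forall T, Hs s T ->
      Hs_norm s (tmul (exh_fun e j) T) <= M * Hs_norm s T.
    by have [M M0 h] := tmul_norm hB s (exh_fun e j); exists M.
  by exists (fun j => projT1 (cid (H j))) => j; exact: projT2 (cid (H j)).
have [B B0 hBM] := max_bound M J.
pose t := s + m%:R; have st : s <= t by rewrite lerDl.
have [T0 hT0 E0] := set_valP x.
have n0 : HI_norm t (0 : test I -> C) <= 0.
  rewrite /HI_norm; apply: ge_inf.
    by exists 0 => _ [T _ <-]; exact: Hs_norm_ge0.
  have h0 := Hs_normZ hB 0 hT0; rewrite normc0 mul0r in h0.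
  exists (fun chi => 0 * T0 chi) => //; split; last by apply/funext => p; rewrite /dist_restrict mul0r.
  have := Hs_lin (-1) hT0 hT0; rewrite (_ : (fun chi => _) = fun chi => 0 * T0 chi)//.
  by apply/funext => chi; rewrite mul0r mulN1r addNr.
have rB : 0 < r / B by rewrite divr_gt0.
have nx : nbhs x (lcs_ball (X := HI_space t I) tt x (r / B)).
  apply: lcs_ball_nbhs => //; rewrite /lcs_ball /= subrr.
  exact: le_lt_trans n0 rB.
have [z [[phi zphi] hz]] := cx _ nx.
exists phi => j jJ; rewrite -zphi.
have [T1 hT1 E1] := set_valP z.
have zx : Hs t (fun chi => -1 * T0 chi + T1 chi) by exact: Hs_lin.
have Ezx : dist_restrict (fun chi => -1 * T0 chi + T1 chi) = lcs_val z - lcs_val x.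
  apply/funext => p; rewrite -[RHS]/((\val z) p - (\val x) p) -E0 -E1 /dist_restrict.
  by rewrite mulN1r addrC.
have [_ [T [hT ET] <-] nT] : exists2 y, (Hs_norm t @` [set T | Hs t T /\
     dist_restrict T = lcs_val z - lcs_val x]) y & y < r / B.
  apply: inf_lt; last exact: hz.
  exists (Hs_norm t (fun chi => -1 * T0 chi + T1 chi)).
  by exists (fun chi => -1 * T0 chi + T1 chi).
rewrite -ET -/(tmul _ T) /pj -/(tmul _ _).
have [Mj0 hMj] := HM j.
have hTs := Hs_sub st hT.
apply: le_lt_trans (hMj T hTs) _.
apply: (@le_lt_trans _ _ (B * Hs_norm t T)).
  apply: ler_pM => //; first exact: Hs_norm_ge0.
    exact: hBM.
  exact: (Hs_norm_sub hB st hT).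
by rewrite mulrC -ltr_pdivlMr.
Qed.

End domain.
End with_bump.
End local_sobolev_topology.

(** * Action of the operator on distributions *)

Section differentiated_distributions.
Context {R : realType}.
Local Notation C := (R[i]^o).
Local Notation mu := (@lebesgue_measure R).
Implicit Types (s t : R) (f w : R -> C) (T : schwartz R -> C).

Lemma wtD s t (x : R) : wt (s + t) x = wt s x * wt t x.
Proof.
rewrite /wt mulrDl powRD//; apply/implyP => _.
by rewrite gt_eqF// onesq_gt0.
Qed.

Lemma wt1X (x : R) k : wt 1 x ^+ k = wt k%:R x.
Proof.
rewrite /wt -powR_mulrn ?powR_ge0// -powRrM; congr (_ `^ _).
by rewrite mul1r mulrC.
Qed.

Lemma norm_le_wt1 (x : R) : `|x| <= wt 1 x.
Proof.
rewrite /wt mul1r powR12_sqrt ?(ltW (onesq_gt0 _))// -sqrtr_sqr ler_wsqrtr//.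
by rewrite lerDr.
Qed.

(** The symbol of [d/dx] seen through [ifourier]; the reflection in [ifourier] accounts for the
    minus sign. *)
Definition symb (x : R) : R[i] := (0 -i* (2 * pi)) * x%:C.

Lemma symb_norm x : normc (symb x) <= 2 * pi * wt 1 x.
Proof.
rewrite normcM normc_real.
have -> : normc (0 -i* (2 * pi)) = 2 * pi :> R.
  by rewrite /= expr0n add0r sqrrN sqrtr_sqr ger0_norm// mulr_ge0// pi_ge0.
by rewrite ler_wpM2l ?norm_le_wt1// mulr_ge0// pi_ge0.
Qed.

Lemma ifourier_cderiv f k x : sch f -> ifourier (cderiv k f) x = symb x ^+ k * ifourier f x.
Proof.
move=> hf; elim: k => [|k IH]; first by rewrite cderiv_0 expr0 mul1r.
rewrite cderivS /ifourier fourier_cderiv; last exact: sch_cderiv.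
rewrite -/(ifourier (cderiv k f) x) IH exprS mulrA; congr (_ * _ * _).
by rewrite /symb; apply: complex_ext; rewrite ?cReM ?cImM /=; ring.
Qed.

Lemma cmeasurable_symbX k : cmeasurable (fun x => symb x ^+ k : C).
Proof.
elim: k => [|k IH]; first exact: cmeasurable_cst.
under eq_fun do rewrite exprS; apply: cmeasurableM => //.
by apply: cmeasurableM; [exact: cmeasurable_cst|apply: cmeasurable_real].
Qed.

Section operator.
Variables (m : nat) (c : 'I_m.+1 -> R[i]).

Definition psymb (x : R) : C := \sum_(k < m.+1) c k * symb x ^+ k.

Lemma cmeasurable_psymb : cmeasurable psymb.
Proof.
rewrite /psymb; elim: (index_enum _) => [|k l IH].
  by under eq_fun do rewrite big_nil; exact: cmeasurable_cst.
under eq_fun do rewrite big_cons; apply: cmeasurableD => //.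
by apply: cmeasurableM; [exact: cmeasurable_cst|exact: cmeasurable_symbX].
Qed.

Lemma psymb_norm : exists2 M, 0 <= M & forall x, normc (psymb x) <= M * wt m%:R x.
Proof.
exists (\sum_(k < m.+1) normc (c k) * (2 * pi) ^+ k).
  by apply: sumr_ge0 => k _; rewrite mulr_ge0 ?normc_ge0// exprn_ge0// mulr_ge0// pi_ge0.
move=> x; rewrite /psymb mulr_suml; elim/big_ind2: _ => [|u v u' v' h1 h2|k _].
- by rewrite normc0.
- by apply: le_trans (le_normcD _ _) _; exact: lerD.
rewrite normcM -mulrA ler_wpM2l ?normc_ge0// normcX.
apply: (@le_trans _ _ ((2 * pi * wt 1 x) ^+ k)).
  by rewrite lerXn2r ?nnegrE ?normc_ge0 ?symb_norm// mulr_ge0 ?wt_ge0// mulr_ge0// pi_ge0.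
rewrite exprMn ler_wpM2l ?exprn_ge0 ?mulr_ge0 ?pi_ge0// wt1X.
by apply: wt_mono; rewrite ler_nat -ltnS.
Qed.

(** The transpose of the operator with coefficients [c], hence without signs. The operator itself,
    [diff_op], corresponds to the coefficients [c k * (-1) ^+ k]. *)
Definition tdiff T : schwartz R -> C := fun chi =>
  \sum_(k < m.+1) c k * (T (mks (sch_cderiv k (schwartz_sch chi))) : R[i]).

Definition fdiff f : R -> C := fun x => \sum_(k < m.+1) c k * cderiv k f x.

(** On the Fourier side the operator multiplies by [psymb], whose growth of order [m] accounts for
    the lost derivatives. *)
Lemma tdiff_frep t T w : fourier_repr t T w ->
  fourier_repr (t - m%:R) (tdiff T) (fun x => psymb x * w x).
Proof.
move=> hT; have hw := frep_cl2 hT.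
have [M M0 hM] := psymb_norm.
have mW : cmeasurable (fun x => psymb x * w x).
  by apply: cmeasurableM; [exact: cmeasurable_psymb|exact: hw.1].
have le x : wabs (t - m%:R) (fun x => psymb x * w x) x <= wabs t (fun x => M%:C * w x) x.
  rewrite /wabs !normcM normc_real ger0_norm// wtD wtN.
  rewrite -mulrA ler_wpM2l ?wt_ge0// mulrA ler_wpM2r ?normc_ge0//.
  by rewrite mulrC ler_pdivrMr ?wt_gt0.
have [hMw _] := cl2Z_nrm M%:C hw.
have [hW _] := cl2_le mW le hMw.
apply: frepI => // chi; have hc := schwartz_sch chi.
have hi := sch_ifourier hc.
have E k : T (mks (sch_cderiv k (schwartz_sch chi))) = cint (fun x => w x * (symb x ^+ k * ifourier chi x)).
  by rewrite (frep_eval _ hT); apply: eq_cint => x; rewrite ifourier_cderiv.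
have i k : cintegrable (fun x => w x * (symb x ^+ k * ifourier chi x)).
  have -> : (fun x => w x * (symb x ^+ k * ifourier chi x)) =
      (fun x => w x * ifourier (cderiv k chi) x).
    by apply/funext => x; rewrite ifourier_cderiv.
  by apply: cl2_cintegrable hw _; apply: sch_ifourier; exact: sch_cderiv.
rewrite /tdiff; under eq_bigr do rewrite E.
have [_ ->] : cintegrable (fun x => psymb x * w x * ifourier chi x) /\
    cint (fun x => psymb x * w x * ifourier chi x) =
    \sum_(k < m.+1) c k * cint (fun x => w x * (symb x ^+ k * ifourier chi x)); last by [].
rewrite /psymb; elim: (index_enum _) => [|k l [ih1 ih2]].
  have -> : (fun x => (\sum_(k <- [::]) c k * symb x ^+ k) * w x * ifourier chi x) = (fun=> 0).
    by apply/funext => x; rewrite big_nil !mul0r.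
  by rewrite big_nil cint0; split=> //; split; exact: rint0.
have EE : (fun x => (\sum_(j <- k :: l) c j * symb x ^+ j) * w x * ifourier chi x) =
    (fun x => c k * (w x * (symb x ^+ k * ifourier chi x)) +
      (\sum_(j <- l) c j * symb x ^+ j) * w x * ifourier chi x).
  by apply/funext => x; rewrite big_cons; ring.
have ik := cintegrableZ (c k) (i k).
rewrite EE; split; first exact: cintegrableD.
by rewrite cintD// cintZ// ih2 big_cons.
Qed.

Lemma tdiff_linear T : linear T -> linear (tdiff T).
Proof.
move=> lT a u v; rewrite /tdiff /GRing.scale/= mulr_sumr -big_split/=; apply: eq_bigr => k _.
have -> : mks (sch_cderiv k (schwartz_sch (a *: u + v))) =
    a *: mks (sch_cderiv k (schwartz_sch u)) + mks (sch_cderiv k (schwartz_sch v)).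
  apply: schwartz_ext => x /=.
  have := cderivE a k (sch_smooth (schwartz_sch u)) (sch_smooth (schwartz_sch v)).
  by move=> /(congr1 (fun h => h x)).
by rewrite lT /GRing.scale/= mulrDr mulrCA.
Qed.

Lemma Hs_tdiff t T : Hs t T -> Hs (t - m%:R) (tdiff T).
Proof.
move=> [[lT _] [w hw]]; have h := tdiff_frep hw; split; last by exists (fun x => psymb x * w x).
by apply: tempered_frep h; exact: tdiff_linear.
Qed.

Lemma sch_sum (r : seq 'I_m.+1) f : sch f -> sch (fun x => \sum_(k <- r) c k * cderiv k f x).
Proof.
move=> hf; elim: r => [|k l IH].
  have -> : (fun x => \sum_(k <- [::]) c k * cderiv k f x) = (0 : R -> C).
    by apply/funext => x; rewrite big_nil.
  exact: rpred0.
under eq_fun do rewrite big_cons; apply: schD => //.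
by apply: schZ; exact: sch_cderiv.
Qed.

Lemma sch_fdiff f : sch f -> sch (fdiff f).
Proof. exact: sch_sum. Qed.

Lemma tdiffE T (chi : schwartz R) (h : sch (fdiff chi)) : linear T -> tdiff T chi = T (mks h).
Proof.
move=> lT; rewrite /tdiff; move: h; rewrite /fdiff.
elim: (index_enum _) => [|k l IH] h.
  rewrite big_nil (_ : mks h = 0); last by apply: schwartz_ext => x /=; rewrite big_nil.
  by rewrite linear_at0.
have hl := sch_sum l (schwartz_sch chi).
rewrite big_cons (IH hl).
have -> : mks h = c k *: mks (sch_cderiv k (schwartz_sch chi)) + mks hl.
  by apply: schwartz_ext => x /=; rewrite big_cons.
by rewrite lT.
Qed.

End operator.

Lemma diff_op_restrict (I : set R) m (c : 'I_m.+1 -> R[i]) T :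
  diff_op c (@dist_restrict R I T) = dist_restrict (tdiff (fun k => c k * (-1) ^+ k) T).
Proof.
apply/funext => phi; apply: eq_bigr => k _; rewrite mulrA; congr (_ * _).
by congr T; exact: schwartz_ext.
Qed.

Lemma dist_fdiff (I : set R) m (c : 'I_m.+1 -> R[i]) f : sch f ->
  diff_op c (@dist_of_fun R I f) = dist_of_fun (fdiff c f).
Proof. by move=> hf; apply/funext => phi; rewrite diff_op_dist. Qed.

(** The derivative of [wt r] is [r x wt (r - 2)], so the weights of all orders have to be taken
    together. *)
Inductive wt_class : (R -> C) -> Prop :=
| wt_base t : wt_class (fun x => (wt t x)%:C)
| wt_mulx f : wt_class f -> wt_class (fun x => x%:C * f x)
| wt_scale (c : R[i]) f : wt_class f -> wt_class (fun x => c * f x)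
| wt_add f g : wt_class f -> wt_class g -> wt_class (fun x => f x + g x).

Lemma wt_smooth t : smooth_on setT (fun x => (wt t x)%:C : C).
Proof.
have [] // := @derivative_closed_class R wt_class _ _ (wt_base t).
move=> f; elim => {f} [r|f hf [f' hf' df]|c f hf [f' hf' df]|f g hf [f' hf' df] hg [g' hg' dg]].
- exists (fun x => r%:C * (x%:C * (wt (r - 2) x)%:C)).
    by apply/wt_scale/wt_mulx/wt_base.
  move=> x; rewrite -!rmorphM/=; apply: cdiff_real.
  have D : is_derive x 1 (fun x : R => 1 + x ^+ 2) (2 * x).
    have := is_deriveD (is_derive_cst (1 : R) x 1) (is_deriveX 2%N (is_derive_id x 1)).
    by move=> /is_derive_eqd; apply; rewrite /GRing.scale/= expr1 mulr1 add0r mulr2n; ring.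
  have P0 := onesq_gt0 x.
  have P : is_derive (1 + x ^+ 2) 1 (fun y : R => y `^ (r / 2)) ((r / 2) * (1 + x ^+ 2) `^ (r / 2 - 1)).
    apply: DeriveDef; first by apply: derivable_powR; rewrite in_itv/= andbT.
    by rewrite -derive1E powR_derive1// in_itv/= andbT.
  have D2 := @is_derive1_comp _ (fun y : R => y `^ (r / 2)) (fun y : R => 1 + y ^+ 2) x _ _ P D.
  apply: (is_derive_eqd D2).
  rewrite /GRing.scale/= /wt (_ : (r - 2) / 2 = r / 2 - 1); last by field.
  by set z := powR _ _; field.
- exists (fun x => x%:C * f' x + f x); first by apply: wt_add => //; exact: wt_mulx.
  by move=> x; apply: cdiff_eq (cdiffM (cdiff_id x) (df x)) _; rewrite mul1r.
- by exists (fun x => c * f' x); [exact: wt_scale|move=> x; exact: cdiffZ].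
- by exists (fun x => f' x + g' x); [exact: wt_add|move=> x; exact: cdiffD].
Qed.

Lemma smooth_conj f : smooth_on setT f -> smooth_on setT (fun x => conjc (f x)).
Proof.
move=> sf; pose P (h : R -> C) := exists2 g : R -> C, smooth_on setT g & h = fun x => conjc (g x).
have H h : P h -> exists2 h', P h' & forall x, cdiff h x (h' x).
  move=> [g sg ->]; exists (fun x => conjc (cderiv 1%N g x)).
    exact: ex_intro2 _ _ (cderiv 1%N g) (smooth_cderiv 1 sg) erefl.
  by move=> x; apply: cdiff_conj; exact: smooth_cdiff0.
by have [] := derivative_closed_class H (ex_intro2 _ _ f sf erefl).
Qed.

Section with_bump.
Variables (b : R -> R) (d : R).
Hypothesis hB : bump b d.

(* the functional is tested on [conj W] times the weight, cut off smoothly;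
   this makes the truncated norms of [W] uniformly bounded *)
Lemma cl2_of_bounded_functional s t W (M : R) : smooth_on setT W -> cl2 t W ->
  (forall psi, sch psi -> normc (cint (fun x => W x * psi x)) <= M * nrm s psi) ->
  cl2 (- s) W.
Proof.
move=> sW hW hM; have [hb d0 b1 b0 bge0] := hB; have [B B0 hBd] := bump_bounded hB.
have mW := smooth_cmeasurable sW.
pose bn (n : nat) (x : R) := b (n.+1%:R^-1 * x).
have bn0 n x : 0 <= bn n x by exact: bge0.
pose F n (x : R) := (wabs (- s) W x * bn n x) ^+ 2.
pose g x : C := (wt (- s) x)%:C * ((wt (- s) x)%:C * conjc (W x)).
have sg : smooth_on setT g.
  apply: smoothM; first exact: wt_smooth.
  by apply: smoothM; [exact: wt_smooth|exact: smooth_conj].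
have hbn n : sch (fun x => (bn n x)%:C) by apply: (sch_dilated_bump hB); rewrite invr_gt0.
have key n : rint (F n) /\ \int[mu]_x F n x <= (M * B) ^+ 2.
  have n0 : (0 : R) < n.+1%:R^-1 by rewrite invr_gt0.
  have h1 : sch (fun x => (bn n x)%:C * g x) := smooth_bump_sch hB n0 sg.
  (* The bump enters twice, so that [W * psi] is the square [F n] and the norm of [psi] is at most
     [B] times the root of the integral of [F n]. The hypothesis on [W] thus bounds that root by
     [M * B]. *)
  pose psi x : C := (bn n x)%:C * ((bn n x)%:C * g x).
  have hpsi : sch psi := smooth_bump_sch hB n0 (sch_smooth h1).
  have EF x : (F n x)%:C = W x * psi x.
    have -> : W x * psi x = ((bn n x) * (bn n x) * (wt (- s) x * wt (- s) x))%:C * (W x * conjc (W x)).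
      by rewrite /psi /g !rmorphM/=; ring.
    have -> : W x * conjc (W x) = (normc (W x) ^+ 2)%:C.
      by rewrite sqr_normcE; case: (W x) => u v; apply: complex_ext; rewrite ?cReM ?cImM/=; ring.
    by rewrite -rmorphM/=; congr (_%:C); rewrite /F /wabs; ring.
  have iF : cintegrable (fun x => W x * psi x) by exact: cl2_cintegrable hW hpsi.
  have rF : rint (F n).
    have [+ _] := iF; rewrite (_ : ReF _ = F n)//.
    by apply/funext => x; rewrite /ReF -EF.
  split=> //; set Q := Rintegral _ _ _.
  have Q0 : 0 <= Q by apply: Rintegral_ge0 => x _; exact: sqr_ge0.
  have EQ : normc (cint (fun x => W x * psi x)) = Q.
    have -> : cint (fun x => W x * psi x) = Q%:C.
      apply: complex_ext => /=.
        by congr Rintegral; apply/funext => x; rewrite /ReF -EF.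
      rewrite (_ : ImF _ = cst 0) ?Rintegral_cst ?mul0r//.
      by apply/funext => x; rewrite /ImF -EF.
    by rewrite normc_real ger0_norm.
  have l2F : l2 (fun x => wabs (- s) W x * bn n x).
    split=> //; apply: measurable_funM; first exact: measurable_wabs.
    by have [] := sch_cmeasurable (hbn n).
  have EN : l2norm (fun x => wabs (- s) W x * bn n x) = Num.sqrt Q by [].
  have hn : nrm s psi <= B * Num.sqrt Q.
    have EB : B * Num.sqrt Q = l2norm (fun x => B * (wabs (- s) W x * bn n x)).
      by rewrite l2normZ// gtr0_norm.
    rewrite (nrmE (sch_cl2 s hpsi)) EB.
    apply: l2norm_le; last exact: l2Z.
    - move=> x; rewrite ger0_norm ?wabs_ge0// {1}/wabs /psi /g !normcM !normc_real normc_conj.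
      rewrite !ger0_norm ?wt_ge0//.
      have -> : wt s x * (bn n x * (bn n x * (wt (- s) x * (wt (- s) x * normc (W x))))) =
        (wt s x * wt (- s) x) * (bn n x * (wabs (- s) W x * bn n x)) by rewrite /wabs; ring.
      rewrite wtVK mul1r; apply: ler_wpM2r; last exact: hBd.
      by rewrite mulr_ge0 ?wabs_ge0.
    - by apply: measurable_wabs; exact: sch_cmeasurable.
  (* A negative [M] forces the nonnegative [Q] to vanish. *)
  have M0 : 0 <= M \/ Q = 0.
    have [M0|M0] := leP 0 M; [by left|right].
    apply/eqP; rewrite eq_le Q0 andbT -EQ; apply: le_trans (hM psi hpsi) _.
    by rewrite nmulr_rle0// nrm_ge0.
  have [{}M0|->] := M0; last exact: sqr_ge0.
  have h2 : Q <= M * B * Num.sqrt Q.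
    by rewrite -{1}EQ -mulrA; apply: le_trans (hM psi hpsi) _; rewrite ler_wpM2l.
  have [->|Qn0] := eqVneq Q 0; first exact: sqr_ge0.
  have Qp : 0 < Num.sqrt Q by rewrite sqrtr_gt0 lt_neqAle eq_sym Qn0.
  have : Num.sqrt Q <= M * B.
    by rewrite -(ler_pM2r Qp) -expr2 sqr_sqrtr.
  move=> h3; rewrite -[Q]sqr_sqrtr// lerXn2r ?nnegrE ?sqrtr_ge0//.
  by rewrite mulr_ge0// ltW.
apply/cl2P; split=> //; split; first exact: measurable_wabs.
have mw2 : measurable_fun setT (fun x => wabs (- s) W x ^+ 2).
  by apply: (measurable_funX 2%N); exact: measurable_wabs.
apply: rint_ge0P => //; first by move=> x; exact: sqr_ge0.
pose J (n : nat) : set R := `[- (d * n.+1%:R), d * n.+1%:R]%classic.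
have mono : {homo J : n k / (n <= k)%N >-> n `<=` k}.
  move=> n k nk x; rewrite /J /= !in_itv/= -!ler_norml => /le_trans; apply.
  by rewrite ler_pM2l// ler_nat ltnS.
have UJ : \bigcup_n J n = setT.
  apply/seteqP; split=> // x _; exists (Num.truncn (`|x| / d)) => //.
  rewrite /J /= in_itv/= -ler_norml mulrC -ler_pdivrMr//.
  exact/ltW/truncnS_gt.
have cvJ : (\int[mu]_(x in J n) (wabs (- s) W x ^+ 2)%:E @[n --> \oo] -->
    \int[mu]_x (wabs (- s) W x ^+ 2)%:E)%E.
  rewrite -UJ; apply: ge0_nondecreasing_set_cvg_integral.
  - by move=> n k nk; apply/subsetPset; exact: mono.
  - by move=> n; exact: measurable_itv.
  - by move=> n; apply/measurable_EFinP; exact: measurable_funTS.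
  - by move=> n x _; rewrite lee_fin sqr_ge0.
apply: (@le_lt_trans _ _ ((M * B) ^+ 2)%:E); last by rewrite ltry.
apply: (cvge_le _ cvJ); apply: nearW => n.
have [iF leF] := key n; rewrite -lee_fin -rint_EFin// in leF; apply: le_trans leF.
rewrite integral_mkcond; apply: ge0_le_integral => //.
- by move=> x _; rewrite patchE; case: ifP => // _; rewrite lee_fin sqr_ge0.
- apply/(measurable_restrictT _ _).1; first exact: measurable_itv.
  by apply/measurable_EFinP; exact: measurable_funTS.
- by apply/measurable_EFinP; exact: rint_measurable.
- move=> x _; rewrite patchE; case: ifPn => [|_]; last by rewrite lee_fin sqr_ge0.
  rewrite inE /J/= in_itv/= -ler_norml => hx; rewrite lee_fin /F /bn b1 ?mulr1//.
  by rewrite normrM gtr0_norm ?invr_gt0// ler_pdivrMl// mulrC.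
Qed.

(* [T = phi T] makes the transform of [T] smooth, so its truncations are Schwartz
   functions *)
Lemma Hs_smooth_approx s (I : set R) (phi : test I) T (r : R) : Hs s T -> tmul phi T = T -> 0 < r ->
  exists2 f, sch f & Hs_norm s (fun chi => -1 * T chi + tempered_of_fun f chi) < r.
Proof.
move=> [_ [w hw]] idT r0; have hF := sch_fourier (test_sch phi).
have hW := tmul_frep phi hw; rewrite idT in hW.
set W := conv _ w in hW; have cW := frep_cl2 hW.
have sW : smooth_on setT W by exact: conv_smooth hF (frep_cl2 hw).
have [hb d0 b1 b0 bge0] := hB; have [B B0 hBd] := bump_bounded hB.
pose bn (n : nat) (x : R) : R := b (n.+1%:R^-1 * x).
have hbn n : sch (fun x => (bn n x)%:C) by apply: (sch_dilated_bump hB); rewrite invr_gt0.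
have n0 n : (0 : R) < n.+1%:R^-1 by rewrite invr_gt0.
have hs n : sch (fun x => (bn n x)%:C * W x) := smooth_bump_sch hB (n0 n) sW.
pose f n := ifourier (fun x => (bn n x)%:C * W x).
have hf n : sch (f n) by exact: sch_ifourier.
pose D n x : C := -1 * W x + (bn n x)%:C * W x.
have rD n : fourier_repr s (fun chi => -1 * T chi + tempered_of_fun (f n) chi) (D n).
  have := frepD (-1) hW (tempered_of_fun_repr s (hf n)).
  by rewrite ifourierK.
have [_ iW] := cl2_l2 cW.
have iD n := (cl2_l2 (frep_cl2 (rD n))).2.
have ED n x : wabs s (D n) x = `|bn n x - 1| * wabs s W x.
  rewrite /wabs /D (_ : -1 * W x + (bn n x)%:C * W x = (bn n x - 1)%:C * W x).
    by rewrite normcM normc_real mulrCA.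
  by rewrite rmorphB/=; ring.
have cvD : (\int[mu]_x wabs s (D n) x ^+ 2) @[n --> \oo] --> (0 : R).
  have := @dominated_convergence _ _ R mu setT measurableT
    (fun n x => (wabs s (D n) x ^+ 2)%:E) (fun=> 0%E) (fun x => ((1 + B) ^+ 2 * wabs s W x ^+ 2)%:E).
  case=> //.
  - by move=> n; apply/measurable_EFinP; exact: rint_measurable (iD n).
  - apply/aeW => x _; apply: cvg_EFin; first exact: nearW.
    apply/cvgrPdist_lt => e e0; near=> n; rewrite /= ED.
    rewrite (_ : bn n x = 1) ?subrr ?normr0 ?mul0r ?expr0n ?subrr ?normr0//.
    rewrite /bn b1// normrM gtr0_norm ?invr_gt0// ler_pdivrMl//.
    rewrite mulrC -ler_pdivrMl// mulrC.
    apply: (@le_trans _ _ n%:R); last by rewrite ler_nat.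
    by near: n; exact: nbhs_infty_ger.
  - exact: rintZ.
  - apply/aeW => x n _; rewrite /= lee_fin ger0_norm ?sqr_ge0// ED exprMn.
    rewrite ler_wpM2r ?sqr_ge0// lerXn2r ?nnegrE// ?addr_ge0// ?(ltW B0)//.
    apply: le_trans (ler_normB _ _) _; rewrite normr1 addrC lerD2l ger0_norm; [exact: hBd|exact: bge0].
  move=> _ _; rewrite integral0 => cv.
  by apply: fine_cvg; exact: cv.
have r2 : 0 < r ^+ 2 by rewrite exprn_gt0.
move/cvgrPdist_lt : cvD => /(_ _ r2) h.
near \oo => n.
have hn : `|0 - \int[mu]_x wabs s (D n) x ^+ 2| < r ^+ 2 by near: n.
exists (f n); first exact: hf.
rewrite (Hs_normE hB (rD n)) (nrmE (frep_cl2 (rD n))).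
rewrite -(@ltr_pXn2r _ 2)// ?nnegrE ?l2norm_ge0 ?(ltW r0)// sqr_l2norm.
apply: le_lt_trans hn; rewrite sub0r normrN; exact: ler_norm.
Unshelve. all: by end_near. Qed.

End with_bump.
End differentiated_distributions.

(** * Spectra *)

Section range_of_operator.
Context {R : realType}.
Local Notation C := (R[i]^o).
Variables (I : set R) (e : exhaustion I) (s : R) (m : nat) (a : 'I_m.+1 -> R[i]).
Hypotheses (m1 : (1 <= m)%N) (am : a ord_max != 0).
Variables (b : R -> R) (d : R).
Hypothesis hB : bump b d.
Implicit Types (f y : R -> C) (g h : schwartz R -> C) (u : test I -> C) (l : R[i]).
Let A := aD s e a.

Definition dcoef (k : 'I_m.+1) : R[i] := (0 +i* (2 * pi)) ^- k * a k.

(** The polynomial [q] for which [lambda - a(D) = q (d/dx)]. *)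
Definition cpoly l : {poly R[i]} := l%:P - \poly_(k < m.+1) dcoef (inord k).

(** As [m >= 1], the constant [l] does not meet the leading coefficient, which is a nonzero multiple
    of [a ord_max]. *)
Lemma size_cpoly l : size (cpoly l) = m.+1.
Proof.
rewrite /cpoly addrC; have sp : size (\poly_(k < m.+1) dcoef (inord k)) = m.+1.
  rewrite size_poly_eq//= (_ : inord m = ord_max); last first.
    by apply: val_inj; rewrite /= inordK.
  rewrite /dcoef mulf_neq0// invr_eq0 expf_eq0/= eq_complex/= eqxx/= mulf_eq0.
  by rewrite pnatr_eq0/= gt_eqF ?pi_gt0// andbF.
rewrite size_polyDl size_polyN sp//.
by apply: (leq_ltn_trans (size_polyC_leq1 _)); rewrite ltnS.
Qed.

Lemma polyD_cpoly l f x : polyD (cpoly l) f x = l * f x - fdiff dcoef f x.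
Proof.
rewrite (@polyD_widen _ _ _ _ m.+1) ?size_cpoly// /fdiff.
under eq_bigr => k _ do rewrite coefB coefC coef_poly ltn_ord inord_val mulrBl.
rewrite big_split/= sumrN; congr (_ - _).
rewrite big_ord_recl/= cderiv_0 big1 ?addr0// => k _.
by rewrite mul0r.
Qed.

Lemma sch_polyD l f : sch f -> sch (polyD (cpoly l) f).
Proof.
move=> hf; rewrite (_ : polyD _ f = fun x => l * f x + (-1) * fdiff dcoef f x).
  by apply: schD; apply: schZ => //; exact: sch_fdiff.
by apply/funext => x; rewrite polyD_cpoly mulN1r.
Qed.

Lemma sch_test_cintegrable f (phi : test I) : sch f -> cintegrable (fun x => f x * phi x).
Proof. by move=> hf; apply: cl2_cintegrable (sch_cl2 0 hf) (test_sch phi). Qed.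

Lemma shifted_dist l f : sch f ->
  shifted A l (@dist_of_fun R I f) = @dist_of_fun R I (polyD (cpoly l) f).
Proof.
move=> hf; rewrite /shifted /= /opD dist_fdiff//; apply/funext => phi.
rewrite -[LHS]/(l * cint (fun x => f x * phi x) - cint (fun x => fdiff dcoef f x * phi x)).
have i1 := sch_test_cintegrable phi hf.
have i2 := sch_test_cintegrable phi (sch_fdiff dcoef hf).
rewrite -cintZ// -cintB//; last exact: cintegrableZ.
by apply: eq_cint => x; rewrite polyD_cpoly; ring.
Qed.

Lemma dom_opD u : op_dom A u -> Hloc s I (op_fun A u).
Proof.
move=> /dom_restrict[T hT ->]; rewrite /= /opD diff_op_restrict.
by apply: Hloc_restrict; have := Hs_tdiff (fun k => dcoef k * (-1) ^+ k) hT; rewrite addrK.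
Qed.

Lemma test_extend K y : smooth_on setT y ->
  exists f : test I, forall x, exh_left e K < x < exh_right e K -> f x = y x.
Proof.
move=> sy; exists (Test (test_pred_mul (exh_fun e K) sy)) => x /andP[x1 x2] /=; rewrite exh_eq1 ?mul1r//.
by rewrite in_itv/= !ltW.
Qed.

Lemma local_solution l K f : smooth_on setT f -> exists phi : test I,
  forall x, exh_left e K < x < exh_right e K -> polyD (cpoly l) phi x = f x.
Proof.
move=> sf; have q0 : cpoly l != 0 by rewrite -size_poly_gt0 size_cpoly.
pose N := `|exh_left e K| + `|exh_right e K| + 1.
have N0 : 0 < N by rewrite ltr_wpDl.
have [y sy hy] := polyD_solution hB q0 N0 sf.
have [phi hphi] := test_extend K sy; exists phi => x hx.
have oU : open `]exh_left e K, exh_right e K[%classic by exact: interval_open.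
rewrite (polyD_local _ (sch_smooth (test_sch phi)) sy oU); last 2 first.
- by move=> z; rewrite /= in_itv/=; exact: hphi.
- by rewrite /= in_itv.
apply: hy; rewrite /N ltr_norml; move/andP: hx => [x1 x2]; apply/andP; split.
  have := ler_norm (- exh_left e K); rewrite normrN => h1.
  by have := normr_ge0 (exh_right e K); lra.
have := ler_norm (exh_right e K) => h1.
by have := normr_ge0 (exh_left e K); lra.
Qed.

Lemma exh_fun_inner j K x : (j.+1 < K)%N -> exh_fun e j x != 0 ->
  exh_left e K < x < exh_right e K.
Proof.
case: K => // K jK /exh_fun_support /andP[/ltW x1 /ltW x2].
have hx : exh_left e j.+1 <= x <= exh_right e j.+1 by rewrite x1.
have := @exh_nested _ _ e K x; rewrite /= !in_itv/=; apply.
exact: exhaustion_mono hx.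
Qed.

Lemma tmul_bounds J : exists2 B, 0 < B & forall j T, (j <= J)%N -> Hs s T ->
  Hs_norm s (tmul (exh_fun e j) T) <= B * Hs_norm s T.
Proof.
have H j : exists M, 0 <= M /\ forall T, Hs s T ->
    Hs_norm s (tmul (exh_fun e j) T) <= M * Hs_norm s T.
  by have [M M0 h] := tmul_norm hB s (exh_fun e j); exists M.
pose M j := projT1 (cid (H j)).
have HM j : 0 <= M j /\ forall T, Hs s T ->
    Hs_norm s (tmul (exh_fun e j) T) <= M j * Hs_norm s T := projT2 (cid (H j)).
have [B B0 hBM] := max_bound M J; exists B => // j T jJ hT.
apply: le_trans ((HM j).2 T hT) _; rewrite ler_wpM2r ?Hs_norm_ge0//.
exact: hBM.
Qed.

(** The seminorms of index at most [J] see [u] only through [v], because [exh_fun e J.+1] is 1 on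
    the supports of the earlier cut-offs. [v] is approximated by a Schwartz function [f0], and the
    equation with right-hand side [f0] is solved on an interval containing those supports. *)
Lemma range_dense l : closure (shifted_range A l) = setT.
Proof.
apply/seteqP; split=> // x _ U /(Hloc_nbhsP hB)[J [rho [rho0 hU]]].
pose u : test I -> C := lcs_val x; have hu : Hloc s I u := set_valP x.
pose v := cutoff (exh_fun e J.+1) u; have hv : Hs s v := hu.2 _.
(* The cut-off of the next index fixes [v], so that the representative of [v] is smooth and can be
   truncated. *)
have idv : tmul (exh_fun e J.+2) v = v.
  by rewrite /v tmulC cutoff_absorb// => z; exact: exh_fun_absorb.
have [B B0 hBd] := tmul_bounds J.
have [f0 hf0 lt] := Hs_smooth_approx hB hv idv (divr_gt0 rho0 B0).
have [f hf] := local_solution l J.+2 (sch_smooth hf0).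
have hz := sch_polyD l (test_sch f).
pose z := @lcs_pt R (Hloc_space s e) _ (@Hloc_dist R I s _ hz).
exists z; split.
  by exists (dist_of_fun f); [exact: dom_test|rewrite shifted_dist//; exact: test_sch].
apply: hU => j jJ.
have -> : pj e s j (lcs_val z - lcs_val x) =
    Hs_norm s (tmul (exh_fun e j) (fun chi => -1 * v chi + tempered_of_fun f0 chi)).
  rewrite /pj; congr (Hs_norm s _); apply/funext => chi.
  have E1 : cutoff (exh_fun e j) u chi = tmul (exh_fun e j) v chi.
    by rewrite /v cutoff_absorb// => t; apply: exh_fun_absorb; rewrite ltnS.
  rewrite -[LHS]/(cutoff (exh_fun e j) (@dist_of_fun R I (polyD (cpoly l) f)) chi -
    cutoff (exh_fun e j) u chi) E1.
  rewrite -[RHS]/(-1 * tmul (exh_fun e j) v chi + cutoff (exh_fun e j) (@dist_of_fun R I f0) chi).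
  rewrite mulN1r addrC !cutoff_dist; congr (_ + _); apply: eq_cint => t.
  have [->|nz] := eqVneq (exh_fun e j t) 0; first by rewrite !mul0r.
  by rewrite hf//; apply: exh_fun_inner nz; rewrite ltnS.
have hD : Hs s (fun chi => -1 * v chi + tempered_of_fun f0 chi).
  by apply: Hs_lin => //; exact: Hs_tempered_of_fun.
apply: le_lt_trans (hBd j _ jJ hD) _.
by rewrite mulrC -ltr_pdivlMr.
Qed.

End range_of_operator.

(** * Discontinuity of the inverse *)

Section inverse_of_operator.
Context {R : realType}.
Local Notation C := (R[i]^o).
Local Notation mu := (@lebesgue_measure R).
Variables (I : set R) (e : exhaustion I) (s : R) (m : nat) (a : 'I_m.+1 -> R[i]).
Hypotheses (m1 : (1 <= m)%N) (am : a ord_max != 0).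
Variables (b : R -> R) (d : R).
Hypothesis hB : bump b d.
Implicit Types (f y : R -> C) (g h : schwartz R -> C) (u : test I -> C) (l : R[i]).
Let A := aD s e a.

(** A vanishing norm would make the product vanish almost everywhere, but on the first interval of
    the exhaustion, of positive length, it is an exponential. *)
Lemma cutoff_exp_norm_gt0 r : 0 < Hs_norm s (tempered_of_fun (fun x => exh_fun e 0 x * cexp r x)).
Proof.
have hw := sch_test_mul (exh_fun e 0) (cexp_smooth r).1.
set w := (fun x => _) in hw *.
rewrite lt_neqAle Hs_norm_ge0 andbT eq_sym; apply/negP => /eqP n0.
have z := Hs_norm0_eq0 hB (Hs_tempered_of_fun s hw) n0.
have az : {ae mu, forall x, w x = 0}.
  by apply: (cl2_ae0 hB (sch_cl2 0 hw)) => psi hpsi; exact: z (mks hpsi).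
have nz : mu.-negligible (`[exh_left e 0, exh_right e 0]%classic : set R).
  apply: negligibleS az => x hx /= wx0; have /eqP := wx0.
  by rewrite /w exh_eq1 ?inE// mul1r (negbTE (cexp_neq0 r x)).
have : mu `[exh_left e 0, exh_right e 0]%classic = 0%E.
  by apply: (@measure_negligible _ _ _ mu) nz; exact: measurable_itv.
rewrite lebesgue_measure_itv/= lte_fin exh_lt => /eqP.
by rewrite -EFinB eqe subr_eq0 gt_eqF// exh_lt.
Qed.

Lemma inverse_not_continuous l : ~ shifted_inverse_continuous A l.
Proof.
move=> [S [hS cS]].
have [r /rootP qr] : exists r, root (cpoly a l) r.
  by apply/closed_rootP; rewrite size_cpoly// eqSS -lt0n.
have h0 : sch ((0 : test I) : R -> C) by exact: test_sch.
pose u0 := @lcs_pt R (Hloc_space s e) _ (@Hloc_dist R I s _ h0).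
pose y0 := @lcs_pt R (Hloc_space s e) _ (@Hloc_dist R I s _ (sch_polyD m1 am l h0)).
have du0 : op_dom A (lcs_val u0) by exact: dom_test.
have S0 : S y0 = u0 by apply: hS => //; rewrite shifted_dist.
have r0 : shifted_range A l y0 by exists (lcs_val u0) => //; rewrite shifted_dist.
have cS0 := (subspace_continuousP _ _).1 cS y0 r0.
have := cS0 _ (pj_ball_nbhs hB 0 (S y0) ltr01).
move=> /(Hloc_nbhsP hB)[J [rho [rho0 hJ]]].
pose n0 := Hs_norm s (tempered_of_fun (fun x => exh_fun e 0 x * cexp r x)).
have n0p : 0 < n0 by exact: cutoff_exp_norm_gt0.
(* Normalizes the exponential so that its seminorm of index 0 is exactly 1, which excludes it from
   the open unit ball around [S y0], the zero distribution. *)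
pose t : R[i] := (n0^-1)%:C.
have sce := (cexp_smooth r).1.
have [f hf] := test_extend e J.+2 (smoothZ t sce).
have hsf : sch f by exact: test_sch.
have hqf := sch_polyD m1 am l hsf.
pose u1 := @lcs_pt R (Hloc_space s e) _ (@Hloc_dist R I s _ hsf).
pose y1 := @lcs_pt R (Hloc_space s e) _ (@Hloc_dist R I s _ hqf).
have S1 : S y1 = u1.
  by apply: hS; [exact: dom_test|rewrite shifted_dist].
have r1 : shifted_range A l y1.
  by exists (dist_of_fun f); [exact: dom_test|rewrite shifted_dist].
have q0 x : polyD (cpoly a l) (0 : test I) x = 0.
  by rewrite /polyD; apply: big1 => k _; rewrite (_ : (0 : test I) = 0 :> (R -> C))// cderiv0 mulr0.
have qf x : exh_left e J.+2 < x < exh_right e J.+2 -> polyD (cpoly a l) f x = 0.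
  move=> hx; have oU : open `]exh_left e J.+2, exh_right e J.+2[%classic by exact: interval_open.
  rewrite (polyD_local _ (sch_smooth hsf) (smoothZ t sce) oU); last 2 first.
  - by move=> z; rewrite /= in_itv/=; exact: hf.
  - by rewrite /= in_itv.
  rewrite /polyD; under eq_bigr => k _ do rewrite cderivZ// mulrCA.
  by rewrite -mulr_sumr -/(polyD (cpoly a l) (cexp r) x) polyD_cexp qr mul0r mulr0.
have small j : (j <= J)%N -> pj e s j (lcs_val y1 - lcs_val y0) < rho.
  move=> jJ; rewrite /pj (_ : cutoff _ _ = fun chi => 0 * tempered_of_fun f chi).
    by rewrite (Hs_normZ hB)//; [rewrite normc0 mul0r|exact: Hs_tempered_of_fun].
  apply/funext => chi; rewrite mul0r.
  rewrite -[LHS]/(cutoff (exh_fun e j) (@dist_of_fun R I (polyD (cpoly a l) f)) chi -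
    cutoff (exh_fun e j) (@dist_of_fun R I (polyD (cpoly a l) (0 : test I))) chi).
  rewrite !cutoff_dist /tempered_of_fun.
  apply/eqP; rewrite subr_eq0; apply/eqP; apply: eq_cint => x.
  have [->|nz] := eqVneq (exh_fun e j x) 0; first by rewrite !mul0r.
  by rewrite q0 qf// ; apply: exh_fun_inner nz; rewrite ltnS.
have : pj e s 0 (lcs_val (S y1) - lcs_val (S y0)) < 1 := hJ y1 small r1.
rewrite S0 S1 /pj.
rewrite (_ : cutoff _ _ = fun chi => t * tempered_of_fun (fun x => exh_fun e 0 x * cexp r x) chi).
  rewrite (Hs_normZ hB) /t ?normc_real ?gtr0_norm ?invr_gt0//.
    by rewrite -/n0 mulVf ?ltxx// gt_eqF.
  by apply: Hs_tempered_of_fun; exact: sch_test_mul.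
apply/funext => chi.
rewrite -[LHS]/(cutoff (exh_fun e 0) (@dist_of_fun R I f) chi -
  cutoff (exh_fun e 0) (@dist_of_fun R I (0 : test I)) chi) !cutoff_dist.
have -> : tempered_of_fun (fun x => exh_fun e 0 x * (0 : test I) x) chi = 0.
  by rewrite -[RHS](@cint0 R); apply: eq_cint => x; rewrite mulr0 mul0r.
have ie : cintegrable (fun x => exh_fun e 0 x * cexp r x * chi x).
  by apply: cl2_cintegrable (sch_cl2 0 (sch_test_mul _ sce)) (schwartz_sch chi).
rewrite subr0 /tempered_of_fun -cintZ//; apply: eq_cint => x.
have [->|nz] := eqVneq (exh_fun e 0 x) 0; first by rewrite !mul0r mulr0.
by rewrite hf; [ring|apply: exh_fun_inner nz].
Qed.

End inverse_of_operator.

(** * Existence of the values of the adjoint *)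

Section values_of_adjoint.
Context {R : realType}.
Local Notation C := (R[i]^o).
Variables (I : set R) (e : exhaustion I) (s : R) (m : nat) (a : 'I_m.+1 -> R[i]).
Hypotheses (m1 : (1 <= m)%N) (am : a ord_max != 0).
Variables (b : R -> R) (d : R).
Hypothesis hB : bump b d.
Implicit Types (f y : R -> C) (g h : schwartz R -> C) (u : test I -> C) (l : R[i]).
Let A := aD s e a.
Let A' := adjoint A.

Lemma closed_dsupport g : closed (dsupport g).
Proof.
apply: open_closedC; rewrite openE => x [V [oV Vx hV]].
by rewrite /interior nbhsE /=; exists V => // z Vz; exists V.
Qed.

Lemma dsupport_tdiff (c : 'I_m.+1 -> R[i]) g : dsupport (tdiff c g) `<=` dsupport g.
Proof.
apply: subsetC => x [V [oV Vx hV]]; exists V; split=> // phi.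
rewrite /dist_restrict /tdiff big1// => k _.
have := hV (test_deriv k phi); rewrite /dist_restrict.
have -> : test_schwartz (test_deriv k phi) = mks (sch_cderiv k (schwartz_sch (test_schwartz phi))).
  exact: schwartz_ext.
by move=> ->; rewrite mulr0.
Qed.

Lemma fdiff_test (c : 'I_m.+1 -> R[i]) (phi : test I) : exists psi : test I, forall x, psi x = fdiff c phi x.
Proof.
exists (\sum_(k < m.+1) c k *: test_deriv k phi) => x; rewrite /fdiff.
elim: (index_enum _) => [|k r IH]; first by rewrite !big_nil.
by rewrite !big_cons -IH.
Qed.

(** This singles out the candidate for the value of the adjoint at [g]: the transposed operator
    applied to [g]. *)
Lemma pairing_opD_test g (f : test I) : Hc (- s) I g ->
  pairing s g (op_fun A (dist_of_fun f)) = tdiff (dcoef a) g (test_schwartz f).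
Proof.
move=> hg; have hf := sch_fdiff (dcoef a) (test_sch f).
have [psi hpsi] := fdiff_test (dcoef a) f.
rewrite /= /opD dist_fdiff; last exact: test_sch.
rewrite (_ : fdiff _ _ = psi); last by apply/funext => x; rewrite hpsi.
apply: etrans (pairing_test hB e psi hg) _.
have [[[lg _] _] _ _] := hg.
have E := @tdiffE R m (dcoef a) g (test_schwartz f) hf lg.
apply: etrans (esym E); congr g.
by apply: schwartz_ext => x; rewrite /= hpsi.
Qed.

Lemma adjoint_near g u (r : R) : op_dom A' g -> op_dom A u -> 0 < r ->
  exists (J : nat) (rho : R), 0 < rho /\ forall z, op_dom A z ->
    (forall j, (j <= J)%N -> pj e s j (z - u) < rho) ->
    normc (pairing s g (op_fun A u) - pairing s g (op_fun A z)) < r.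
Proof.
move=> [hg cg] du r0.
pose u' := @lcs_pt R (Hloc_space s e) u (dom_Hloc du).
have := (subspace_continuousP _ _).1 cg u' du.
have rC : (0 : R[i]) < r%:C by rewrite ltcR.
move=> /cvgrPdist_lt /(_ _ rC) /(Hloc_nbhsP hB)[J [rho [rho0 hJ]]].
exists J, rho; split=> // z dz hz.
have := hJ (@lcs_pt R (Hloc_space s e) z (dom_Hloc dz)) hz dz.
by rewrite -ltcR.
Qed.

(** Continuity at 0 makes the functional smaller than 1 on some neighbourhood. If the bound failed
    at [chi], the multiple of [chi] where the functional has modulus 1, cut off near the support of
    [h], would lie in that neighbourhood. *)
Lemma adjoint_bounded g : op_dom A' g -> exists2 C0 : R, 0 <= C0 & forall chi : schwartz R,
  normc (tdiff (dcoef a) g chi) <= C0 * Hs_norm s (tempered_of_fun chi).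
Proof.
move=> dg; have hg := dg.1; set h := tdiff _ g.
have hh : Hs (- s - m%:R) h by case: hg => [hg _ _]; exact: Hs_tdiff.
have lh : linear h := hh.1.1.
have [J [rho [rho0 hJ]]] := adjoint_near dg (@dom_test R I e s m a 0) ltr01.
have [_ cpt sI] := hg.
have cph : compact (dsupport h).
  by apply: subclosed_compact cpt _; [exact: closed_dsupport|exact: dsupport_tdiff].
have [k hk] := compact_exhaustion e cph (subset_trans (@dsupport_tdiff _ g) sI).
have idh : tmul (exh_fun e k) h = h by apply: (tmul_id hB hh.1); exact: hk.
have [B1 B10 hB1] := tmul_bounds e s hB J; have [B2 B20 hB2] := tmul_norm hB s (exh_fun e k).
(* [B2] is the cost of the cut-off near the support of [h], [B1] that of the cut-offs in the
   seminorms up to [J], and [rho] the radius of the neighbourhood. *)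
pose Q := B1 * B2 / rho.
have Q0 : 0 <= Q by rewrite /Q divr_ge0 ?mulr_ge0// ?ltW.
exists Q => // chi; rewrite leNgt; apply/negP => lt.
have hp : 0 < normc (h chi) by apply: le_lt_trans lt; rewrite mulr_ge0// Hs_norm_ge0.
pose t : R[i] := ((normc (h chi))^-1)%:C.
have nt : normc t = (normc (h chi))^-1 by rewrite normc_real ger0_norm// invr_ge0 ltW.
pose f := test_mul (exh_fun e k) (t *: chi).
have hc : Hs s (tempered_of_fun chi) by apply: Hs_tempered_of_fun; exact: schwartz_sch.
have := hJ (dist_of_fun f) (dom_test _ _ _ _).
rewrite !pairing_opD_test//.
have h0 := linear_at0 lh.
have -> : tdiff (dcoef a) g (test_schwartz f) = t * h chi.
  by rewrite -[LHS]/(tmul (exh_fun e k) h (t *: chi)) idh -[t *: chi]addr0 lh h0 addr0.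
have -> : tdiff (dcoef a) g (test_schwartz (0 : test I)) = 0.
  by rewrite -[RHS]h0; congr h; exact: schwartz_ext.
rewrite sub0r normcN normcM nt mulVf ?gt_eqF// ltxx => small.
suff : false by []. 
apply: small => j jJ.
have -> : pj e s j (@dist_of_fun R I f - dist_of_fun (0 : test I)) =
    Hs_norm s (fun c' => t * tmul (exh_fun e j) (tmul (exh_fun e k) (tempered_of_fun chi)) c').
  rewrite /pj; congr (Hs_norm s _); apply/funext => c'.
  have ie : cintegrable (fun x => chi x * (exh_fun e k x * (exh_fun e j x * c' x))).
    apply: cl2_cintegrable (sch_cl2 0 (schwartz_sch chi)) _.
    by apply: sch_test_mul; apply/sch_smooth/sch_test_mul/sch_smooth; exact: schwartz_sch.
  rewrite -[LHS]/(cint (fun x => exh_fun e k x * (t * chi x) * (exh_fun e j x * c' x)) -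
    cint (fun x => 0 * (exh_fun e j x * c' x))).
  rewrite -[RHS]/(t * cint (fun x => chi x * (exh_fun e k x * (exh_fun e j x * c' x)))).
  rewrite -cintZ// (_ : cint (fun x => 0 * _) = 0).
    by rewrite subr0; apply: eq_cint => x; ring.
  by rewrite -[RHS](@cint0 R); apply: eq_cint => x; rewrite mul0r.
have h1 := Hs_tmul (exh_fun e k) hc; have h2 := Hs_tmul (exh_fun e j) h1.
rewrite (Hs_normZ hB)// nt mulrC ltr_pdivrMr//.
apply: (@le_lt_trans _ _ (B1 * (B2 * Hs_norm s (tempered_of_fun chi)))).
  by apply: le_trans (hB1 _ _ jJ h1) _; apply: ler_wpM2l (hB2 _ hc); exact: ltW.
by move: lt; rewrite /Q mulrAC ltr_pdivrMr// mulrA [_ * rho]mulrC.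
Qed.

(** A priori [h] has order [- s - m]. Its support is compact, so [W] is smooth, and the continuity
    of the functional improves the order to [- s]. *)
Lemma tdiff_Hc g : op_dom A' g -> Hc (- s) I (tdiff (dcoef a) g).
Proof.
move=> dg; have hg := dg.1; set h := tdiff _ g.
have hh : Hs (- s - m%:R) h by case: hg => [hg _ _]; exact: Hs_tdiff.
have [_ cpt sI] := hg.
have cph : compact (dsupport h).
  by apply: subclosed_compact cpt _; [exact: closed_dsupport|exact: dsupport_tdiff].
have shI := subset_trans (@dsupport_tdiff (dcoef a) g) sI.
split=> //; split; first exact: hh.1.
have [k hk] := compact_exhaustion e cph shI.
have idh : tmul (exh_fun e k) h = h by apply: (tmul_id hB hh.1); exact: hk.
have [w hw] := hh.2; have hF := sch_fourier (test_sch (exh_fun e k)).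
have hW := tmul_frep (exh_fun e k) hw; rewrite idh in hW.
set W := conv _ w in hW; have cW := frep_cl2 hW.
have sW : smooth_on setT W by exact: conv_smooth hF (frep_cl2 hw).
have [Q Q0 hQ] := adjoint_bounded dg.
suff cs : cl2 (- s) W by exists W; apply: frepI => // chi; exact: frep_eval hW.
apply: (cl2_of_bounded_functional hB sW cW (M := Q)) => psi hpsi.
(* At [fourier psi] the functional [h] is the integral of [W * psi], and by inversion the [H^s] norm
   of [fourier psi] is the weighted norm of [psi] reflected. *)
have hf := sch_fourier hpsi; have [_ _ EW] := hW.
have := hQ (mks hf); rewrite -/h (EW (mks hpsi) (mks hf) erefl) /=.
rewrite (Hs_normE hB (tempered_of_fun_repr s hf)).
have [_ <-] := cl2_opp (sch_cl2 s hpsi).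
by rewrite (_ : fourier (fourier psi) = fun x => psi (- x))//; apply/funext => x; exact: fourier_inversion.
Qed.

(** It suffices that some element has the required property, for [xget] then returns one. The
    identity holds on test functions and extends to the domain by approximation: pairing with [h] is
    bounded by a seminorm, and the functional of [g] is continuous on the domain. *)
Lemma adjoint_value g : op_dom A' g -> Hc (- s) I (op_fun A' g) /\
  forall u, op_dom A u -> pairing s (op_fun A' g) u = pairing s g (op_fun A u).
Proof.
move=> dg; have hg := dg.1.
suff ex : exists h, Hc (- s) I h /\ forall u, op_dom A u -> pairing s h u = pairing s g (op_fun A u).
  by have [h0 hh0] := ex; exact: (xgetPex 0 ex).
have hh := tdiff_Hc dg; exists (tdiff (dcoef a) g); split; [exact: hh|move=> u du].
set h := tdiff _ g in hh *.
have [k [c [c0 hc]]] := pairing_bound hB e hh.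
apply: contrapT => /eqP; rewrite -subr_eq0 -normc_gt0.
set r := normc _ => rp; have r0 : 0 < r / 2 by rewrite divr_gt0.
have [J [rho [rho0 hJ]]] := adjoint_near dg du r0.
have c1 : 0 < c + 1 by rewrite ltr_wpDl.
(* One tolerance for both errors: [rho] controls the functional of [g], the other term the pairing
   with [h]; [c + 1] is positive even if [c] is 0. *)
have t0 : 0 < Num.min rho (r / 2 / (c + 1)) by rewrite lt_min rho0 divr_gt0.
have [phi hphi] := dom_approx hB (maxn J k) du t0.
have dphi := @dom_test R I e s m a phi.
have hr : normc (pairing s g (op_fun A u) - pairing s g (op_fun A (dist_of_fun phi))) < r / 2.
  apply: hJ => // j jJ; have := hphi j (leq_trans jJ (leq_maxl _ _)).
  by rewrite lt_min => /andP[].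
have hu := dom_Hloc du; have hp := dom_Hloc dphi.
have hup := Hloc_lin (-1) hu hp.
have := hc _ hup; rewrite (pairing_linr hB e hh hu hp hup) (pairing_test hB e phi hh).
rewrite -[h _](pairing_opD_test phi hg) => h1.
have h2 := hphi k (leq_maxr _ _); rewrite lt_min in h2; case/andP: h2 => _ h2.
rewrite (_ : dist_of_fun phi - u = -1 *: u + dist_of_fun phi) in h2; last by rewrite scaleN1r addrC.
have h3 : normc (-1 * pairing s h u + pairing s g (op_fun A (dist_of_fun phi))) < r / 2.
  apply: le_lt_trans h1 _.
  apply: (@le_lt_trans _ _ ((c + 1) * Hs_norm s (cutoff (exh_fun e k) (-1 *: u + dist_of_fun phi)))).
    by rewrite ler_wpM2r ?Hs_norm_ge0// lerDl.
  by rewrite mulrC -ltr_pdivlMr.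
have : r < r / 2 + r / 2; last by rewrite -splitr ltxx.
apply: le_lt_trans (ltrD h3 hr).
apply: le_trans (le_normcD _ _); rewrite le_eqVlt; apply/orP; left; apply/eqP.
rewrite -[RHS]normcN /r.
move: (pairing s h u) (pairing s g (op_fun A u)) (pairing s g (op_fun A _)) => X Y Z.
by congr normc; rewrite mulN1r addrACA subrr addr0 opprD opprK.
Qed.

End values_of_adjoint.

(** * Injectivity and range of the shifted adjoint *)

Section spectrum_of_adjoint.
Context {R : realType}.
Local Notation C := (R[i]^o).
Variables (I : set R) (e : exhaustion I) (s : R) (m : nat) (a : 'I_m.+1 -> R[i]).
Hypotheses (m1 : (1 <= m)%N) (am : a ord_max != 0).
Variables (b : R -> R) (d : R).
Hypothesis hB : bump b d.
Implicit Types (f y : R -> C) (g h : schwartz R -> C) (u : test I -> C) (l : R[i]).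
Let A := aD s e a.
Let A' := adjoint A.

Lemma shifted_adjoint_test l g (f : test I) (hq : sch (polyD (cpoly a l) f)) : op_dom A' g ->
  shifted A' l g (test_schwartz f) = g (mks hq).
Proof.
move=> dg; have hg := dg.1; have [hh ph] := adjoint_value hB dg.
have hf := sch_fdiff (dcoef a) (test_sch f); have [[[lg _] _] _ _] := hg.
have dphi := @dom_test R I e s m a f.
rewrite -[LHS]/(l * g (test_schwartz f) - op_fun A' g (test_schwartz f)).
rewrite -(pairing_test hB e f hh) (ph _ dphi) (pairing_opD_test e a hB f hg).
rewrite (@tdiffE R m (dcoef a) g (test_schwartz f) hf lg).
have -> : mks hq = (-1) *: mks hf + (l *: test_schwartz f + 0).
  apply: schwartz_ext => x; rewrite [LHS](polyD_cpoly m1 am).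
  rewrite -[RHS]/(-1 * fdiff (dcoef a) f x + (l * f x + 0)).
  by rewrite addr0 mulN1r addrC.
have g0 := linear_at0 lg.
by rewrite !lg g0 addr0 scaleN1r addrC.
Qed.

(** For [chi] given, [f] solves [(lambda - a(D)) f = chi] where [theta] is nonzero. As [theta] fixes
    [g], the value [g chi] equals that of the image of [g] at [f], so the image determines [g]. *)
Lemma adjoint_shifted_injective l : shifted_injective A' l.
Proof.
move=> g1 g2 /set_mem d1 /set_mem d2 E.
have [[t1 _] cp1 s1] := d1.1; have [[t2 _] cp2 s2] := d2.1.
have [k1 h1] := compact_exhaustion e cp1 s1; have [k2 h2] := compact_exhaustion e cp2 s2.
pose k := maxn k1 k2; pose theta := exh_fun e k.
have i1 : tmul theta g1 = g1 by apply: (tmul_id hB t1); apply: h1; exact: leq_maxl.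
have i2 : tmul theta g2 = g2 by apply: (tmul_id hB t2); apply: h2; exact: leq_maxr.
apply/funext => chi.
have [f hf] := local_solution e m1 am hB l k.+2 (sch_smooth (schwartz_sch chi)).
have hq := sch_polyD m1 am l (test_sch f).
have key g : tmul theta g = g -> op_dom A' g -> g chi = shifted A' l g (test_schwartz f).
  move=> ig dg; rewrite (shifted_adjoint_test hq dg) -ig.
  rewrite -[LHS]/(g (test_schwartz (test_mul theta chi))).
  rewrite -[RHS]/(g (test_schwartz (test_mul theta (mks hq)))).
  congr g; apply: schwartz_ext => x /=.
  have [->|nz] := eqVneq (theta x) 0; first by rewrite !mul0r.
  by congr (_ * _); apply/esym/hf; exact: exh_fun_inner nz.
by rewrite (key g1 i1 d1) (key g2 i2 d2) E.
Qed.

Lemma pairing_sub l g h u : Hc (- s) I g -> Hc (- s) I h -> Hloc s I u ->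
  pairing s (fun chi => l * g chi - h chi) u = l * pairing s g u - pairing s h u.
Proof.
(* Linearity is available in the form [c g + g'], so [- h] is produced as [- 2 h + h]. *)
move=> hg hh hu; have h2 := Hc_lin (- 2) hh hh.
have := pairing_lin hB e l hg h2 hu; rewrite (pairing_lin hB e (- 2) hh hh hu).
have -> : (fun chi => l * g chi + (- 2 * h chi + h chi)) = (fun chi => l * g chi - h chi).
  by apply/funext => chi; ring.
by move=> ->; move: (pairing s g u) (pairing s h u) => X Y; ring.
Qed.

Lemma pairing_subr l g u (v : test I -> C) : Hc (- s) I g -> Hloc s I u -> Hloc s I v ->
  pairing s g (l *: u - v) = l * pairing s g u - pairing s g v.
Proof.
move=> hg hu hv; have h2 := Hloc_lin (- 2) hv hv.
have := pairing_linr hB e hg hu h2 (Hloc_lin l hu h2); rewrite (pairing_linr hB e hg hv hv h2).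
have -> : l *: u + (- 2 *: v + v) = l *: u - v.
  by apply/funext => chi; rewrite -[LHS]/(l * u chi + (- 2 * v chi + v chi)) -[RHS]/(l * u chi - v chi); ring.
by move=> ->; move: (pairing s g u) (pairing s g v) => X Y; ring.
Qed.

(** The eigenvector is the difference of two elements of the domain with equal images. Keeping the
    pair lets the adjoint identity be applied to each of them. *)
Lemma adjoint_range_annihilates l g u1 u2 : op_dom A' g -> op_dom A u1 -> op_dom A u2 ->
  shifted A l u1 = shifted A l u2 -> pairing s (shifted A' l g) (-1 *: u2 + u1) = 0.
Proof.
move=> dg d1 d2 E; have hu1 := dom_Hloc d1; have hu2 := dom_Hloc d2.
have hu := Hloc_lin (-1) hu2 hu1; have hg := dg.1; have [hh ph] := adjoint_value hB dg.
apply: etrans (pairing_sub l hg hh hu) _.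
rewrite (pairing_linr hB e hg hu2 hu1 hu) (pairing_linr hB e hh hu2 hu1 hu) (ph _ d1) (ph _ d2).
have := congr1 (pairing s g) E.
rewrite [LHS](pairing_subr l hg hu1 (dom_opD d1)) [RHS](pairing_subr l hg hu2 (dom_opD d2)).
have alg (z1 z2 y1 y2 : R[i]) : l * z1 - y1 = l * z2 - y2 -> l * (-1 * z2 + z1) - (-1 * y2 + y1) = 0.
  by move=> /eqP; rewrite -subr_eq0 => /eqP; apply: etrans; ring.
exact: alg.
Qed.

Lemma weak_ballE (theta : test I) u (hu : Hloc s I u) (r : R) (y : Hc_space s I) :
  lcs_ball (exist _ u (mem_set hu) : lcs_index (Hc_space s I)) (@lcs_pt R (Hc_space s I) _ (Hc_test s theta)) r y =
  (normc (pairing s (lcs_val y) u - u theta) < r) :> Prop.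
Proof.
have hy : Hc (- s) I (lcs_val y) := set_valP y.
have := pairing_sub 1 hy (Hc_test s theta) hu.
rewrite mul1r (pairing_fun hB e theta hu) => <-.
rewrite (_ : (fun chi => _) = lcs_val y - tempered_of_fun theta)//.
by apply/funext => chi; rewrite mul1r.
Qed.

(** A nonzero [u] takes a nonzero value at some [theta]. The weak* ball around [theta] defined by
    [u], with radius [|u theta|], misses the range, on which pairing with [u] gives 0. *)
Lemma eigenvector_range l : ~ shifted_injective A l -> closure (shifted_range A' l) <> setT.
Proof.
move=> ninj cl; apply: ninj => u1 u2 /set_mem d1 /set_mem d2 E.
have hu : Hloc s I (-1 *: u2 + u1) := Hloc_lin (-1) (dom_Hloc d2) (dom_Hloc d1).
suff u0 theta : (-1 *: u2 + u1) theta = 0.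
  apply/funext => theta; apply/eqP; rewrite -subr_eq0 -(u0 theta).
  by rewrite -[X in _ == X]/(-1 * u2 theta + u1 theta) mulN1r addrC.
set u := -1 *: u2 + u1 in hu *; apply: contrapT => /eqP; rewrite -normc_gt0 => r0.
pose g0 := @lcs_pt R (Hc_space s I) _ (Hc_test s theta).
have n0 : nbhs g0 (lcs_ball (exist _ u (mem_set hu) : lcs_index (Hc_space s I)) g0 (normc (u theta))).
  by apply: lcs_ball_nbhs; rewrite // weak_ballE (pairing_fun hB e theta hu) subrr normc0.
have : closure (shifted_range A' l) g0 by rewrite cl.
move=> /(_ _ n0)[y [[g dg Ey]]]; rewrite weak_ballE -Ey.
by rewrite [pairing _ _ _](adjoint_range_annihilates dg d1 d2 E) sub0r normcN ltxx.
Qed.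

End spectrum_of_adjoint.

Theorem theorem2p8 (R : realType) (I : set R) (e : exhaustion I) (s : R)
    (m : nat) (a : 'I_m.+1 -> R[i]) :
  open I -> is_interval I -> (1 <= m)%N -> a ord_max != 0 ->
  hypoelliptic (@opD_transpose R I m a) ->
  let A := aD s e a in
  let A' := adjoint A in
  [/\ sigma_p A `|` sigma_r A `<=` sigma_p A' `|` sigma_r A',
      sigma_p A' `<=` sigma_p A `|` sigma_r A &
      sigma_r A' `<=` sigma_p A `|` sigma_c A].
Proof.
move=> _ _ m1 am _ A A'; have [b [d hB]] := exhaustion_bump e.
have iA' l : shifted_injective A' l by exact (@adjoint_shifted_injective R I e s m a m1 am b d hB l).
split=> [l [pA|[_ /(_ (range_dense e s m1 am hB l))//]]|l pA'|l _].
- by right; split; [exact: iA'|exact: (eigenvector_range hB pA)].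
- by case: pA'; exact: iA'.
- have [iA|nA] := pselect (shifted_injective A l); last by left.
  right; split; [exact: iA|exact: (range_dense e s m1 am hB l)|].
  exact: (inverse_not_continuous m1 am hB).
Qed.
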